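(* Let $\Omega\subset\mathbb{R}^n$ be open, let $\phi$ be a phase function of order $\mu$ on $\Omega\times\mathbb{R}^s$ and let $a\in S^{\infty}(\Omega,s)$. Then the wave front set of the distribution $D_\phi(a)\in\mathcal{D}'(\Omega)$ is contained in $\mathrm{SP}(\phi)$.
   Context: Symbols: for an open set $\Omega\subset\mathbb{R}^n$ and $m\in\mathbb{R}$, $S^{m}(\Omega,s)$ is the set of (smooth) functions $a:\Omega\times\mathbb{R}^s\to\mathbb{C}$ such that for each compact $K\subset\Omega$ and all multiindices $\alpha,\beta$, $$\|a\|_{\alpha\beta K} = \sup_{x\in K,\,\theta\in\mathbb{R}^s} |(D_x^\alpha D_\theta^\beta a)(x,\theta)|\,(1+|\theta|)^{|\beta|-m} < \infty ,$$ equipped with these seminorms; its elements are called symbols of order $m$. $S^{\infty}(\Omega,s)=\bigcup_m S^m(\Omega,s)$. Phase functions: a phase function of order $\mu$ on $\Omega\times\mathbb{R}^s$ is a function $\phi:\Omega\times\mathbb{R}^s\to\mathbb{R}$ such that (1) $\phi$ is a symbol of order $\mu>0$; (2) for each compact $K\subset\Omega$ there are positive $C,D$ such that $|\nabla_x\phi(x,\theta)|^2+|\theta|^2|\nabla_\theta\phi(x,\theta)|^2\ge C|\theta|^{2\mu}$ for all $|\theta|\ge D$, $x\in K$. Oscillatory integrals: $D_\phi: S^\infty(\Omega,s)\to\mathcal{D}'(\Omega)$ is the unique map such that $D_\phi(a)(x)=\int_{\mathbb{R}^s} a(x,\theta)e^{i\phi(x,\theta)}\,\mathrm{d}^s\theta$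 when $a\in S^m(\Omega,s)$ for some $m<-s$, and such that $D_\phi:S^m(\Omega,s)\to\mathcal{D}'(\Omega)$ is continuous for all $m$. Write $\dot{\mathbb{R}}^n=\mathbb{R}^n\setminus\{0\}$ and let $\sphericalangle(v,w)$ denote the angle between two vectors $v,w\in\mathbb{R}^n$. Define $$\mathrm{M}(\phi)=\{(x,\theta)\in\Omega\times\dot{\mathbb{R}}^s \mid \nexists\, C,D>0 \text{ s.t. } |\nabla_\theta\phi(x,\lambda\theta)|\ge C\lambda^{\mu-1}\ \forall\lambda>D\},$$ $$\mathrm{SP}(\phi)=\{(x,k)\in\Omega\times\dot{\mathbb{R}}^n \mid \exists\,(x,\theta)\in \mathrm{M}(\phi)\text{ s.t. }\nexists\,\alpha,D>0\text{ s.t. }\sphericalangle(\nabla_x\phi(x,\lambda\theta),k)\ge\alpha\ \forall\lambda>D\}.$$ The wave front set is defined with the Fourier transform convention $\hat u(k)=\int e^{-ik\cdot x}u(x)\,\mathrm{d}^nx$. *)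

(* Defs.v *)
From HB Require Import structures.
From mathcomp Require Import all_boot all_order all_algebra.
From mathcomp Require Import all_classical all_reals all_analysis.
From mathcomp Require Import complex.

Set Implicit Arguments.
Unset Strict Implicit.
Unset Printing Implicit Defensive.
Import Order.TTheory GRing.Theory Num.Theory.
Import numFieldNormedType.Exports.

Local Open Scope classical_set_scope.
Local Open Scope ring_scope.
Local Open Scope complex_scope.

Section lebesgue_tuple.
Context {R : realType}.
Local Notation mR := (measurableTypeR R).

Definition tcons n (p : mR * n.-tuple mR) : n.+1.-tuple mR :=
  [the n.+1.-tuple mR of p.1 :: p.2].

Definition tuncons n (t : n.+1.-tuple mR) : mR * n.-tuple mR :=
  (thead t, [tuple of behead t]).

Lemma tconsK n : cancel (@tcons n) (@tuncons n).
Proof. by case=> x t; congr (_, _); apply/val_inj. Qed.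

Lemma measurable_tcons n : measurable_fun [set: mR * n.-tuple mR] (@tcons n).
Proof. exact: (measurable_cons measurable_fst measurable_snd). Qed.

Lemma measurable_tuncons n : measurable_fun [set: n.+1.-tuple mR] (@tuncons n).
Proof.
apply/measurable_fun_pairP; split => /=; first exact: measurable_tnth.
exact: measurable_behead.
Qed.

(* Lebesgue measure on R^n, as the n-fold product measure; it is carried by
   tuples because row vectors have no measurable structure. *)
Fixpoint lebesgue_tuple n : set (n.-tuple mR) -> \bar R :=
  match n with
  | 0 => \d_ [tuple]
  | n'.+1 => pushforward (lebesgue_measure \x lebesgue_tuple (n := n'))%E
                         (@tcons n')
  end.

Section lebesgue_step.
Context n (mu : {sigma_finite_measure set (n.-tuple mR) -> \bar R}).

Definition lebesgue_step :=
  pushforward (@lebesgue_measure R \x mu)%E (@tcons n).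

Let mstep : {measure set (n.+1.-tuple mR) -> \bar R}.
Proof.
refine (pushforward (@lebesgue_measure R \x mu)%E (@tcons n)).
exact: measurable_tcons.
Defined.

HB.instance Definition _ := isMeasure.Build _ _ _ lebesgue_step
  (@measure0 _ _ _ mstep) (@measure_ge0 _ _ _ mstep)
  (@measure_semi_sigma_additive _ _ _ mstep).

Let step_sigma_finite : sigma_finite setT lebesgue_step.
Proof.
have /sigma_finiteP[F [TF ndF Foo]] := sigma_finiteT (@lebesgue_measure R).
have /sigma_finiteP[G [TG ndG Goo]] := sigma_finiteT mu.
exists (fun k => @tuncons n @^-1` (F k `*` G k)).
  rewrite -preimage_bigcup [X in _ @^-1` X](_ : _ = setT) ?preimage_setT//.
  apply/seteqP; split => // -[x y] _.
  have [i _ Fx] : (\bigcup_i F i) x by rewrite -TF.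
  have [j _ Gy] : (\bigcup_i G i) y by rewrite -TG.
  exists (maxn i j) => //; split => /=.
    by move: x Fx; exact/subsetPset/ndF/leq_maxl.
  by move: y Gy; exact/subsetPset/ndG/leq_maxr.
move=> k; have [mF Fk] := Foo k; have [mG Gk] := Goo k; split.
  rewrite -[X in measurable X]setTI; apply: measurable_tuncons => //.
  exact: measurableX.
rewrite /lebesgue_step /pushforward -comp_preimage.
rewrite (_ : _ \o _ = id) ?preimage_id; last first.
  by apply/funext => x /=; rewrite tconsK.
by rewrite product_measure1E// lte_mul_pinfty// ge0_fin_numE.
Qed.

HB.instance Definition _ := Measure_isSigmaFinite.Build _ _ _ lebesgue_step
  step_sigma_finite.

End lebesgue_step.

Lemma lebesgue_tuple_is_measure n :
  exists mu : {sigma_finite_measure set (n.-tuple mR) -> \bar R},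
    @lebesgue_tuple n = mu.
Proof.
elim: n => [|n [mu IHn]]; first by exists \d_ [tuple].
by exists (lebesgue_step mu); rewrite /= IHn.
Qed.

Section lebesgue_tuple_instances.
Variable n : nat.

Let measure_of : {measure set (n.-tuple mR) -> \bar R}
  := sval (cid (lebesgue_tuple_is_measure n)).

Let measure_ofE : measure_of = @lebesgue_tuple n :> (set _ -> _).
Proof. by rewrite /measure_of; case: cid. Qed.

Let lebesgue_tuple0 : @lebesgue_tuple n set0 = 0%E.
Proof. by rewrite -measure_ofE. Qed.

Let lebesgue_tuple_ge0 A : (0 <= @lebesgue_tuple n A)%E.
Proof. by rewrite -measure_ofE. Qed.

Let lebesgue_tuple_sigma_additive : semi_sigma_additive (@lebesgue_tuple n).
Proof. by rewrite -measure_ofE; exact: measure_semi_sigma_additive. Qed.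

HB.instance Definition _ := isMeasure.Build _ _ _ (@lebesgue_tuple n)
  lebesgue_tuple0 lebesgue_tuple_ge0 lebesgue_tuple_sigma_additive.

Let lebesgue_tuple_sigma_finite : sigma_finite setT (@lebesgue_tuple n).
Proof. by have [mu ->] := lebesgue_tuple_is_measure n; exact: sigma_finiteT. Qed.

HB.instance Definition _ := Measure_isSigmaFinite.Build _ _ _ (@lebesgue_tuple n)
  lebesgue_tuple_sigma_finite.

End lebesgue_tuple_instances.

Lemma lebesgue_tuple_box n (A : 'I_n -> set mR) :
  (forall i, measurable (A i)) ->
  @lebesgue_tuple n [set t | forall i, A i (tnth t i)] =
  (\prod_(i < n) lebesgue_measure (A i))%E.
Proof.
elim: n A => [|n IHn] A mA.
  by rewrite big_ord0 /= diracE mem_set// => -[].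
rewrite big_ord_recl -IHn => [|i]; last exact: mA.
have mB : measurable [set t : n.-tuple mR | forall i, A (lift ord0 i) (tnth t i)].
  rewrite (_ : [set _ | _] = \bigcap_i
      ((fun t : n.-tuple mR => tnth t i) @^-1` A (lift ord0 i))); last first.
    by apply/seteqP; split => t /= At i; [move=> _; exact: At|exact: At].
  apply: fin_bigcap_measurable => [|i _]; first exact: finite_finset.
  by rewrite -[X in measurable X]setTI; exact: (@measurable_tnth _ mR n i measurableT _ (mA _)).
rewrite -product_measure1E; [|exact: mA|exact: mB].
rewrite /= /pushforward; congr (product_measure1 _ _ _).
apply/seteqP; split => -[x t] /=.
  move=> H; split => /=; first exact: (H ord0).
  by move=> i; have := H (lift ord0 i); rewrite tnthS.
move=> [Ax At] i; case: (unliftP ord0 i) => [j ->|->] //.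
by rewrite tnthS.
Qed.

End lebesgue_tuple.

Section vectors.
Context {R : realType}.

Definition dotp n (v w : 'rV[R]_n) : R := \sum_(i < n) v 0 i * w 0 i.

(* The canonical norm `|v| of 'rV[R]_n is the sup norm. *)
Definition enorm n (v : 'rV[R]_n) : R := Num.sqrt (dotp v v).

(* If v = 0 or w = 0, the quotient is 0 and the angle is pi / 2. *)
Definition angle n (v w : 'rV[R]_n) : R :=
  acos (dotp v w / (enorm v * enorm w)).

End vectors.

Section calculus.
Context {R : realType}.

Definition cabs (z : R[i]) : R := complex.Re `|z|.

Definition expi (t : R) : R[i] := cos t +i* sin t.

Section derivatives.
Context {V : normedModType R}.
Implicit Types (f : V -> R[i]) (vs : seq V).

Definition re_fun f : V -> R^o := fun x => complex.Re (f x).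
Definition im_fun f : V -> R^o := fun x => complex.Im (f x).

Definition cderive (v : V) f : V -> R[i] :=
  fun x => ('D_v (re_fun f) x : R) +i* ('D_v (im_fun f) x : R).

Definition cderives vs f : V -> R[i] := foldr cderive f vs.

Definition smooth_on (U : set V) f :=
  forall vs x, U x ->
    differentiable (re_fun (cderives vs f)) x /\
    differentiable (im_fun (cderives vs f)) x.

End derivatives.

Definition unitv n (i : 'I_n) : 'rV[R]_n := delta_mx 0 i.

Definition mi_deg n (alpha : 'I_n -> nat) : nat := (\sum_(i < n) alpha i)%N.

Definition mi_seq n (alpha : 'I_n -> nat) : seq 'I_n :=
  flatten [seq nseq (alpha i) i | i <- enum 'I_n].

Definition partials n (alpha : 'I_n -> nat) (f : 'rV[R]_n -> R[i]) :=
  cderives [seq unitv i | i <- mi_seq alpha] f.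

Definition cintegral n (A : set 'rV[R]_n) (f : 'rV[R]_n -> R[i]) : R[i] :=
  let row_of (t : n.-tuple (measurableTypeR R)) := \row_i tnth t i in
  Rintegral (@lebesgue_tuple R n) (row_of @^-1` A)
    (fun t => complex.Re (f (row_of t))) +i*
  Rintegral (@lebesgue_tuple R n) (row_of @^-1` A)
    (fun t => complex.Im (f (row_of t))).

End calculus.

Section symbols.
Context {R : realType} (n s : nat) (Omega : set 'rV[R]_n).
Local Notation X := ('rV[R]_n * 'rV[R]_s)%type.
Implicit Types (m mu : R) (a : X -> R[i]) (phi : X -> R).
Implicit Types (alpha : 'I_n -> nat) (beta : 'I_s -> nat).

Definition dirx (i : 'I_n) : X := (unitv i, 0).
Definition dirt (j : 'I_s) : X := (0, unitv j).

(* Up to a unimodular constant, D_x^alpha D_theta^beta a, as D = -i d. *)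
Definition xt_partials alpha beta a : X -> R[i] :=
  cderives ([seq dirx i | i <- mi_seq alpha] ++ [seq dirt j | j <- mi_seq beta])
    a.

Definition symbol_seminorm m alpha beta (K : set 'rV[R]_n) a : \bar R :=
  ereal_sup [set (cabs (xt_partials alpha beta a p) *
      (1 + enorm p.2) `^ ((mi_deg beta)%:R - m))%:E
    | p in K `*` [set: 'rV[R]_s]].

Definition symbol m a :=
  smooth_on (Omega `*` [set: 'rV[R]_s]) a /\
  forall alpha beta (K : set 'rV[R]_n), compact K -> K `<=` Omega ->
    (symbol_seminorm m alpha beta K a < +oo)%E.

Definition symbol_any a := exists m, symbol m a.

Definition grad_x phi (p : X) : 'rV[R]_n :=
  \row_i ('D_(dirx i) (phi : X -> R^o) p : R).
Definition grad_theta phi (p : X) : 'rV[R]_s :=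
  \row_j ('D_(dirt j) (phi : X -> R^o) p : R).

Definition phase_function mu phi :=
  [/\ 0 < mu, symbol mu (fun p => (phi p)%:C) &
  forall K : set 'rV[R]_n, compact K -> K `<=` Omega ->
    exists C D : R, [/\ 0 < C, 0 < D &
      forall x theta, K x -> D <= enorm theta ->
        C * enorm theta `^ (2 * mu) <=
          enorm (grad_x phi (x, theta)) ^+ 2 +
          enorm theta ^+ 2 * enorm (grad_theta phi (x, theta)) ^+ 2]].

Definition M_set mu phi : set X :=
  [set p | [/\ Omega p.1, p.2 != 0 &
    ~ exists C D : R, [/\ 0 < C, 0 < D &
      forall lam, D < lam ->
        C * lam `^ (mu - 1) <= enorm (grad_theta phi (p.1, lam *: p.2))]]].

Definition SP_set mu phi : set ('rV[R]_n * 'rV[R]_n) :=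
  [set q | [/\ Omega q.1, q.2 != 0 &
    exists theta, M_set mu phi (q.1, theta) /\
      ~ exists alpha D : R, [/\ 0 < alpha, 0 < D &
        forall lam, D < lam ->
          alpha <= angle (grad_x phi (q.1, lam *: theta)) q.2]]].

End symbols.

Section distributions.
Context {R : realType} (n : nat) (Omega : set 'rV[R]_n).
Implicit Types (f g chi : 'rV[R]_n -> R[i]) (u : ('rV[R]_n -> R[i]) -> R[i]).

Definition supp f : set 'rV[R]_n := closure [set x | f x != 0].

Definition test_function f :=
  [/\ smooth_on [set: 'rV[R]_n] f, compact (supp f) & supp f `<=` Omega].

(* Only the values of u on test functions are meaningful.  The last clause is
   |u f| <= C sup_(|alpha| <= N) sup |d^alpha f|. *)
Definition distribution u :=
  (forall (c : R[i]) f g, test_function f -> test_function g ->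
    u (fun x => c * f x + g x) = c * u f + u g) /\
  (forall K, compact K -> K `<=` Omega -> exists (C : R) (N : nat),
    forall f (B : R), test_function f -> supp f `<=` K ->
      (forall alpha x, (mi_deg alpha <= N)%N -> cabs (partials alpha f x) <= B) ->
      cabs (u f) <= C * B).

(* The Fourier transform int e^(- i k . x) (chi u)(x) dx of the compactly
   supported distribution chi u. *)
Definition cutoff_fourier chi u (k : 'rV[R]_n) : R[i] :=
  u (fun x => chi x * expi (- dotp k x)).

Definition wave_front_set u : set ('rV[R]_n * 'rV[R]_n) :=
  [set q | [/\ Omega q.1, q.2 != 0 &
    ~ exists chi (V : set 'rV[R]_n),
      [/\ test_function chi, chi q.1 != 0,
          open V /\ V q.2,
          forall (lam : R) k, 0 < lam -> V k -> V (lam *: k) &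
          forall N : nat, exists C : R, forall k, V k ->
            (1 + enorm k) ^+ N * cabs (cutoff_fourier chi u k) <= C]]].

End distributions.

Section oscillatory.
Context {R : realType} (n s : nat) (Omega : set 'rV[R]_n).
Local Notation X := ('rV[R]_n * 'rV[R]_s)%type.

(* The two properties determining a |-> D_phi(a), S^oo(Omega, s) -> D'(Omega);
   D'(Omega) carries the weak-* topology, and S^m(Omega, s) the topology given
   by the seminorms symbol_seminorm m.  They fix Dphi a f for every symbol a
   and test function f, as symbols of order -oo are dense in S^m(Omega, s) for
   the topology of S^m'(Omega, s), m < m'. *)
Definition oscillatory_integral (phi : X -> R)
    (Dphi : (X -> R[i]) -> ('rV[R]_n -> R[i]) -> R[i]) :=
  [/\ forall a, symbol_any Omega a -> distribution Omega (Dphi a),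
      forall (m : R) a f, m < - s%:R -> symbol Omega m a ->
        test_function Omega f ->
        Dphi a f = cintegral Omega (fun x =>
          cintegral [set: 'rV[R]_s] (fun theta =>
            a (x, theta) * expi (phi (x, theta))) * f x) &
      forall (m : R) a0 f (eps : R), symbol Omega m a0 ->
        test_function Omega f -> 0 < eps ->
        exists (F : set (('I_n -> nat) * ('I_s -> nat) * set 'rV[R]_n))
            (delta : R),
          [/\ finite_set F,
              forall al be K, F (al, be, K) -> compact K /\ K `<=` Omega,
              0 < delta &
              forall a, symbol Omega m a ->
                (forall al be K, F (al, be, K) ->
                  (symbol_seminorm m al be K (fun p => (a p - a0 p)%R) <
                     delta%:E)%E) ->
                cabs (Dphi a f - Dphi a0 f) < eps]].

End oscillatory.

(* Main.v *)
Require Import Defs.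
From mathcomp Require Import all_boot all_order all_algebra.
From mathcomp Require Import all_classical all_reals all_analysis.
From mathcomp Require Import measurable_realfun complex ring lra.
Set Implicit Arguments.
Unset Strict Implicit.
Unset Printing Implicit Defensive.
Import Order.TTheory GRing.Theory Num.Theory.
Import numFieldNormedType.Exports.
Local Open Scope classical_set_scope.
Local Open Scope ring_scope.
Local Open Scope complex_scope.

(** Away from the stationary directions the phase phi(x, theta) - k . x has no
critical point, and integration by parts gains powers of k at will; this is
the method of non-stationary phase.

Let (x0, k0) lie outside SP(phi) and write <theta> = 1 + |theta|.  The geometric
part, [gradient_lower], is the estimate

  |grad_x phi - k|^2 + (1 + |theta|^2) |grad_theta phi|^2
     >= c (<theta>^mu + |k|)^2

for x near x0, k large in a conic neighbourhood of k0, and all theta.  On the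
ray theta = lam w over x0 there are two cases ([msize_pointwise]).  If (x0, w)
is not in M(phi), the theta-gradient controls lam^mu; as grad_x phi is
O(lam^mu), a large k cannot be cancelled by it unless lam^mu is as large.  If
(x0, w) is in M(phi), then grad_x phi(x0, lam w) stays at a positive angle from
k0, so that |grad_x phi - k| controls both |grad_x phi| and |k|, and the second
axiom of phase functions supplies lam^mu.  The second derivatives of phi are
those of a symbol of order mu, so the gradient at (x, lam w') differs from the
gradient at (x0, lam w) by a small multiple of the lower bound
([grad_lipschitz], [msize_local]).  Compactness of the unit sphere makes the
constants uniform ([msize_sphere]).

The analytic part is [nonstationary_decay].  With psi = phi - k . x, divide the
gradient of psi by its squared length: this gives coefficients c_d with
sum_d c_d D_d psi = 1, and integrating by parts moves the field sum_d c_d D_d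
onto the amplitude ([osc_transport]).  Each step divides the size of the
amplitude by <theta>^mu + |k|: the powers of <theta> make the integral converge
absolutely, those of |k| give the decay.  The estimates for the successive
amplitudes are those of a symbol calculus with parameters, the classes
[wclass].

The integral defining D_phi(a) need not converge.  It is approached by the
symbols a(x, theta) kappa(theta / (j + 1)), which are compactly supported in
theta and converge to a in S^(m + 1) ([regularized_close]).  The decay is
uniform in j, hence passes to the limit by continuity of D_phi
([regularized_bound]).  For bounded k it is enough that D_phi(a) is a
distribution ([modulated_partials]).

Complex exponentials are handled by their real and imaginary parts: all the
integrals have the form int int f cos psi + g sin psi. *)

(** * Differentiation in a direction *)

Section calculus.
Context {R : realType} {V : normedModType R}.
Implicit Types (f g : V -> R) (x v w : V) (U : set V).

Let scaleE (a b : R) : a *: (b : R^o) = a * b. Proof. by []. Qed.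

Lemma near_shift0 (P : set V) x : (\forall y \near x, P y) ->
  \forall h \near (0 : V), P (h + x).
Proof.
move=> Px; near=> h; near: h.
have : (fun h : V => h + x) @ (0 : V) --> (0 + x).
  by apply: cvgD; [exact: cvg_id|exact: cvg_cst].
by rewrite add0r => /(_ _ Px).
Unshelve. all: by end_near. Qed.

Lemma differentiable_near_eq f g x : (\forall y \near x, f y = g y) ->
  differentiable f x -> differentiable g x.
Proof.
move=> fg df.
have fgx : f x = g x by exact: (nbhs_singleton fg).
have gE : g \o shift x = cst (g x) + 'd f x +o_ 0 id.
  apply/eqaddoP => e e0.
  have /eqaddoP/(_ e e0) H := diff_locally df.
  have fg0 := near_shift0 fg.
  near=> h.
  have fgh : f (h + x) = g (h + x) by near: h.
  have : `|(f \o shift x - (cst (f x) + 'd f x)) h| <= e * `|h| by near: h.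
  by rewrite !fctE /= fgx fgh.
have dgE := diff_unique (diff_continuous df) gE.
apply/diff_locallyP; rewrite dgE; split; first exact: diff_continuous.
exact: gE.
Unshelve. all: by end_near. Qed.

Lemma derive_near_eq f g x v : (\forall y \near x, f y = g y) ->
  'D_v f x = 'D_v g x.
Proof.
move=> fg; have fgx := nbhs_singleton fg; rewrite /derive.
suff fgE : (\forall h \near (0 : R)^', h^-1 *: ((f \o shift x) (h *: v) - f x) =
        h^-1 *: ((g \o shift x) (h *: v) - g x)).
  congr (lim _); rewrite eqEsubset; split.
    by apply: near_eq_cvg; apply: filterS fgE => h ->.
  by apply: near_eq_cvg; apply: filterS fgE => h ->.
have /= H : \forall h \near (0 : R), f (h *: v + x) = g (h *: v + x).
  have : (fun h : R => h *: v) @ (0 : R) --> (0 *: v).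
    by apply: cvgZl; exact: cvg_id.
  by rewrite scale0r => /(_ _ (near_shift0 fg)).
apply: (filterS _ (nbhs_dnbhs H)) => h /= ->.
by rewrite fgx.
Qed.

Lemma differentiable_mul f g x : differentiable f x -> differentiable g x ->
  differentiable (fun y => f y * g y) x.
Proof. by move=> df dg; exact: differentiableM. Qed.

Lemma differentiable_add f g x : differentiable f x -> differentiable g x ->
  differentiable (fun y => f y + g y) x.
Proof. by move=> df dg; exact: differentiableD. Qed.

Lemma derive_mul f g x v : differentiable f x -> differentiable g x ->
  'D_v (fun y => f y * g y) x = f x * 'D_v g x + g x * 'D_v f x.
Proof. by move=> df dg; rewrite deriveM//; exact: diff_derivable. Qed.

Lemma derive_add f g x v : differentiable f x -> differentiable g x ->
  'D_v (fun y => f y + g y) x = 'D_v f x + 'D_v g x.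
Proof. by move=> df dg; rewrite deriveD//; exact: diff_derivable. Qed.

Lemma differentiable_bigsum (J : Type) (r : seq J) (F : J -> V -> R) p : (forall j, differentiable (F j) p) ->
  differentiable (fun q => \sum_(j <- r) F j q) p.
Proof.
move=> dF; elim: r => [|j r IH].
  rewrite (_ : (fun _ => _) = (fun=> 0)); first exact: differentiable_cst.
  by apply/funext => u; rewrite big_nil.
rewrite (_ : (fun _ => _) = (fun p => F j p + \sum_(j <- r) F j p)); last first.
  by apply/funext => u; rewrite big_cons.
exact: differentiable_add.
Qed.

Lemma derive_scalel (c : R) f x v : differentiable f x ->
  'D_v (fun y => c * f y) x = c * 'D_v f x.
Proof.
move=> df; have dc : differentiable (fun _ : V => c) x by exact: differentiable_cst.
by rewrite derive_mul// derive_cst mulr0 addr0.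
Qed.

Lemma derive_inv f x v : differentiable f x -> f x != 0 ->
  'D_v (fun y => (f y)^-1) x = - ('D_v f x * ((f x)^-1 * (f x)^-1)).
Proof.
move=> df f0; rewrite deriveV//; last exact: diff_derivable.
by rewrite scaleE expr2 invfM mulNr mulrC.
Qed.

Lemma derive_comp (h : R -> R) f x v : differentiable f x ->
  derivable h (f x) 1 -> 'D_v (fun y => h (f y)) x = 'D_1 h (f x) * 'D_v f x.
Proof.
move=> df /derivable1_diffP dh.
rewrite deriveE; last exact: differentiable_comp.
rewrite (diff_comp df dh) /= -[in LHS]deriveE//.
rewrite -[X in 'D_X h _](mulr1 ('d f x v)) -scaleE !deriveE// linearZ /= scaleE.
exact: mulrC.
Qed.

Lemma differentiable_comp1 (h : R -> R) f x : differentiable f x ->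
  derivable h (f x) 1 -> differentiable (fun y => h (f y)) x.
Proof. by move=> df /derivable1_diffP dh; exact: differentiable_comp. Qed.

Lemma derive_dirZ f x (c : R) v : differentiable f x ->
  'D_(c *: v) f x = c * 'D_v f x.
Proof. by move=> df; rewrite !deriveE// linearZ. Qed.

Lemma derive_dir_sum (I : Type) (r : seq I) (P : pred I) (F : I -> V) f x :
  differentiable f x ->
  'D_(\sum_(i <- r | P i) F i) f x = \sum_(i <- r | P i) 'D_(F i) f x.
Proof.
move=> df; rewrite !deriveE// linear_sum.
by apply: eq_bigr => i _; rewrite deriveE.
Qed.

Lemma open_near U x : open U -> U x -> \forall y \near x, U y.
Proof. by move=> oU Ux; apply: open_nbhs_nbhs; split. Qed.

Lemma is_derive_line f x v (s : R) : differentiable f (x + s *: v) ->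
  is_derive s 1 (fun t : R => f (x + t *: v)) ('D_v f (x + s *: v)).
Proof.
move=> df; have dv := diff_derivable (v := v) df.
have H : (fun h : R => h^-1 *: (((fun t : R => f (x + t *: v)) \o shift s) (h *: 1) -
     f (x + s *: v))) = (fun h => h^-1 *: ((f \o shift (x + s *: v)) (h *: v) - f (x + s *: v))).
  apply/funext => h /=; congr (_ *: (f _ - _)).
  by rewrite [h%:A]mulr1 scalerDl addrCA.
apply: DeriveDef; first by rewrite /derivable H.
by rewrite /derive H.
Qed.

(** The mean value theorem, as a first-order expansion with remainder point on
the segment. *)
Lemma mvt_line f x v (b : R) : 0 < b ->
  (forall s, 0 <= s <= b -> differentiable f (x + s *: v)) ->
  exists2 s, 0 < s < b & f (x + b *: v) - f x = b * 'D_v f (x + s *: v).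
Proof.
move=> b0 df.
have H s : s \in `]0, b[ -> is_derive s 1 (fun t : R => f (x + t *: v)) ('D_v f (x + s *: v)).
  rewrite in_itv/= => /andP[s0 sb]; apply: is_derive_line; apply: df.
  by rewrite !ltW.
have C : {within `[0, b], continuous (fun t : R => f (x + t *: v))}.
  apply: derivable_within_continuous => s.
  rewrite in_itv/= => /df /is_derive_line [//].
have [s /[!in_itv]/= s0b E] := MVT b0 H C.
exists s => //.
by move: E; rewrite scale0r addr0 subr0 mulrC.
Qed.

Lemma continuous_agree (A B : V -> R) x :
  {for x, continuous A} -> {for x, continuous B} ->
  (forall d : R, 0 < d -> exists y1 y2, [/\ ball x d y1, ball x d y2 & A y1 = B y2]) ->
  A x = B x.
Proof.
move=> cA cB H.
apply/eqP; rewrite -subr_eq0 -normr_le0; apply/ler_addgt0Pl => e e0.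
rewrite addr0.
have e2 : 0 < e / 2 by rewrite divr_gt0.
have /cvgrPdist_lt/(_ _ e2) HA := cA.
have /cvgrPdist_lt/(_ _ e2) HB := cB.
have HAB : nbhs x [set y | `|A x - A y| < e / 2 /\ `|B x - B y| < e / 2].
  by apply: filterS2 HA HB.
have {HAB}[d d0 Hd] := (nbhs_ballP _ _).1 HAB.
have [y1 [y2 [b1 b2 E]]] := H _ d0.
have [n1 _] := Hd _ b1; have [_ n2] := Hd _ b2.
have -> : A x - B x = (A x - A y1) - (B x - B y2) by rewrite E; ring.
rewrite (splitr e).
by apply: (le_trans (ler_normB _ _)); apply: lerD; exact: ltW.
Qed.

Lemma derive_translate f x a v : 'D_v (fun y => f (y + a)) x = 'D_v f (x + a).
Proof.
rewrite /derive; set F := fun h => _; set F' := fun h => _.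
suff -> : F = F' by [].
by apply/funext => h; rewrite /F /F' /= addrA.
Qed.

Lemma differentiable_translate f x a : differentiable f (x + a) ->
  differentiable (fun y => f (y + a)) x.
Proof.
move=> df; have dsh : differentiable (fun y : V => y + a) x.
  by apply: differentiableD => //; exact: differentiable_cst.
exact: (differentiable_comp dsh).
Qed.

(** Two applications of the mean value theorem write the second difference of f
over the parallelogram h v, h w as a mixed derivative at some point of it.  The
same difference with v and w exchanged gives the other mixed derivative. *)
Lemma second_difference f x v w (h : R) (P : set V) : 0 < h ->
  (forall s t, 0 <= s <= h -> 0 <= t <= h -> P (x + s *: v + t *: w)) ->
  (forall y, P y -> differentiable f y) ->
  (forall y, P y -> differentiable ('D_v f) y) ->
  exists2 y, P y & f (x + h *: v + h *: w) - f (x + h *: v) -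
    (f (x + h *: w) - f x) = h * (h * 'D_w ('D_v f) y).
Proof.
move=> h0 B df dv.
have hh : 0 <= h <= h by rewrite lexx ltW.
have Bv s : 0 <= s <= h -> P (x + s *: v).
  by move=> hs; have := B s 0 hs; rewrite scale0r addr0; apply; rewrite lexx ltW.
have df1 s : 0 <= s <= h -> differentiable (fun y => f (y + h *: w)) (x + s *: v).
  by move=> hs; apply: differentiable_translate; exact/df/B.
have df2 s : 0 <= s <= h -> differentiable f (x + s *: v).
  by move=> hs; exact/df/Bv.
have [s /andP[s0 sh]] := @mvt_line (fun y => f (y + h *: w) - f y) x v h h0
   (fun s hs => differentiableB (df1 s hs) (df2 s hs)).
have hs : 0 <= s <= h by rewrite !ltW.
rewrite deriveB; [|exact/diff_derivable/df1|exact/diff_derivable/df2].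
rewrite derive_translate => E1.
have [t /andP[t0 th] E2] := @mvt_line ('D_v f) (x + s *: v) w h h0
   (fun t ht => dv _ (B s t hs ht)).
have ht : 0 <= t <= h by rewrite !ltW.
exists (x + s *: v + t *: w); first exact: B.
by rewrite -E2 -E1.
Qed.

(** Both mixed derivatives are values of the same second difference, at points
tending to x; continuity then identifies them at x. *)
Lemma schwarz f x v w U : open U -> U x ->
  (forall y, U y -> differentiable f y) ->
  (forall y, U y -> differentiable ('D_v f) y) ->
  (forall y, U y -> differentiable ('D_w f) y) ->
  {for x, continuous ('D_w ('D_v f))} ->
  {for x, continuous ('D_v ('D_w f))} ->
  'D_w ('D_v f) x = 'D_v ('D_w f) x.
Proof.
move=> oU Ux df dv dw cwv cvw; apply: continuous_agree cwv cvw _ => d' d'0.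
have [d'' d''0 HU] := (nbhs_ballP _ _).1 (open_near oU Ux).
pose d := Num.min d' d''.
have d0 : 0 < d by rewrite lt_min d'0.
pose P y := ball x d y.
pose M := `|v| + `|w| + 1.
have M0 : 0 < M by rewrite ltr_wpDl// addr_ge0.
(* the parallelogram of sides h v, h w must stay in the ball of radius d *)
pose h := d / (M * 2).
have h0 : 0 < h by rewrite divr_gt0// mulr_gt0.
have B s t : 0 <= s <= h -> 0 <= t <= h -> P (x + s *: v + t *: w).
  move=> /andP[s0 sh] /andP[t0 th]; rewrite /P -ball_normE /ball_/=.
  rewrite -addrA opprD addrA subrr sub0r normrN.
  apply: (le_lt_trans (ler_normD _ _)); rewrite !normrZ !ger0_norm//.
  apply: (@le_lt_trans _ _ (h * `|v| + h * `|w|)).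
    by apply: lerD; apply: ler_wpM2r.
  rewrite -mulrDr; apply: (@lt_le_trans _ _ (h * M)).
    by rewrite ltr_pM2l// ltrDl.
  have -> : h * M = d / 2 by rewrite /h; field; rewrite gt_eqF.
  by rewrite ler_pdivrMr// ler_peMr ?ltW// ltr1n.
have PU y : P y -> U y.
  by move=> Py; apply: HU; apply: le_ball Py; rewrite ge_min lexx orbT.
have B' s t : 0 <= s <= h -> 0 <= t <= h -> P (x + s *: w + t *: v).
  by move=> hs ht; rewrite addrAC; exact: B.
have [y1 By1 E1] := second_difference h0 B (fun y Py => df _ (PU _ Py))
  (fun y Py => dv _ (PU _ Py)).
have [y2 By2 E2] := second_difference h0 B' (fun y Py => df _ (PU _ Py))
  (fun y Py => dw _ (PU _ Py)).
exists y1, y2; split.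
- by apply: le_ball By1; rewrite ge_min lexx.
- by apply: le_ball By2; rewrite ge_min lexx.
move: E1 E2; rewrite [x + h *: w + h *: v]addrAC.
move: ('D_w ('D_v f) y1) ('D_v ('D_w f) y2) => a b E1 E2.
apply: (mulfI (lt0r_neq0 h0)); apply: (mulfI (lt0r_neq0 h0)).
rewrite -E1 -E2.
by move: (f _) (f _) (f _) (f _) => *; ring.
Qed.
End calculus.

(** * Symbol classes with parameters *)
Section weighted_classes.
Context {R : realType} {V : normedModType R} {I : finType} (bd : I -> V)
  (om : I -> V -> R) {T : Type} (U B : T -> set V).
Hypothesis om0 : forall d p, 0 <= om d p.
Hypothesis oU : forall t, open (U t).
Hypothesis BU : forall t, B t `<=` U t.
Implicit Types (w f g : T -> V -> R).

(** The common shape of all estimates below.  Each function of the family f is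
differentiable l times on U and satisfies, on B and uniformly in the parameter,
|D_(d1) .. D_(dq) f| <= C w om_(d1) .. om_(dq) for q <= l.  With om = 1 for the
directions of x and om = <theta>^-1 for those of theta, and w = <theta>^m, these
are the symbol estimates of order m.  B is kept apart from U since the
derivatives exist on an open set while the bounds are wanted on a compact
one. *)
Fixpoint wclass (l : nat) w f : Prop :=
  (exists C : R, forall t p, B t p -> `|f t p| <= C * w t p) /\
  if l is l'.+1 then
    (forall t p, U t p -> differentiable (f t) p) /\
    forall d, wclass l' (fun t p => w t p * om d p) (fun t => 'D_(bd d) (f t))
  else True.

Lemma wclass_bound l w f : wclass l w f ->
  exists C : R, forall t p, B t p -> `|f t p| <= C * w t p.
Proof. by case: l => [|l] []. Qed.

Lemma wclass_le l w w' f :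
  (exists2 c : R, 0 <= c & forall t p, B t p -> `|w t p| <= c * w' t p) ->
  wclass l w f -> wclass l w' f.
Proof.
elim: l w w' f => [|l IH] w w' f [c c0 ww'] [[C HC] H];
  have b : exists D : R, forall t p, B t p -> `|f t p| <= D * w' t p by
    exists (`|C| * c) => t p Bp; apply: (le_trans (HC _ _ Bp));
    rewrite (le_trans (ler_norm _))// normrM -mulrA ler_wpM2l// ww'.
  by split.
have [d1 d2] := H; split => //; split => // d; apply: IH (d2 d).
exists c => // t p Bp; rewrite normrM (ger0_norm (om0 _ _)) mulrA.
by apply: ler_wpM2r => //; exact: ww'.
Qed.

Lemma wclass_eqw l w w' f : (forall t p, B t p -> w t p = w' t p) ->
  (forall t p, B t p -> 0 <= w t p) -> wclass l w f -> wclass l w' f.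
Proof.
move=> ww' w0; apply: wclass_le; exists 1 => // t p Bp.
by rewrite mul1r -ww'// ger0_norm// w0.
Qed.

Lemma wclassS l w f : wclass l.+1 w f -> wclass l w f.
Proof.
elim: l w f => [|l IH] w f [H1 [H2 H3]]; first by split.
by split=> //; split=> // d; apply: IH; exact: H3.
Qed.

Lemma wclass_differentiable l w f t p : wclass l.+1 w f -> U t p ->
  differentiable (f t) p.
Proof. by move=> [_ [H _]]; exact: H. Qed.

Lemma wclass_derive l w f d : wclass l.+1 w f ->
  wclass l (fun t p => w t p * om d p) (fun t => 'D_(bd d) (f t)).
Proof. by move=> [_ [_ H]]; exact: H. Qed.

Lemma wclass_ext l w f g : (forall t p, U t p -> f t p = g t p) ->
  wclass l w f -> wclass l w g.
Proof.
elim: l w f g => [|l IH] w f g fg [[C HC] H].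
  by split=> //; exists C => t p Bp; rewrite -fg; [exact: HC|exact: BU].
have fgn t p : U t p -> \forall y \near p, f t y = g t y.
  move=> Up; apply: filterS (open_near (@oU t) Up) => y Uy; exact: fg.
split; first by exists C => t p Bp; rewrite -fg; [exact: HC|exact: BU].
case: H => H1 H2; split => [t p Up|d].
  by apply: (differentiable_near_eq (fgn _ _ Up)); exact: H1.
apply: IH (H2 d) => t p Up.
by apply: derive_near_eq; exact: fgn.
Qed.

Lemma wclass_cst l w (c : T -> R) :
  (exists C : R, forall t p, B t p -> `|c t| <= C * w t p) ->
  (forall t p, B t p -> 0 <= w t p) -> wclass l w (fun t _ => c t).
Proof.
elim: l w c => [|l IH] w c [C HC] w0; first by split=> //; exists C.
split; first by exists C.
split => [t p _|d]; first exact: differentiable_cst.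
apply: (@wclass_ext _ _ (fun _ _ => 0)) => [t p _|]; first by rewrite derive_cst.
apply: IH; last by move=> t p Bp; rewrite mulr_ge0// w0.
by exists 0 => t p _; rewrite normr0 mul0r.
Qed.

Lemma wclass_add l w f g : wclass l w f -> wclass l w g ->
  wclass l w (fun t p => f t p + g t p).
Proof.
elim: l w f g => [|l IH] w f g [[C HC] H] [[D HD] K].
  by split=> //; exists (C + D) => t p Bp; rewrite mulrDl (le_trans (ler_normD _ _))// lerD ?HC ?HD.
split.
  by exists (C + D) => t p Bp; rewrite mulrDl (le_trans (ler_normD _ _))// lerD ?HC ?HD.
have [H1 H2] := H; have [K1 K2] := K; split => [t p Up|d].
  by apply: differentiable_add; [exact: H1|exact: K1].
apply: (wclass_ext _ (IH _ _ _ (H2 d) (K2 d))) => t p Up.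
by rewrite derive_add//; [exact: H1|exact: K1].
Qed.

Lemma wclass_mul l w w' f g : wclass l w f -> wclass l w' g ->
  wclass l (fun t p => w t p * w' t p) (fun t p => f t p * g t p).
Proof.
elim: l w w' f g => [|l IH] w w' f g Hf Hg.
  have [[C HC] _] := Hf; have [[D HD] _] := Hg.
  split=> //; exists (C * D) => t p Bp; rewrite normrM mulrACA.
  by apply: ler_pM => //; [exact: HC|exact: HD].
have [[C HC] [H1 H2]] := Hf; have [[D HD] [K1 K2]] := Hg; split.
  exists (C * D) => t p Bp; rewrite normrM mulrACA.
  by apply: ler_pM => //; [exact: HC|exact: HD].
split => [t p Up|d].
  by apply: differentiable_mul; [exact: H1|exact: K1].
apply: (@wclass_ext _ _ (fun t p => f t p * 'D_(bd d) (g t) p +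
    g t p * 'D_(bd d) (f t) p)) => [t p Up|].
  by rewrite derive_mul//; [exact: H1|exact: K1].
apply: wclass_add.
  have := IH _ _ _ _ (wclassS Hf) (K2 d).
  by rewrite (_ : (fun t p => w t p * (w' t p * om d p)) =
    (fun t p => w t p * w' t p * om d p))//; apply/funext => t; apply/funext => p;
    rewrite mulrA.
have := IH _ _ _ _ (wclassS Hg) (H2 d).
by rewrite (_ : (fun t p => w' t p * (w t p * om d p)) =
  (fun t p => w t p * w' t p * om d p))//; apply/funext => t; apply/funext => p;
  rewrite mulrA [w' t p * _]mulrC.
Qed.

Lemma wclass_scale l w f (c : R) : wclass l w f ->
  wclass l w (fun t p => c * f t p).
Proof.
move=> Hf; have Hc : wclass l (fun _ _ => 1) (fun _ _ => c).
  by apply: wclass_cst => //; exists `|c| => t p _; rewrite mulr1.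
have := wclass_mul Hc Hf.
by rewrite (_ : (fun t p => 1 * w t p) = w)//; apply/funext => t;
  apply/funext => p; rewrite mul1r.
Qed.

Lemma wclass_opp l w f : wclass l w f -> wclass l w (fun t p => - f t p).
Proof.
move=> /(wclass_scale (-1)); apply: wclass_ext => t p _.
by rewrite mulN1r.
Qed.

Lemma wclass_sum l w (J : Type) (r : seq J) (P : pred J) (F : J -> T -> V -> R) :
  (forall t p, B t p -> 0 <= w t p) ->
  (forall j, wclass l w (F j)) ->
  wclass l w (fun t p => \sum_(j <- r | P j) F j t p).
Proof.
move=> w0 HF; elim: r => [|j r IHr].
  have H0 : wclass l w (fun _ _ => 0).
    by apply: wclass_cst => //; exists 0 => t p _; rewrite normr0 mul0r.
  by apply: (wclass_ext _ H0) => t p _; rewrite big_nil.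
case Pj : (P j).
  by apply: (wclass_ext _ (wclass_add (HF j) IHr)) => t p _; rewrite big_cons Pj.
by apply: (wclass_ext _ IHr) => t p _; rewrite big_cons Pj.
Qed.

(** The derivative of 1/f is - D f (1/f)^2, so the class of the inverse follows
by induction from products once f is elliptic: bounded below by its weight. *)
Lemma wclass_inv l w f : wclass l w f -> (forall t p, U t p -> f t p != 0) ->
  (forall t p, B t p -> 0 < w t p) ->
  (exists2 c : R, 0 < c & forall t p, B t p -> c * w t p <= `|f t p|) ->
  wclass l (fun t p => (w t p)^-1) (fun t p => (f t p)^-1).
Proof.
move=> Hf f0 w0 [c c0 Hc].
have Hb : exists C : R, forall t p, B t p -> `|(f t p)^-1| <= C * (w t p)^-1.
  exists c^-1 => t p Bp; rewrite normfV -invfM.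
  have cw : 0 < c * w t p by rewrite mulr_gt0// w0.
  by rewrite lef_pV2 ?posrE ?(lt_le_trans cw) ?Hc// mulrC.
elim: l Hf => [|l IH] Hf; first by split.
split=> //; have Hi := IH (wclassS Hf).
have [_ [H1 H2]] := Hf; split => [t p Up|d].
  by apply: differentiableV; [exact: H1|exact: f0].
apply: (@wclass_ext _ _ (fun t p => - ('D_(bd d) (f t) p *
    ((f t p)^-1 * (f t p)^-1)))) => [t p Up|].
  by rewrite derive_inv//; [exact: H1|exact: f0].
apply: wclass_opp; have := wclass_mul (H2 d) (wclass_mul Hi Hi).
apply: wclass_eqw => t p Bp; last first.
  by rewrite !mulr_ge0// ?invr_ge0 ltW// w0.
have := w0 _ _ Bp; move: (w t p) (om d p) => a b a0.
by field; rewrite gt_eqF.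
Qed.

(** For families h closed under differentiation up to linear combinations, of
which two are used: cosine and sine, and the functions t^-p e^(-1/t). *)
Lemma wclass_comp (J : Type) (h : J -> R -> R) l f :
  (forall j y, derivable (h j) y 1) ->
  (forall j, exists c1 j1 c2 j2, forall y,
    'D_1 (h j) y = c1 * h j1 y + c2 * h j2 y) ->
  (forall j, exists C : R, forall t p, B t p -> `|h j (f t p)| <= C) ->
  wclass l (fun _ _ => 1) f ->
  forall j, wclass l (fun _ _ => 1) (fun t p => h j (f t p)).
Proof.
move=> dh Dh bh; elim: l => [|l IH] Hf j.
  by split=> //; have [C HC] := bh j; exists C => t p; rewrite mulr1; exact: HC.
split; first by have [C HC] := bh j; exists C => t p; rewrite mulr1; exact: HC.
have [_ [H1 H2]] := Hf; split => [t p Up|d].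
  by apply: differentiable_comp1 => //; exact: H1.
have [c1 [j1 [c2 [j2 E]]]] := Dh j.
apply: (@wclass_ext _ _ (fun t p => (c1 * h j1 (f t p) + c2 * h j2 (f t p)) *
   'D_(bd d) (f t) p)) => [t p Up|].
  by rewrite derive_comp//; [rewrite E|exact: H1].
have HI := IH (wclassS Hf).
have := wclass_mul (wclass_add (wclass_scale c1 (HI j1)) (wclass_scale c2 (HI j2))) (H2 d).
by apply: wclass_eqw => t p Bp; rewrite !mul1r.
Qed.

Definition dwords (ds : seq I) (f : V -> R) : V -> R :=
  foldr (fun d (g : V -> R) => 'D_(bd d) g) f ds.

Lemma wclass_word ds w f : wclass (size ds) w f ->
  exists C : R, forall t p, B t p ->
    `|dwords ds (f t) p| <= C * (w t p * \prod_(d <- ds) om d p).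
Proof.
elim/last_ind: ds w f => [|ds d IH] w f Hf.
  have [C HC] := wclass_bound Hf.
  by exists C => t p Bp; rewrite big_nil mulr1; exact: HC.
rewrite size_rcons in Hf; have [C HC] := IH _ _ (wclass_derive d Hf).
exists C => t p Bp; rewrite /dwords foldr_rcons big_rcons/=.
by have := HC t p Bp; rewrite -mulrA [om d p * _]mulrC.
Qed.

Lemma word_wclass l w f :
  (forall ds t p, U t p -> differentiable (dwords ds (f t)) p) ->
  (forall ds, exists C : R, forall t p, B t p ->
    `|dwords ds (f t) p| <= C * (w t p * \prod_(d <- ds) om d p)) ->
  wclass l w f.
Proof.
elim: l w f => [|l IH] w f df Hf.
  split=> //; have [C HC] := Hf [::]; exists C => t p Bp.
  by have := HC t p Bp; rewrite big_nil mulr1.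
split; first by have [C HC] := Hf [::]; exists C => t p Bp; have := HC t p Bp; rewrite big_nil mulr1.
split => [t p|d]; first exact: (df [::]).
apply: IH => ds.
  by move=> t p Up; have := df (rcons ds d) t p Up; rewrite /dwords foldr_rcons.
have [C HC] := Hf (rcons ds d); exists C => t p Bp.
have := HC t p Bp; rewrite /dwords foldr_rcons big_rcons/=.
by rewrite -mulrA [om d p * _]mulrC.
Qed.

End weighted_classes.

(** With om = 1 and finitely many directions, one constant serves for all the
derivatives of order at most l; the seminorms of test functions need this. *)
Lemma wclass_words {R : realType} {V : normedModType R} {I : finType} (bd : I -> V)
    (T : Type) (U B : T -> set V) l w f : (forall t p, B t p -> 0 <= w t p) ->
  wclass bd (fun _ _ => 1) U B l w f ->
  exists2 C : R, 0 <= C & forall ds t p, (size ds <= l)%N -> B t p ->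
    `|dwords bd ds (f t) p| <= C * w t p.
Proof.
elim: l w f => [|l IH] w f w0 [[C HC] H].
  exists `|C| => // -[|//] t p _ Bp; apply: le_trans (HC _ _ Bp) _.
  by rewrite ler_wpM2r ?ler_norm// w0.
have [_ H2] := H.
have w1 t p : B t p -> 0 <= w t p * 1 by rewrite mulr1; exact: w0.
have K d := IH _ _ w1 (H2 d).
pose D d := s2val (cid2 (K d)).
have D0 d : 0 <= D d := s2valP (cid2 (K d)).
have HD d := s2valP' (cid2 (K d)).
exists (`|C| + \sum_d D d) => [|ds t p dl Bp]; first by rewrite addr_ge0// sumr_ge0.
case/lastP: ds dl => [_|ds d].
  apply: le_trans (HC _ _ Bp) _; rewrite ler_wpM2r ?w0//.
  by rewrite (le_trans (ler_norm C))// lerDl sumr_ge0.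
rewrite size_rcons ltnS => dl.
rewrite /dwords foldr_rcons -/(dwords bd ds _).
apply: le_trans (HD d ds t p dl Bp) _; rewrite mulr1 ler_wpM2r ?w0//.
by rewrite (bigD1 d)//= addrCA lerDl addr_ge0// sumr_ge0.
Qed.

(** * Euclidean geometry of row vectors *)
Section euclid.
Context {R : realType} {n : nat}.
Implicit Types v w h : 'rV[R]_n.

Lemma rV_norm_lt v (e : R) : 0 < e ->
  (forall i, `|v 0 i| < e) -> `|v| < e.
Proof.
move=> e0 H; rewrite [ltLHS]/Num.norm /= mx_normrE.
by apply/bigmax_ltP; split => // -[i j] _ /=; rewrite ord1.
Qed.

Lemma rV_coord_le v i : `|v 0 i| <= `|v|.
Proof.
rewrite [leRHS]/Num.norm /= mx_normrE.
by apply/bigmax_geP; right; exists (0, i).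
Qed.

Lemma enorm_sqr v : enorm v ^+ 2 = \sum_i v 0 i ^+ 2.
Proof.
rewrite /enorm sqr_sqrtr; first by apply: eq_bigr => i _; rewrite expr2.
by apply: sumr_ge0 => i _; rewrite -expr2 sqr_ge0.
Qed.

Lemma enorm_ge0 v : 0 <= enorm v.
Proof. exact: sqrtr_ge0. Qed.

Lemma enorm_coord v i : `|v 0 i| <= enorm v.
Proof.
rewrite -(ler_pXn2r (n := 2))// ?nnegrE ?enorm_ge0// real_normK ?num_real// enorm_sqr.
rewrite (bigD1 i)//= lerDl; apply: sumr_ge0 => j _; exact: sqr_ge0.
Qed.

Lemma enorm_sqr_ge0 v : 0 <= enorm v ^+ 2.
Proof. exact: sqr_ge0. Qed.

Lemma enorm_sub_sqr v w (tau : R) :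
  enorm (v - tau *: w) ^+ 2 = enorm v ^+ 2 - 2 * tau * dotp v w + tau ^+ 2 * enorm w ^+ 2.
Proof.
rewrite !enorm_sqr /dotp !mulr_sumr -sumrB -big_split/=.
by apply: eq_bigr => i _; rewrite !mxE; ring.
Qed.

Lemma enorm_eq0 v : enorm v ^+ 2 = 0 -> v = 0.
Proof.
rewrite enorm_sqr => /eqP; rewrite psumr_eq0 => [/allP H|i _]; last exact: sqr_ge0.
apply/rowP => i; rewrite mxE; apply/eqP; rewrite -(sqrf_eq0 (v 0 i)).
by have := H i; rewrite mem_index_enum => /(_ isT).
Qed.

Lemma dotp_cauchy v w : `|dotp v w| <= enorm v * enorm w.
Proof.
rewrite -(ler_pXn2r (n := 2))// ?nnegrE ?mulr_ge0 ?enorm_ge0// real_normK ?num_real// exprMn.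
have [w0|w0] := eqVneq (enorm w ^+ 2) 0.
  have -> : dotp v w = 0.
    by rewrite (enorm_eq0 w0) /dotp big1// => i _; rewrite mxE mulr0.
  by rewrite expr0n/= mulr_ge0 ?sqr_ge0.
have wp : 0 < enorm w ^+ 2 by rewrite lt_def w0 sqr_ge0.
have := enorm_sqr_ge0 (v - (dotp v w / enorm w ^+ 2) *: w).
rewrite enorm_sub_sqr; move: (dotp v w) (enorm v ^+ 2) (enorm w ^+ 2) wp => d a b b0.
have -> : a - 2 * (d / b) * d + (d / b) ^+ 2 * b = (a * b - d ^+ 2) / b.
  by field; rewrite gt_eqF.
by rewrite pmulr_lge0 ?invr_gt0// subr_ge0.
Qed.

(** Squares spare the triangle inequality for the Euclidean norm: this estimate
and the next one hold coordinate by coordinate. *)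
Lemma enormD_sqr_ge v h : enorm v ^+ 2 / 2 - enorm h ^+ 2 <= enorm (v + h) ^+ 2.
Proof.
rewrite !enorm_sqr mulr_suml -sumrB; apply: ler_sum => i _; rewrite !mxE.
by move: (v 0 i) (h 0 i) => a b; have := sqr_ge0 (a + 2 * b); nra.
Qed.

Lemma enormD_sqr_le v h : enorm (v + h) ^+ 2 <= 2 * enorm v ^+ 2 + 2 * enorm h ^+ 2.
Proof.
rewrite !enorm_sqr !mulr_sumr -big_split/=; apply: ler_sum => i _; rewrite !mxE.
by move: (v 0 i) (h 0 i) => a b; have := sqr_ge0 (a - b); nra.
Qed.

Lemma enormN v : enorm (- v) = enorm v.
Proof. by rewrite /enorm /dotp; congr Num.sqrt; apply: eq_bigr => i _; rewrite !mxE mulrNN. Qed.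

Lemma enormZ (c : R) v : enorm (c *: v) = `|c| * enorm v.
Proof.
apply/eqP; rewrite -(eqrXn2 (n := 2))// ?mulr_ge0 ?enorm_ge0// exprMn real_normK ?num_real//.
by rewrite !enorm_sqr mulr_sumr; apply/eqP; apply: eq_bigr => i _; rewrite !mxE exprMn.
Qed.

Lemma enorm_sqr_le v (e : R) : (forall i, `|v 0 i| <= e) -> enorm v ^+ 2 <= n%:R * e ^+ 2.
Proof.
move=> H; rewrite enorm_sqr.
apply: le_trans (_ : \sum_(i < n) e ^+ 2 <= _); last by rewrite sumr_const card_ord mulr_natl.
apply: ler_sum => i _; rewrite -(real_normK (num_real (v 0 i))).
by have := H i; have := normr_ge0 (v 0 i); move: `|v 0 i| => a a0 ae; nra.
Qed.

Lemma norm_le_enorm v : `|v| <= enorm v.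
Proof.
rewrite [leLHS]/Num.norm /= mx_normrE; apply/bigmax_leP; split; first exact: enorm_ge0.
by move=> [i j] _ /=; rewrite ord1; exact: enorm_coord.
Qed.

Lemma enorm_le_norm v : enorm v <= n%:R * `|v|.
Proof.
rewrite -(ler_pXn2r (n := 2))// ?nnegrE ?mulr_ge0 ?enorm_ge0//.
apply: le_trans (enorm_sqr_le (rV_coord_le v)) _.
rewrite exprMn ler_wpM2r ?sqr_ge0//.
by rewrite expr2; case: (n) => [|k]; [rewrite mul0r|rewrite ler_peMr// ler1n].
Qed.

Lemma cos_angle_itv v w : -1 <= dotp v w / (enorm v * enorm w) <= 1.
Proof.
have [z|nz] := eqVneq (enorm v * enorm w) 0.
  by rewrite z invr0 mulr0 lerN10 ler01.
have vw0 : 0 < enorm v * enorm w by rewrite lt_def nz mulr_ge0 ?enorm_ge0.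
by rewrite -ler_norml normrM normfV (gtr0_norm vw0) ler_pdivrMr// mul1r dotp_cauchy.
Qed.

(** At an angle at least alpha from w, the vector v satisfies
v . tau w <= c |v| |tau w| with c = max(cos alpha, 0) < 1, so that
|v - tau w|^2 >= (1 - c) (|v|^2 + |tau w|^2). *)
Lemma angle_coercive (alpha : R) : 0 < alpha -> exists2 eta : R, 0 < eta &
  forall v w (tau : R), 0 <= tau -> alpha <= angle v w ->
    eta * (enorm v ^+ 2 + tau ^+ 2 * enorm w ^+ 2) <= enorm (v - tau *: w) ^+ 2.
Proof.
move=> a0; (* an angle is at most pi, so the hypothesis is void when alpha > pi *)
have [api|pia] := leP alpha pi; last first.
  exists 1 => // v w tau _ aa; exfalso.
  have := lt_le_trans pia (le_trans aa (acos_lepi (cos_angle_itv v w))).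
  by rewrite ltxx.
have ia : alpha \in `[0, pi] by rewrite in_itv/= (ltW a0) api.
have c1 : cos alpha < 1.
  by rewrite -cos0 ltr_cos// in_itv/= lexx pi_ge0.
pose c := Num.max (cos alpha) 0.
have c0 : 0 <= c by rewrite le_max lexx orbT.
have cl1 : c < 1 by rewrite gt_max c1 ltr01.
exists (1 - c) => [|v w tau tau0 aa]; first by rewrite subr_gt0.
have H : dotp v w <= c * (enorm v * enorm w).
  have cs := dotp_cauchy v w.
  have [z|nz] := eqVneq (enorm v * enorm w) 0.
    by move: cs; rewrite z mulr0 normr_le0 => /eqP ->.
  have vw0 : 0 < enorm v * enorm w by rewrite lt_def nz mulr_ge0 ?enorm_ge0.
  rewrite -ler_pdivrMr//; apply: (@le_trans _ _ (cos alpha)); last by rewrite le_max lexx.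
  move: aa; rewrite /angle; set q := _ / _ => aa.
  have q1 : -1 <= q <= 1 by exact: cos_angle_itv.
  have qE : cos (acos q) = q by apply: acosK; rewrite in_itv/=.
  rewrite -qE leNgt; apply/negP; rewrite ltr_cos//; last by rewrite in_itv/= acos_ge0// acos_lepi.
  by rewrite ltNge aa.
rewrite enorm_sub_sqr.
have e1 := enorm_ge0 v; have e2 := enorm_ge0 w.
move: (enorm v) (enorm w) (dotp v w) e1 e2 H => a b d a1 b1 H.
have h1 : tau * d <= c * tau * (a * b).
  by have := ler_wpM2l tau0 H; lra.
have h2 : 2 * (a * (tau * b)) <= a ^+ 2 + (tau * b) ^+ 2 by have := sqr_ge0 (a - tau * b); nra.
have h3 : c * (2 * (a * (tau * b))) <= c * (a ^+ 2 + (tau * b) ^+ 2) by rewrite ler_wpM2l.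
lra.
Qed.

Lemma closed_norm_ball (x0 : 'rV[R]_n) (b : R) : closed [set v : 'rV[R]_n | `|v - x0| <= b].
Proof.
have -> : [set v : 'rV[R]_n | `|v - x0| <= b] = (fun v => `|v - x0|) @^-1` [set x | x <= b] by [].
apply: closed_comp => [v _|]; last exact: closed_le.
have ds : differentiable (fun y : 'rV[R]_n => y - x0) v.
  by apply: differentiableB; [exact: ex_diff|exact: differentiable_cst].
exact: (continuous_comp (differentiable_continuous ds) (@norm_continuous _ _ _)).
Qed.

Lemma compact_norm_ball (x0 : 'rV[R]_n) (b : R) : compact [set v : 'rV[R]_n | `|v - x0| <= b].
Proof.
apply: bounded_closed_compact; last exact: closed_norm_ball.
exists (`|x0| + b); split; first exact: num_real.
move=> M bM v /= vb; apply: le_trans (ltW bM); rewrite -[v](subrK x0) addrC.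
by apply: le_trans (ler_normD _ _) _; rewrite lerD2l.
Qed.

Lemma dotp_shift (k x : 'rV[R]_n) i (h : R) :
  dotp k (h *: unitv i + x) = h * k 0 i + dotp k x.
Proof.
rewrite /dotp.
rewrite (eq_bigr (fun j => h * (k 0 j * (i == j)%:R) + k 0 j * x 0 j)); last first.
  by move=> j _; rewrite !mxE eqxx/= eq_sym; ring.
rewrite big_split/= -mulr_sumr (bigD1 i)//= eqxx mulr1 big1 ?addr0// => j ji.
by rewrite eq_sym (negbTE ji) mulr0.
Qed.

End euclid.

(** * Smooth functions and symbols in terms of classes *)
Section smoothness.
Context {R : realType} {V : normedModType R}.
Implicit Types (f g : V -> R) (U : set V).

(** Smoothness of a complex function is that of its real and imaginary parts; the
next two notions are the real counterparts of [cderives] and [smooth_on]. *)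
Definition rderives (vs : seq V) f : V -> R :=
  foldr (fun v (g : V -> R) => 'D_v g) f vs.

Definition rsmooth U f := forall vs x, U x -> differentiable (rderives vs f) x.

Lemma re_cderives vs (a : V -> R[i]) :
  re_fun (cderives vs a) = rderives vs (re_fun a).
Proof. by elim: vs => //= v vs <-. Qed.

Lemma im_cderives vs (a : V -> R[i]) :
  im_fun (cderives vs a) = rderives vs (im_fun a).
Proof. by elim: vs => //= v vs <-. Qed.

Lemma smooth_onP U (a : V -> R[i]) :
  smooth_on U a <-> rsmooth U (re_fun a) /\ rsmooth U (im_fun a).
Proof.
split.
  by move=> H; split => vs x Ux; have [] := H vs x Ux; rewrite re_cderives im_cderives.
by move=> [H1 H2] vs x Ux; rewrite re_cderives im_cderives; split; [exact: H1|exact: H2].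
Qed.

Lemma rsmooth_commute U f v w x : open U -> rsmooth U f -> U x ->
  'D_v ('D_w f) x = 'D_w ('D_v f) x.
Proof.
move=> oU H Ux; apply: (schwarz oU Ux).
- by move=> y; exact: (H [::]).
- by move=> y; exact: (H [:: w]).
- by move=> y; exact: (H [:: v]).
- by apply: differentiable_continuous; exact: (H [:: v; w]).
- by apply: differentiable_continuous; exact: (H [:: w; v]).
Qed.

Lemma rderives_cat vs ws f : rderives (vs ++ ws) f = rderives vs (rderives ws f).
Proof. by rewrite /rderives foldr_cat. Qed.

Lemma rsmooth_derives U f vs : rsmooth U f -> rsmooth U (rderives vs f).
Proof. by move=> H ws x Ux; rewrite -rderives_cat; exact: H. Qed.

(** Derivatives may be taken in any order.  This is what allows words of
directions in place of multi-indices. *)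
Lemma rderives_perm U f vs ws : open U -> rsmooth U f -> perm_eq vs ws ->
  forall x, U x -> rderives vs f x = rderives ws f x.
Proof.
move=> oU Sf.
have move_front l v r : forall x, U x ->
    rderives (l ++ v :: r) f x = rderives (v :: l ++ r) f x.
  elim: l => [|e l IH] //= x Ux.
  rewrite (@rsmooth_commute U (rderives (l ++ r) f))//; last exact: rsmooth_derives.
  by apply: derive_near_eq; apply: filterS (open_near oU Ux) => y; exact: IH.
elim: vs ws => [|v vs IH] ws.
  by rewrite perm_sym => /perm_nilP ->.
move=> pws x Ux.
have vws : v \in ws by rewrite -(perm_mem pws) mem_head.
have [l [r wsE]] : exists l r, ws = l ++ v :: r.
  by case/splitPr: vws => l r; exists l, r.
rewrite wsE move_front//=; apply: derive_near_eq.
apply: filterS (open_near oU Ux) => y Uy; apply: IH => //.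
by move: pws; rewrite wsE -cat1s -[v :: r]cat1s perm_sym perm_catCA perm_cat2l perm_sym.
Qed.

End smoothness.

Section smooth_classes.
Context {R : realType} {V : normedModType R} {I : finType} (bd : I -> V)
  (om : I -> V -> R) {T : Type} (U B : T -> set V).
Hypothesis om0 : forall d p, 0 <= om d p.
Hypothesis oU : forall t, open (U t).
Hypothesis bd_span : forall v, exists c : I -> R, v = \sum_d c d *: bd d.
Implicit Types (w f g : T -> V -> R).

Local Notation wclass := (wclass bd om).

Lemma wclass_nobound B' l w w' f : wclass U B' l w f ->
  wclass U (fun _ => set0) l w' f.
Proof.
elim: l w w' f => [|l IH] w w' f [_ H]; first by split=> //; exists 0 => t p [].
have [H1 H2] := H; split; first by exists 0 => t p [].
by split => // d; exact: IH (H2 d).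
Qed.

(** Membership in all the classes gives differentiability in the directions bd
only; as these span the space, all iterated derivatives exist. *)
Lemma wclass_smooth w f : (forall l, wclass U B l w f) ->
  forall t, rsmooth (U t) (f t).
Proof.
move=> Hf t vs; pose N := fun _ : T => @set0 V.
have {}Hf l : wclass U N l (fun _ _ => 1) f by exact: wclass_nobound (Hf l).
suff H l : wclass U N l (fun _ _ => 1) (fun t => rderives vs (f t)).
  by move=> x; exact: (wclass_differentiable (H 1%N)).
have BU u : N u `<=` U u by move=> p [].
elim: vs l => [|v vs IH] l; first exact: Hf.
have [c ->] := bd_span v.
apply: (wclass_ext oU BU (f := fun t p =>
   \sum_d c d * 'D_(bd d) (rderives vs (f t)) p)) => [u p Up|].
  rewrite /= derive_dir_sum; last exact: (wclass_differentiable (IH 1%N)).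
  by apply: eq_bigr => d _; rewrite derive_dirZ//; exact: (wclass_differentiable (IH 1%N)).
apply: (wclass_sum om0 oU BU) => [u p []|d].
apply: (wclass_scale om0 oU BU); apply: (@wclass_nobound N _ (fun t p => 1 * om d p)).
exact: (wclass_derive d (IH l.+1)).
Qed.

End smooth_classes.

Lemma dwordsE {R : realType} {V : normedModType R} {I : finType} (bd : I -> V)
  (ds : seq I) (f : V -> R) : dwords bd ds f = rderives [seq bd d | d <- ds] f.
Proof. by elim: ds => //= d ds ->. Qed.

Section complex_abs.
Context {R : realType}.
Implicit Types z : R[i].

Lemma cabsE z : cabs z = Num.sqrt (complex.Re z ^+ 2 + complex.Im z ^+ 2).
Proof. by case: z => a b; rewrite /cabs normc_def. Qed.

Lemma cabs_ge0 z : 0 <= cabs z.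
Proof. by rewrite cabsE sqrtr_ge0. Qed.

Lemma cabs_le z : cabs z <= `|complex.Re z| + `|complex.Im z|.
Proof.
rewrite cabsE -(ler_pXn2r (n := 2))// ?nnegrE ?sqrtr_ge0 ?addr_ge0//.
rewrite sqr_sqrtr ?addr_ge0 ?sqr_ge0// sqrrD !real_normK ?num_real//.
by rewrite addrAC lerDl mulrn_wge0// mulr_ge0.
Qed.

Lemma Re_le_cabs z : `|complex.Re z| <= cabs z.
Proof.
by rewrite cabsE -sqrtr_sqr ler_wsqrtr// lerDl sqr_ge0.
Qed.

Lemma Im_le_cabs z : `|complex.Im z| <= cabs z.
Proof.
by rewrite cabsE -sqrtr_sqr ler_wsqrtr// lerDr sqr_ge0.
Qed.
End complex_abs.

Section symbol_classes.
Context {R : realType} (n s : nat).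
Local Notation X := ('rV[R]_n * 'rV[R]_s)%type.
Local Notation I := ('I_n + 'I_s)%type.

Definition xtdir (d : I) : X :=
  match d with inl i => dirx s i | inr j => dirt n j end.

(** The weight <theta> of symbols. *)
Definition jap (p : X) : R := 1 + enorm p.2.

Definition xtweight (d : I) (p : X) : R :=
  match d with inl _ => 1 | inr _ => (jap p)^-1 end.

Lemma jap_ge1 p : 1 <= jap p.
Proof. by rewrite /jap lerDl sqrtr_ge0. Qed.

Lemma jap_gt0 p : 0 < jap p.
Proof. exact: lt_le_trans ltr01 (jap_ge1 p). Qed.

Lemma xtweight_ge0 d p : 0 <= xtweight d p.
Proof. by case: d => [i|j] //=; rewrite invr_ge0 ltW// jap_gt0. Qed.

Definition xtcoord (d : I) (p : X) : R :=
  match d with inl i => p.1 0 i | inr j => p.2 0 j end.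

Lemma xtcoord_sum (v : X) : v = \sum_d xtcoord d v *: xtdir d.
Proof.
rewrite big_sumType/=; case: v => x y /=.
have E1 (r : seq 'I_n) : \sum_(i <- r) x 0 i *: dirx s i =
    (\sum_(i <- r) x 0 i *: delta_mx 0 i, 0).
  elim: r => [|i r IH]; first by rewrite !big_nil.
  by rewrite !big_cons IH; congr (_, _); rewrite /= scaler0 addr0.
have E2 (r : seq 'I_s) : \sum_(j <- r) y 0 j *: dirt n j =
    (0, \sum_(j <- r) y 0 j *: delta_mx 0 j).
  elim: r => [|j r IH]; first by rewrite !big_nil.
  by rewrite !big_cons IH; congr (_, _); rewrite /= scaler0 addr0.
rewrite E1 E2 -!row_sum_delta.
by congr (_, _); rewrite /= ?addr0 ?add0r.
Qed.

Lemma xtdir_span (v : X) : exists c : I -> R, v = \sum_d c d *: xtdir d.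
Proof. by exists (xtcoord^~ v); exact: xtcoord_sum. Qed.

(** The multi-index of a word counts the occurrences of each direction. *)
Definition words_alpha (ds : seq I) (i : 'I_n) := count_mem (inl i : I) ds.
Definition words_beta (ds : seq I) (j : 'I_s) := count_mem (inr j : I) ds.

Lemma count_mi_seq k (alpha : 'I_k -> nat) i : count_mem i (mi_seq alpha) = alpha i.
Proof.
rewrite /mi_seq count_flatten -map_comp sumnE big_map.
rewrite big_enum/= (bigD1 i)//= count_nseq/= eqxx mul1n.
rewrite big1 ?addn0// => j ji; rewrite count_nseq/=.
by rewrite (negbTE ji).
Qed.

Lemma words_perm (ds : seq I) :
  perm_eq ds ([seq inl i | i <- mi_seq (words_alpha ds)] ++
              [seq inr j | j <- mi_seq (words_beta ds)]).
Proof.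
apply/allP => -[i|j] _; apply/eqP; rewrite count_cat !count_map.
  rewrite (eq_count (a2 := pred1 i)) ?count_mi_seq; last by move=> k /=; rewrite /eq_op.
  rewrite [X in (_ + X)%N](_ : _ = 0%N) ?addn0//.
  by apply/eqP; rewrite -leqn0 leqNgt -has_count; apply/hasPn.
rewrite [X in (X + _)%N](_ : _ = 0%N) ?add0n.
  by rewrite (eq_count (a2 := pred1 j)) ?count_mi_seq// => k /=; rewrite /eq_op.
by apply/eqP; rewrite -leqn0 leqNgt -has_count; apply/hasPn.
Qed.

Lemma size_mi_seq k (alpha : 'I_k -> nat) : size (mi_seq alpha) = mi_deg alpha.
Proof.
rewrite /mi_seq size_flatten /shape -map_comp sumnE big_map big_enum/=.
by apply: eq_bigr => i _; rewrite size_nseq.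
Qed.

Lemma prod_xtweight_words (al : seq 'I_n) (be : seq 'I_s) p :
  \prod_(d <- [seq inl i | i <- al] ++ [seq inr j | j <- be]) xtweight d p =
  (jap p) ^- size be.
Proof.
rewrite big_cat/= !big_map/= big1// mul1r.
elim: be => [|j be IH]; first by rewrite big_nil expr0 invr1.
by rewrite big_cons/= IH exprS invfM.
Qed.

Lemma prod_xtweight (ds : seq I) p :
  \prod_(d <- ds) xtweight d p = (jap p) ^- mi_deg (words_beta ds).
Proof. by rewrite (perm_big _ (words_perm ds)) prod_xtweight_words size_mi_seq. Qed.

Lemma xtdir_words alpha beta :
  [seq dirx s i | i <- mi_seq alpha] ++ [seq dirt n j | j <- mi_seq beta] =
  [seq xtdir d | d <- [seq inl i | i <- mi_seq alpha] ++ [seq inr j | j <- mi_seq beta]].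
Proof. by rewrite map_cat -!map_comp. Qed.

Lemma powR_exp (x : R) k m : 0 < x -> x `^ (k%:R - m) = x ^+ k / x `^ m.
Proof. move=> x0; have xn0 : x != 0 by rewrite gt_eqF.
by rewrite powRD ?xn0 ?implybT// powRN powR_mulrn// ltW. Qed.

Variable Omega : set 'rV[R]_n.
Hypothesis Omega_open : open Omega.
Let U := Omega `*` [set: 'rV[R]_s].

Lemma open_cylinder : open U.
Proof. have -> : U = fst @^-1` Omega by apply/seteqP; split => -[x th] //= [].
by apply: open_comp => // x _; exact: cvg_fst. Qed.

Definition symbol_weight (m : R) (p : X) : R := (jap p) `^ m.

Lemma symbol_weight_gt0 m p : 0 < symbol_weight m p.
Proof. by rewrite powR_gt0 ?jap_gt0. Qed.

Lemma symbol_seminorm_bound m (a : X -> R[i]) al be K (C : R) :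
  (forall p, K p.1 -> cabs (xt_partials al be a p) <=
     C * (symbol_weight m p * (jap p) ^- mi_deg be)) ->
  (symbol_seminorm m al be K a <= C%:E)%E.
Proof.
move=> H; apply: ub_ereal_sup => _ [p [Kp _] <-]; rewrite lee_fin -/(jap p).
rewrite powR_exp ?jap_gt0// -/(symbol_weight m p).
have w0 := symbol_weight_gt0 m p; have j0 := exprn_gt0 (mi_deg be) (jap_gt0 p).
rewrite -ler_pdivlMr ?divr_gt0//; apply: le_trans (H _ Kp) _.
by rewrite invfM invrK [X in _ <= _ * X]mulrC.
Qed.

Lemma bound_symbol_seminorm m (a : X -> R[i]) al be K :
  (symbol_seminorm m al be K a < +oo)%E -> exists C : R,
  forall p, K p.1 -> cabs (xt_partials al be a p) <=
     C * (symbol_weight m p * (jap p) ^- mi_deg be).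
Proof.
move=> H.
have [C HC] : exists C : R, (symbol_seminorm m al be K a <= C%:E)%E.
  case: (symbol_seminorm m al be K a) H => [r|//|] _; first by exists r.
  by exists 0; exact: leNye.
exists C => p Kp.
have : ((cabs (xt_partials al be a p) *
      (jap p) `^ ((mi_deg be)%:R - m))%:E <= C%:E)%E.
  by apply: le_trans HC; apply: ereal_sup_ubound; exists p.
rewrite lee_fin powR_exp ?jap_gt0// -/(symbol_weight m p).
have w0 := symbol_weight_gt0 m p; have j0 := exprn_gt0 (mi_deg be) (jap_gt0 p).
by rewrite -ler_pdivlMr ?divr_gt0// invfM invrK [X in _ <= _ * X]mulrC.
Qed.

(** Seminorms only see derivatives taken with the x-directions first; those of
an arbitrary word are brought to this form by [rderives_perm]. *)
Lemma symbol_class m (a : X -> R[i]) K : symbol Omega m a ->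
  compact K -> K `<=` Omega -> forall l,
  wclass xtdir xtweight (fun _ : unit => U) (fun _ => K `*` [set: 'rV[R]_s]) l
    (fun _ => symbol_weight m) (fun _ => re_fun a) /\
  wclass xtdir xtweight (fun _ : unit => U) (fun _ => K `*` [set: 'rV[R]_s]) l
    (fun _ => symbol_weight m) (fun _ => im_fun a).
Proof.
move=> [/smooth_onP[Sr Si] Ha] cK KO l.
have bnd ds : exists C : R, forall p, K p.1 ->
    `|dwords xtdir ds (re_fun a) p| <= C * (symbol_weight m p * \prod_(d <- ds) xtweight d p) /\
    `|dwords xtdir ds (im_fun a) p| <= C * (symbol_weight m p * \prod_(d <- ds) xtweight d p).
  have [C HC] := bound_symbol_seminorm (Ha (words_alpha ds) (words_beta ds) K cK KO).
  exists C => p Kp; rewrite prod_xtweight.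
  have Up : U p by split => //; exact: KO.
  have pw := perm_map xtdir (words_perm ds).
  rewrite !dwordsE.
  rewrite (rderives_perm open_cylinder Sr pw Up) (rderives_perm open_cylinder Si pw Up).
  rewrite -xtdir_words -re_cderives -im_cderives.
  by split; apply: le_trans (HC _ Kp); [exact: Re_le_cabs|exact: Im_le_cabs].
by split; apply: word_wclass => [ds _ p Up|ds];
  [rewrite dwordsE; exact: Sr|
   have [C HC] := bnd ds; exists C => _ p [Kp _]; have [] := HC p Kp|
   rewrite dwordsE; exact: Si|
   have [C HC] := bnd ds; exists C => _ p [Kp _]; have [] := HC p Kp].
Qed.

Lemma class_xt_partials (T : Type) (a : T -> X -> R[i]) (K : set 'rV[R]_n) w al be :
  (forall l, wclass xtdir xtweight (fun _ => U) (fun _ => K `*` [set: 'rV[R]_s]) l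
    w (fun t => re_fun (a t))) ->
  (forall l, wclass xtdir xtweight (fun _ => U) (fun _ => K `*` [set: 'rV[R]_s]) l
    w (fun t => im_fun (a t))) ->
  exists C : R, forall t p, K p.1 -> cabs (xt_partials al be (a t) p) <=
     C * (w t p * (jap p) ^- mi_deg be).
Proof.
move=> Hr Hi.
pose ds : seq I := [seq inl i | i <- mi_seq al] ++ [seq inr j | j <- mi_seq be].
have [C HC] := wclass_word (Hr (size ds)).
have [D HD] := wclass_word (Hi (size ds)).
exists (C + D) => t p Kp; apply: le_trans (cabs_le _) _.
have -> : complex.Re (xt_partials al be (a t) p) = dwords xtdir ds (re_fun (a t)) p.
  rewrite dwordsE -xtdir_words -re_cderives.
  by [].
have -> : complex.Im (xt_partials al be (a t) p) = dwords xtdir ds (im_fun (a t)) p.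
  rewrite dwordsE -xtdir_words -im_cderives.
  by [].
have Bp : (K `*` [set: 'rV[R]_s]) p by split.
have := HC t p Bp; have := HD t p Bp.
rewrite prod_xtweight_words size_mi_seq => h1 h2.
by rewrite mulrDl; exact: lerD.
Qed.

Lemma class_symbol m (a : X -> R[i]) :
  (forall K, compact K -> K `<=` Omega -> forall l,
     wclass xtdir xtweight (fun _ : unit => U) (fun _ => K `*` [set: 'rV[R]_s]) l
       (fun _ => symbol_weight m) (fun _ => re_fun a)) ->
  (forall K, compact K -> K `<=` Omega -> forall l,
     wclass xtdir xtweight (fun _ : unit => U) (fun _ => K `*` [set: 'rV[R]_s]) l
       (fun _ => symbol_weight m) (fun _ => im_fun a)) ->
  symbol Omega m a.
Proof.
move=> Hr Hi; split.
  have oU (t : unit) : open U := open_cylinder.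
  apply/smooth_onP; split.
    exact: (wclass_smooth (t := tt) (U := fun=> U) (f := fun=> re_fun a)
      xtweight_ge0 oU xtdir_span (Hr set0 (@compact0 _) (@sub0set _ _))).
  exact: (wclass_smooth (t := tt) (U := fun=> U) (f := fun=> im_fun a)
    xtweight_ge0 oU xtdir_span (Hi set0 (@compact0 _) (@sub0set _ _))).
move=> al be K cK KO.
have [C HC] := @class_xt_partials unit (fun _ => a) K _ al be (Hr K cK KO) (Hi K cK KO).
by apply: le_lt_trans (symbol_seminorm_bound (HC tt)) _; exact: ltry.
Qed.

End symbol_classes.

(** * Integration of continuous functions on R^n x R^s *)
(** Continuous functions of row vectors must be shown measurable as functions of
tuples.  The coordinates are rounded to the grid of step 1 / (k + 1): the
function then takes countably many values on measurable sets, and continuity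
makes these approximations converge. *)
Section measurable_continuous.
Context {R : realType} d (S : measurableType d) (J : finType).
Variables (y : J -> S -> R) (H : {ffun J -> R} -> R).
Hypothesis my : forall i, measurable_fun [set: S] (y i).
Hypothesis cH : forall (z : {ffun J -> R}) (e : R), 0 < e -> exists2 dl : R, 0 < dl &
  forall z' : {ffun J -> R}, (forall i, `|z' i - z i| < dl) -> `|H z' - H z| < e.

Let grid k (s : S) : {ffun J -> int} := [ffun i => Num.floor (y i s * k.+1%:R)].
Let pt k (g : {ffun J -> int}) : {ffun J -> R} := [ffun i => (g i)%:~R / k.+1%:R].

Let measurable_grid k g : measurable [set s | grid k s = g].
Proof.
have -> : [set s | grid k s = g] = \bigcap_(i in [set: J])
    (y i @^-1` `[(g i)%:~R / k.+1%:R, (g i + 1)%:~R / k.+1%:R[%classic).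
  apply/seteqP; split => s /=.
    move=> <- i _ /=; rewrite in_itv/= /grid ffunE.
    rewrite ler_pdivrMr// ltr_pdivlMr//; exact: floor_itv.
  move=> Hs; apply/ffunP => i; rewrite /grid ffunE; apply: floor_def.
  have := Hs i I; rewrite /= in_itv/= ler_pdivrMr// ltr_pdivlMr//.
apply: fin_bigcap_measurable => [|i _]; first exact: finite_finset.
by rewrite -[X in measurable X]setTI; apply: my.
Qed.

Lemma measurable_continuous : measurable_fun [set: S] (fun s => H [ffun i => y i s]).
Proof.
apply: (measurable_fun_cvg (h := fun k s => H (pt k (grid k s)))) => [k|s _].
  move=> _ A mA; rewrite setTI.
  have -> : (fun s => H (pt k (grid k s))) @^-1` A =
      \bigcup_(g : {ffun J -> int}) (if H (pt k g) \in A then [set s | grid k s = g] else set0).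
    apply/seteqP; split => s /=.
      by move=> As; exists (grid k s) => //=; rewrite mem_set.
    by move=> [g _]; case: ifPn => // /set_mem Ag /= ->.
  apply: countable_bigcupT_measurable; first exact: countableP.
  by move=> g; case: ifP => _; [exact: measurable_grid|exact: measurable0].
apply/cvgrPdist_lt => e e0.
have [dl dl0 Hdl] := cH [ffun i => y i s] e0.
near=> k; rewrite distrC; apply: Hdl => i.
rewrite !ffunE.
have k0 : 0 < k.+1%:R :> R by [].
have /andP[h1 h2] := floor_itv (y i s * k.+1%:R).
have h3 : k.+1%:R^-1 < dl.
  near: k; exact: near_infty_natSinv_lt (PosNum dl0).
apply: le_lt_trans h3.
move: h1 h2; move: (Num.floor _) => q h1 h2.
have -> : q%:~R / k.+1%:R - y i s = (q%:~R - y i s * k.+1%:R) / k.+1%:R.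
  by field; rewrite gt_eqF.
rewrite normrM normfV (gtr0_norm k0) -[leRHS]mul1r ler_wpM2r ?invr_ge0 ?ltW//.
by rewrite ltr_norml; rewrite intrD in h2; apply/andP; split; lra.
Unshelve. all: by end_near. Qed.

End measurable_continuous.

Section row_vectors.
Context {R : realType}.
Local Notation mR := (measurableTypeR R).

Definition row_of n (t : n.-tuple mR) : 'rV[R]_n := \row_i tnth t i.

Lemma continuous_measurable_row n (f : 'rV[R]_n -> R) : continuous f ->
  measurable_fun setT (fun t : n.-tuple mR => f (row_of t)).
Proof.
move=> cf; pose H (z : {ffun 'I_n -> R}) := f (\row_i z i).
have -> : (fun t : n.-tuple mR => f (row_of t)) = (fun t => H [ffun i => tnth t i]).
  by apply/funext => t; congr f; apply/rowP => i; rewrite !mxE ffunE.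
apply: (@measurable_continuous R _ _ _ (fun i (t : n.-tuple mR) => tnth t i)) => [i|z e e0].
  exact: measurable_tnth.
have /cvgrPdist_lt/(_ _ e0)/nbhs_ballP[dl /= dl0 Hdl] := cf (\row_i z i).
exists dl => // z' zz'; rewrite distrC; apply: Hdl.
rewrite -ball_normE /ball_/=; apply: rV_norm_lt => // i.
by rewrite !mxE distrC.
Qed.

Lemma continuous_measurable_row2 n s (F : 'rV[R]_n * 'rV[R]_s -> R) : continuous F ->
  measurable_fun setT (fun p : n.-tuple mR * s.-tuple mR => F (row_of p.1, row_of p.2)).
Proof.
move=> cF; pose H (z : {ffun 'I_n + 'I_s -> R}) :=
  F (\row_i z (inl i), \row_j z (inr j)).
have -> : (fun p : n.-tuple mR * s.-tuple mR => F (row_of p.1, row_of p.2)) =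
   (fun p => H [ffun i => match i with inl i => tnth p.1 i | inr j => tnth p.2 j end]).
  by apply/funext => p; congr (F (_, _)); apply/rowP => i; rewrite !mxE ffunE.
apply: (@measurable_continuous R _ _ _ (fun i (p : n.-tuple mR * s.-tuple mR) =>
  match i with inl i => tnth p.1 i | inr j => tnth p.2 j end)) => [[i|j]|z e e0].
- exact: (measurableT_comp (measurable_tnth i) measurable_fst).
- exact: (measurableT_comp (measurable_tnth j) measurable_snd).
have /cvgrPdist_lt/(_ _ e0)/nbhs_ballP[dl /= dl0 Hdl] := cF (\row_i z (inl i), \row_j z (inr j)).
exists dl => // z' zz'; rewrite distrC; apply: Hdl; split => /=.
  by rewrite -ball_normE /ball_/=; apply: rV_norm_lt => // i; rewrite !mxE distrC.
by rewrite -ball_normE /ball_/=; apply: rV_norm_lt => // i; rewrite !mxE distrC.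
Qed.

(** A positive integrable function, product of the 1 / (1 + v_i^2), used to
dominate all integrands. *)
Definition gauge n (v : 'rV[R]_n) : R := \prod_(i < n) (oneDsqr (v 0 i))^-1.

Lemma gauge_gt0 n (v : 'rV[R]_n) : 0 < gauge v.
Proof. by apply: prodr_gt0 => i _; rewrite invr_gt0 (lt_le_trans ltr01)// oneDsqr_ge1. Qed.

Lemma integral_oneDsqrV_lty :
  (\int[@lebesgue_measure R]_x ((oneDsqr x)^-1)%:E < +oo)%E.
Proof.
rewrite (@ge0_symfun_integralT _ (fun x => (oneDsqr x)^-1)).
- rewrite -set_itvcy integral0y_oneDsqr.
  by rewrite -EFinM ltry.
- by move=> x; rewrite invr_ge0 (le_trans ler01)// oneDsqr_ge1.
- exact: continuous_oneDsqrV.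
- by move=> x /=; rewrite /oneDsqr sqrrN.
Qed.

Local Notation mu n := (@lebesgue_tuple R n).

Lemma measurable_gauge n : measurable_fun setT (fun t : n.-tuple mR => gauge (row_of t)).
Proof.
rewrite (_ : (fun _ => _) = (fun t : n.-tuple mR => \prod_(i < n) (oneDsqr (tnth t i))^-1)).
  apply: measurable_prod => i _.
  apply: (@measurableT_comp _ _ _ _ _ _ (fun x : R => (oneDsqr x)^-1)).
    by apply: continuous_measurable_fun; exact: continuous_oneDsqrV.
  exact: measurable_tnth.
by apply/funext => t; apply: eq_bigr => i _; rewrite mxE.
Qed.

Lemma row_of_tcons n (x : mR) (t : n.-tuple mR) :
  row_of (tcons (x, t)) = \row_i (if unlift ord0 i is Some j then row_of t 0 j else x).
Proof.
apply/rowP => i; rewrite !mxE; case: unliftP => [j ->|->] //.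
by rewrite mxE tnthS.
Qed.

Lemma gauge_tcons n (x : mR) (t : n.-tuple mR) :
  gauge (row_of (tcons (x, t))) = (oneDsqr x)^-1 * gauge (row_of t).
Proof.
rewrite /gauge big_ord_recl row_of_tcons !mxE unlift_none; congr (_ * _).
by apply: eq_bigr => i _; rewrite mxE liftK.
Qed.

Lemma integral_gauge_lty n : (\int[mu n]_t (gauge (row_of t))%:E < +oo)%E.
Proof.
elim: n => [|n IH].
  have -> : mu 0 = \d_[tuple] by [].
  rewrite integral_dirac//; last by apply/measurable_EFinP; exact: measurable_gauge.
  by rewrite diracT mul1e ltry.
have -> : (\int[mu n.+1]_t (gauge (row_of t))%:E = \int[pushforward
    (@lebesgue_measure R \x mu n) (@tcons R n)]_t (gauge (row_of t))%:E)%E by [].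
rewrite ge0_integral_pushforward//=; first last.
- by move=> t _; rewrite lee_fin ltW// gauge_gt0.
- by apply/measurable_EFinP; exact: measurable_gauge.
- exact: measurable_tcons.
rewrite preimage_setT fubini_tonelli1/=; first last.
- by move=> [x t]; rewrite lee_fin ltW// gauge_gt0.
- apply/measurable_EFinP.
  exact: (measurableT_comp (@measurable_gauge n.+1) (@measurable_tcons R n)).
rewrite /fubini_F.
have -> : (fun x : mR => \int[mu n]_y (gauge (row_of (tcons (x, y))))%:E)%E =
    (fun x : mR => ((oneDsqr x)^-1)%:E * \int[mu n]_y (gauge (row_of y))%:E)%E.
  apply/funext => x; under eq_integral do rewrite gauge_tcons EFinM.
  rewrite ge0_integralZl//.
  - by apply/measurable_EFinP; exact: measurable_gauge.
  - by move=> t _; rewrite lee_fin ltW// gauge_gt0.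
rewrite ge0_integralZr//; first last.
- by apply: integral_ge0 => t _; rewrite lee_fin ltW// gauge_gt0.
- apply/measurable_EFinP; apply: continuous_measurable_fun.
  exact: continuous_oneDsqrV.
apply: lte_mul_pinfty => //.
- by apply: integral_ge0 => x _; rewrite lee_fin invr_ge0 (le_trans ler01)// oneDsqr_ge1.
- rewrite ge0_fin_numE; first exact: integral_oneDsqrV_lty.
  by apply: integral_ge0 => x _; rewrite lee_fin invr_ge0 (le_trans ler01)// oneDsqr_ge1.
Qed.

Lemma integrable_gauge n : (mu n).-integrable setT (fun t => (gauge (row_of t))%:E).
Proof.
apply/integrableP; split; first by apply/measurable_EFinP; exact: measurable_gauge.
under eq_integral do rewrite abse_EFin ger0_norm ?ltW ?gauge_gt0//.
exact: integral_gauge_lty.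
Qed.

Lemma integrable_row n (f : 'rV[R]_n -> R) (C : R) :
  measurable_fun setT (fun t : n.-tuple mR => f (row_of t)) ->
  (forall v, `|f v| <= C * gauge v) ->
  (mu n).-integrable setT (fun t => (f (row_of t))%:E).
Proof.
move=> mf Hf.
have : (mu n).-integrable setT (fun t => C%:E * (gauge (row_of t))%:E)%E.
  by apply: integrableZl => //; exact: integrable_gauge.
apply: le_integrable => //; first exact/measurable_EFinP.
move=> t _; rewrite /= lee_fin; apply: le_trans (Hf _) _.
exact: ler_norm.
Qed.

Definition gauge2 n s (p : 'rV[R]_n * 'rV[R]_s) : R := gauge p.1 * gauge p.2.

Local Notation mu2 n s := (mu n \x mu s)%E.

Lemma integral_gauge2_lty n s :
  (\int[mu2 n s]_p (gauge2 (row_of p.1, row_of p.2))%:E < +oo)%E.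
Proof.
rewrite fubini_tonelli1/=; first last.
- by move=> p; rewrite lee_fin mulr_ge0// ltW// gauge_gt0.
- apply/measurable_EFinP; apply: measurable_funM.
    exact: (measurableT_comp (@measurable_gauge n) measurable_fst).
  exact: (measurableT_comp (@measurable_gauge s) measurable_snd).
rewrite /fubini_F.
have -> : (fun x : n.-tuple mR => \int[mu s]_y (gauge2 (row_of x, row_of y))%:E)%E =
    (fun x => (gauge (row_of x))%:E * \int[mu s]_y (gauge (row_of y))%:E)%E.
  apply/funext => x; under eq_integral do rewrite /gauge2/= EFinM.
  rewrite ge0_integralZl//.
  - by apply/measurable_EFinP; exact: measurable_gauge.
  - by move=> t _; rewrite lee_fin ltW// gauge_gt0.
  - by rewrite lee_fin ltW// gauge_gt0.
rewrite ge0_integralZr//; first last.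
- by apply: integral_ge0 => t _; rewrite lee_fin ltW// gauge_gt0.
- by move=> x _; rewrite lee_fin ltW// gauge_gt0.
- by apply/measurable_EFinP; exact: measurable_gauge.
apply: lte_mul_pinfty => //.
- by apply: integral_ge0 => x _; rewrite lee_fin ltW// gauge_gt0.
- rewrite ge0_fin_numE; first exact: integral_gauge_lty.
  by apply: integral_ge0 => x _; rewrite lee_fin ltW// gauge_gt0.
- exact: integral_gauge_lty.
Qed.

Lemma measurable_gauge2 n s : measurable_fun setT
  (fun p : n.-tuple mR * s.-tuple mR => gauge2 (row_of p.1, row_of p.2)).
Proof.
apply: measurable_funM.
  exact: (measurableT_comp (@measurable_gauge n) measurable_fst).
exact: (measurableT_comp (@measurable_gauge s) measurable_snd).
Qed.

Lemma gauge2_gt0 n s (p : 'rV[R]_n * 'rV[R]_s) : 0 < gauge2 p.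
Proof. by rewrite mulr_gt0// gauge_gt0. Qed.

Lemma integrable_gauge2 n s :
  (mu2 n s).-integrable setT (fun p => (gauge2 (row_of p.1, row_of p.2))%:E).
Proof.
apply/integrableP; split; first by apply/measurable_EFinP; exact: measurable_gauge2.
under eq_integral do rewrite abse_EFin ger0_norm ?ltW ?gauge2_gt0//.
exact: integral_gauge2_lty.
Qed.

Lemma integrable_row2 n s (F : 'rV[R]_n * 'rV[R]_s -> R) (C : R) :
  continuous F -> (forall p, `|F p| <= C * gauge2 p) ->
  (mu2 n s).-integrable setT (fun p => (F (row_of p.1, row_of p.2))%:E).
Proof.
move=> cF HF.
have : (mu2 n s).-integrable setT (fun p => C%:E * (gauge2 (row_of p.1, row_of p.2))%:E)%E.
  by apply: integrableZl => //; exact: integrable_gauge2.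
apply: le_integrable => //.
  by apply/measurable_EFinP; exact: continuous_measurable_row2.
move=> t _; rewrite /= lee_fin; apply: le_trans (HF _) _.
exact: ler_norm.
Qed.

Definition iint n s (F : 'rV[R]_n * 'rV[R]_s -> R) : R :=
  Rintegral (mu n) setT (fun t => Rintegral (mu s) setT (fun u => F (row_of t, row_of u))).

Lemma integrable_row2_section n s (F : 'rV[R]_n * 'rV[R]_s -> R) (C : R) (x : 'rV[R]_n) :
  continuous F -> (forall p, `|F p| <= C * gauge2 p) ->
  (mu s).-integrable setT (fun u => (F (x, row_of u))%:E).
Proof.
move=> cF HF; apply: (@integrable_row _ (fun v => F (x, v)) (C * gauge x)).
  apply: (@continuous_measurable_row _ (fun v => F (x, v))) => v.
  have cp : {for v, continuous (fun v => (x, v))}.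
    apply: differentiable_continuous; exact: differentiable_pair.
  exact: (continuous_comp cp (cF (x, v))).
by move=> v; rewrite -mulrA; exact: HF.
Qed.

(** Fubini: the iterated integral is an integral for the product measure, hence
may be estimated, and its order exchanged. *)
Lemma iintE n s (F : 'rV[R]_n * 'rV[R]_s -> R) (C : R) :
  continuous F -> (forall p, `|F p| <= C * gauge2 p) ->
  iint F = Rintegral (mu2 n s) setT (fun p => F (row_of p.1, row_of p.2)).
Proof.
move=> cF HF; rewrite /iint /Rintegral; congr (fine _).
rewrite -(integral12_prod_meas1 (integrable_row2 cF HF)) /fubini_F.
apply: eq_integral => t _; rewrite fineK//=.
exact: integrable_fin_num (integrable_row2_section _ cF HF).
Qed.

Lemma iint_le n s : exists2 K : R, 0 <= K &
  forall (F : 'rV[R]_n * 'rV[R]_s -> R) (C : R),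
  continuous F -> (forall p, `|F p| <= C * gauge2 p) -> `|iint F| <= C * K.
Proof.
exists (Rintegral (mu2 n s) setT (fun p => gauge2 (row_of p.1, row_of p.2))).
  by apply: Rintegral_ge0 => p _; rewrite ltW// gauge2_gt0.
move=> F C cF HF; rewrite (iintE cF HF).
apply: le_trans (le_normr_Rintegral _ (integrable_row2 cF HF)) _ => //.
rewrite -RintegralZl//; last exact: integrable_gauge2.
apply: le_Rintegral => //.
- exact: integrable_norm (integrable_row2 cF HF).
- have := integrableZl measurableT C (integrable_gauge2 n s).
  by apply: eq_integrable.
Qed.

Lemma iintD n s (F G : 'rV[R]_n * 'rV[R]_s -> R) (C D : R) :
  continuous F -> continuous G ->
  (forall p, `|F p| <= C * gauge2 p) -> (forall p, `|G p| <= D * gauge2 p) ->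
  iint (fun p => F p + G p) = iint F + iint G.
Proof.
move=> cF cG HF HG.
have cFG : continuous (fun p => F p + G p) by move=> p; apply: cvgD; [exact: cF|exact: cG].
have HFG p : `|F p + G p| <= (C + D) * gauge2 p.
  by rewrite mulrDl (le_trans (ler_normD _ _))// lerD.
rewrite (iintE cF HF) (iintE cG HG) (iintE cFG HFG) RintegralD//.
- exact: integrable_row2 cF HF.
- exact: integrable_row2 cG HG.
Qed.

(** The support of f lies in [-B, B], and the fundamental theorem of calculus
gives f(B) - f(-B) = 0. *)
Lemma integral_derivative_eq0 (f h : R -> R) (b : R) :
  (forall x, is_derive x (1:R) f (h x)) -> continuous h ->
  (forall x, b < `|x| -> f x = 0) ->
  (\int[@lebesgue_measure R]_x (h x)%:E = 0)%E.
Proof.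
move=> df ch f0.
pose B := `|b| + 1.
have B0 : 0 < B by rewrite ltr_wpDl.
have bB : b < B by rewrite (le_lt_trans (ler_norm _))// ltrDl.
have h0 x : b < `|x| -> h x = 0.
  move=> bx; have [dx <-] := df x.
  rewrite (@derive_near_eq _ _ f (fun=> 0)) ?derive_cst//.
  have cn : `|y| @[y --> x] --> `|x| by apply: cvg_norm; exact: cvg_id.
  have : \forall y \near x, b < `|y| by exact: cvgr_gt cn _ bx.
  by apply: filterS => y; exact: f0.
have -> : (\int[@lebesgue_measure R]_x (h x)%:E = \int[@lebesgue_measure R]_(x in `[(- B)%R, B]) (h x)%:E)%E.
  rewrite [RHS]integral_mkcond; apply: eq_integral => x _; rewrite patchE.
  case: ifPn => // /negP xB; rewrite h0//.
  rewrite ltNge; apply/negP => xb; apply: xB; rewrite inE/= in_itv/= -ler_norml.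
  by rewrite (le_trans xb)// ltW.
have cf : continuous f.
  by move=> x; apply: differentiable_continuous; apply/derivable1_diffP; have [] := df x.
rewrite (@continuous_FTC2 _ _ f).
- by rewrite !f0 ?subee// ?normrN (gtr0_norm B0).
- by rewrite -subr_gt0 opprK addr_gt0.
- exact: continuous_subspaceT.
- split.
  + by move=> x _; have [] := df x.
  + exact: cvg_at_right_filter (cf _).
  + exact: cvg_at_left_filter (cf _).
- by move=> x _; rewrite derive1E; have [] := df x.
Unshelve. all: by end_near. Qed.

Lemma integral_tcons n (f : 'rV[R]_n.+1 -> R) (C : R) :
  measurable_fun setT (fun t : n.+1.-tuple mR => f (row_of t)) ->
  (forall v, `|f v| <= C * gauge v) ->
  (@lebesgue_measure R \x mu n)%E.-integrable setT (fun p => (f (row_of (tcons p)))%:E) /\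
  (\int[mu n.+1]_t (f (row_of t))%:E =
   \int[@lebesgue_measure R \x mu n]_p (f (row_of (tcons p)))%:E)%E.
Proof.
move=> mf Hf.
have mg : measurable_fun setT (fun t : n.+1.-tuple mR => (f (row_of t))%:E).
  exact/measurable_EFinP.
have intf : (@lebesgue_measure R \x mu n)%E.-integrable setT
    (fun p => (f (row_of (tcons p)))%:E).
  apply/integrableP; split.
    exact: (measurableT_comp mg (@measurable_tcons R n)).
  have /integrableP[_] := integrable_row mf Hf.
  have -> : (\int[mu n.+1]_t `|(f (row_of t))%:E| = \int[pushforward
    (@lebesgue_measure R \x mu n) (@tcons R n)]_t `|(f (row_of t))%:E|)%E by [].
  rewrite ge0_integral_pushforward//=.
  - exact: measurable_tcons.
  - by apply/measurable_EFinP; exact: measurableT_comp.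
split => //.
have -> : (\int[mu n.+1]_t (f (row_of t))%:E = \int[pushforward
    (@lebesgue_measure R \x mu n) (@tcons R n)]_t (f (row_of t))%:E)%E by [].
rewrite integral_pushforward//.
exact: measurable_tcons.
Qed.

Definition row_cons n (x : R) (v : 'rV[R]_n) : 'rV[R]_n.+1 :=
  \row_i (if unlift ord0 i is Some j then v 0 j else x).

Lemma row_cons_line0 n (x y : R) (v : 'rV[R]_n) :
  row_cons x v + y *: unitv ord0 = row_cons (x + y) v.
Proof.
apply/rowP => i; rewrite !mxE eqxx/=; case: unliftP => [j ->|->].
  by rewrite eq_sym (negbTE (neq_lift _ _)) mulr0 addr0.
by rewrite eqxx mulr1.
Qed.

Lemma row_cons_line n (x y : R) (v : 'rV[R]_n) (j : 'I_n) :
  row_cons x v + y *: unitv (lift ord0 j) = row_cons x (v + y *: unitv j).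
Proof.
apply/rowP => i; rewrite !mxE eqxx/=; case: unliftP => [k ->|->].
  by rewrite !mxE eqxx/= (inj_eq lift_inj).
by rewrite (negbTE (neq_lift _ _)) mulr0 addr0.
Qed.

Lemma gauge_row_cons n (x : R) (v : 'rV[R]_n) :
  gauge (row_cons x v) = (oneDsqr x)^-1 * gauge v.
Proof.
rewrite /gauge big_ord_recl !mxE unlift_none; congr (_ * _).
by apply: eq_bigr => i _; rewrite mxE liftK.
Qed.

(** Induction on the dimension peels off one coordinate at a time, integrating
the i-th one first. *)
Lemma integral_partial_eq0 n (i : 'I_n) (f h : 'rV[R]_n -> R) (b C : R) :
  (forall v x, is_derive x (1:R) (fun y : R => f (v + y *: unitv i)) (h (v + x *: unitv i))) ->
  (forall v, continuous (fun x : R => h (v + x *: unitv i))) ->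
  measurable_fun setT (fun t : n.-tuple mR => h (row_of t)) ->
  (forall v, `|h v| <= C * gauge v) ->
  (forall v : 'rV[R]_n, b < `|v 0 i| -> f v = 0) ->
  (\int[mu n]_t (h (row_of t))%:E = 0)%E.
Proof.
elim: n i f h C => [[]//|n IH] i f h C df ch mh Hh f0.
have [ih ->] := integral_tcons mh Hh.
case: (unliftP ord0 i) => [j|] ij; last first.
  rewrite -(integral21_prod_meas1 ih) /fubini_G; apply: integral0_eq => t _.
  apply: (@integral_derivative_eq0 (fun x => f (row_cons x (row_of t)))
     (fun x => h (row_of (tcons (x, t)))) b).
  - move=> x; have := df (row_cons 0 (row_of t)) x; rewrite ij row_cons_line0 add0r row_of_tcons.
    by under [X in is_derive _ _ X]funext do rewrite row_cons_line0 add0r.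
  - have := ch (row_cons 0 (row_of t)); rewrite ij.
    rewrite (_ : (fun x => h (row_of (tcons (x, t)))) = (fun x => h (row_cons 0 (row_of t) + x *: unitv ord0)))//.
    by apply/funext => x; rewrite row_cons_line0 add0r row_of_tcons.
  - by move=> x bx; apply: f0; rewrite ij mxE unlift_none.
rewrite -(integral12_prod_meas1 ih) /fubini_F; apply: integral0_eq => x _.
have hE t : h (row_of (tcons (x, t))) = h (row_cons x (row_of t)) by rewrite row_of_tcons.
under eq_integral do rewrite hE.
apply: (@IH j (fun v => f (row_cons x v)) (fun v => h (row_cons x v)) (C * (oneDsqr x)^-1)).
- move=> v y; have := df (row_cons x v) y; rewrite ij row_cons_line.
  by under [X in is_derive _ _ X]funext do rewrite row_cons_line.
- move=> v; have := ch (row_cons x v); rewrite ij.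
  by under [X in continuous X]funext do rewrite row_cons_line.
- under eq_fun do rewrite -hE.
  apply: (@measurableT_comp _ _ _ _ _ _ (fun p => h (row_of (tcons p)))).
    exact: (measurableT_comp mh (@measurable_tcons R n)).
  exact: measurable_pair1.
- by move=> v; rewrite -mulrA -gauge_row_cons.
- by move=> v bv; apply: f0; rewrite ij mxE liftK.
Qed.

Lemma gauge_ge n (v : 'rV[R]_n) (b : R) : `|v| <= b -> (oneDsqr b)^-1 ^+ n <= gauge v.
Proof.
move=> vb; have b0 := le_trans (normr_ge0 v) vb.
rewrite /gauge -[n in X in X <= _]card_ord -prodr_const; apply: ler_prod => i _.
have o1 (x : R) : 0 < oneDsqr x by rewrite (lt_le_trans ltr01)// oneDsqr_ge1.
rewrite invr_ge0 ltW// lef_pV2 ?posrE// /oneDsqr lerD2l -(real_normK (num_real (v 0 i))).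
by rewrite ler_pXn2r ?nnegrE// (le_trans (rV_coord_le v i)).
Qed.

Lemma compact_support_gauge2 n s (F : 'rV[R]_n * 'rV[R]_s -> R) (b : R) :
  continuous F -> (forall p, b < `|p.1| \/ b < `|p.2| -> F p = 0) ->
  exists C : R, forall p, `|F p| <= C * gauge2 p.
Proof.
move=> cF F0.
pose K := [set v : 'rV[R]_n | `|v| <= b] `*` [set v : 'rV[R]_s | `|v| <= b].
have cK : compact K by apply: compact_setX; rewrite -[X in compact X](_ : [set v | `|v - 0| <= b] = _);
    try exact: compact_norm_ball; apply/seteqP; split => v /=; rewrite subr0.
have cFK : compact (F @` K).
  by apply: continuous_compact => //; exact: continuous_subspaceT.
have [M [Mr HM]] := compact_bounded cFK.
pose C := `|M| + 1.
have HC p : K p -> `|F p| <= C.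
  move=> Kp; have MC : M < C by rewrite (le_lt_trans (ler_norm _))// ltrDl.
  by apply: (HM C MC); exists p.
pose g := (oneDsqr b)^-1 ^+ n * (oneDsqr b)^-1 ^+ s.
have g0 : 0 < g by rewrite mulr_gt0// exprn_gt0// invr_gt0 (lt_le_trans ltr01)// oneDsqr_ge1.
exists (C / g) => p.
have [p1|p1] := leP `|p.1| b; last first.
  have -> : F p = 0 by apply: F0; left.
  by rewrite normr0 mulr_ge0 ?divr_ge0 ?addr_ge0// ltW ?gauge2_gt0.
have [p2|p2] := leP `|p.2| b; last first.
  have -> : F p = 0 by apply: F0; right.
  by rewrite normr0 mulr_ge0 ?divr_ge0 ?addr_ge0// ltW ?gauge2_gt0.
apply: le_trans (HC _ _) _; first by split.
rewrite -mulrA ler_peMr ?addr_ge0// mulrC ler_pdivlMr// mul1r.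
by apply: ler_pM; rewrite ?exprn_ge0 ?invr_ge0 ?(le_trans ler01) ?oneDsqr_ge1 ?gauge_ge.
Qed.

Lemma derive_support n s (F : 'rV[R]_n * 'rV[R]_s -> R) (b : R) v :
  (forall p, b < `|p.1| \/ b < `|p.2| -> F p = 0) ->
  (forall p, b < `|p.1| \/ b < `|p.2| -> 'D_v F p = 0).
Proof.
move=> F0 p bp; rewrite (@derive_near_eq _ _ F (fun=> 0)) ?derive_cst//.
have n1 : `|q.1| @[q --> p] --> `|p.1| by apply: cvg_norm; exact: cvg_fst.
have n2 : `|q.2| @[q --> p] --> `|p.2| by apply: cvg_norm; exact: cvg_snd.
case: bp => bp.
  have : \forall q \near p, b < `|q.1| by exact: cvgr_gt n1 _ bp.
  by apply: filterS => q hq; apply: F0; left.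
have : \forall q \near p, b < `|q.2| by exact: cvgr_gt n2 _ bp.
by apply: filterS => q hq; apply: F0; right.
Qed.

Lemma continuous_line n s (G : 'rV[R]_n * 'rV[R]_s -> R) p v :
  continuous G -> continuous (fun x : R => G (p + x *: v)).
Proof.
move=> cG x; apply: (@continuous_comp _ _ _ (fun x : R => p + x *: v) G); last exact: cG.
by apply: cvgD; [exact: cvg_cst|apply: cvgZl; exact: cvg_id].
Qed.

Lemma xtline_l n s (x : 'rV[R]_n) (v : 'rV[R]_s) i (y : R) :
  (x, v) + y *: xtdir (inl i) = (x + y *: unitv i, v).
Proof. by congr (_, _); rewrite /= scaler0 addr0. Qed.

Lemma xtline_r n s (x : 'rV[R]_n) (v : 'rV[R]_s) j (y : R) :
  (x, v) + y *: xtdir (inr j) = (x, v + y *: unitv j).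
Proof. by congr (_, _); rewrite /= scaler0 addr0. Qed.

(** The boundary-free integration by parts: the inner integral vanishes for a
derivative in theta, and after exchanging the integrals for one in x. *)
Lemma iint_derive_eq0 n s (d : 'I_n + 'I_s) (F : 'rV[R]_n * 'rV[R]_s -> R) (b : R) :
  (forall p, differentiable F p) -> continuous ('D_(xtdir d) F) ->
  (forall p, b < `|p.1| \/ b < `|p.2| -> F p = 0) ->
  iint ('D_(xtdir d) F) = 0.
Proof.
move=> dF cD F0.
have [C HC] := compact_support_gauge2 cD (derive_support _ F0).
have line p x := @is_derive_line R _ F p (xtdir d) x (dF _).
have clin p := @continuous_line _ _ _ p (xtdir d) cD.
case: d cD HC line clin => [i|j] cD HC line clin; last first.
  suff H (x : 'rV[R]_n) : (\int[mu s]_u ('D_(xtdir (inr j)) F (x, row_of u))%:E = 0)%E.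
    by rewrite /iint /Rintegral integral0_eq// => t _; rewrite H.
  apply: (@integral_partial_eq0 _ j (fun v => F (x, v))
     (fun v => 'D_(xtdir (inr j)) F (x, v)) b (C * gauge x)).
  - move=> v y; have := line (x, v) y; rewrite xtline_r.
    rewrite (_ : (fun t : R => F ((x, v) + t *: xtdir (inr j))) =
       (fun y => F (x, v + y *: unitv j)))//.
    by apply/funext => z; rewrite xtline_r.
  - move=> v; have := clin (x, v).
    rewrite (_ : (fun t : R => 'D_(xtdir (inr j)) F ((x, v) + t *: xtdir (inr j))) =
       (fun y => 'D_(xtdir (inr j)) F (x, v + y *: unitv j)))//.
    by apply/funext => y; rewrite xtline_r.
  - apply: (@continuous_measurable_row _ (fun v => 'D_(xtdir (inr j)) F (x, v))) => v.
    have cp : {for v, continuous (fun v => (x, v))}.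
      by apply: differentiable_continuous; exact: differentiable_pair.
    exact: (continuous_comp cp (cD (x, v))).
  - by move=> v; rewrite -mulrA; exact: HC.
  - by move=> v bv; apply: F0; right; rewrite (lt_le_trans bv)// rV_coord_le.
rewrite (iintE cD HC) /Rintegral -(integral21_prod_meas1 (integrable_row2 cD HC)).
rewrite /fubini_G integral0_eq// => u _ /=.
apply: (@integral_partial_eq0 _ i (fun v => F (v, row_of u))
   (fun v => 'D_(xtdir (inl i)) F (v, row_of u)) b (C * gauge (row_of u))).
- move=> v x; have := line (v, row_of u) x; rewrite xtline_l.
  rewrite (_ : (fun t : R => F ((v, row_of u) + t *: xtdir (inl i))) =
     (fun y => F (v + y *: unitv i, row_of u)))//.
  by apply/funext => y; rewrite xtline_l.
- move=> v; have := clin (v, row_of u).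
  rewrite (_ : (fun t : R => 'D_(xtdir (inl i)) F ((v, row_of u) + t *: xtdir (inl i))) =
     (fun y => 'D_(xtdir (inl i)) F (v + y *: unitv i, row_of u)))//.
  by apply/funext => y; rewrite xtline_l.
- have := measurableT_comp (continuous_measurable_row2 cD) (measurable_pair2 u).
  by [].
- by move=> v; rewrite -mulrA [gauge (row_of u) * _]mulrC; exact: HC.
- by move=> v bv; apply: F0; left; rewrite (lt_le_trans bv)// rV_coord_le.
Qed.

End row_vectors.

(** * Cutoff functions *)
Section flat.
Context {R : realType}.

(** The functions t^-p e^(-1/t) extended by 0 are smooth, and their derivatives
are combinations of functions of the same kind ([is_derive_flat]). *)
Definition flat (p : nat) (t : R) : R :=
  if 0 < t then t^-1 ^+ p * expR (- t^-1) else 0.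

Lemma expR_inv_le (q : nat) (t : R) : 0 < t -> expR (- t^-1) <= (q.+1%:R * t) ^+ q.+1.
Proof.
move=> t0; have u0 : 0 < q.+1%:R * t by rewrite mulr_gt0.
rewrite expRN -[X in _ <= X]invrK lef_pV2 ?posrE ?expR_gt0 ?invr_gt0 ?exprn_gt0//.
have -> : t^-1 = q.+1%:R * (q.+1%:R * t)^-1 by field; rewrite gt_eqF//= andbT pnatr_eq0.
rewrite expRM_natl -exprVn ler_pXn2r ?nnegrE ?invr_ge0 ?(ltW u0) ?expR_ge0//.
by apply: le_trans (expR_ge1Dx _); rewrite lerDr.
Qed.

Lemma flat_ge0 p t : 0 <= flat p t.
Proof. by rewrite /flat; case: ifPn => // t0; rewrite mulr_ge0 ?expR_ge0 ?exprn_ge0 ?invr_ge0 ?ltW. Qed.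

(** e^(-1/t) vanishes at 0 faster than every power of t. *)
Lemma flat_le (p q : nat) : exists2 C : R, 0 <= C &
  forall t, 0 < t -> flat p t <= C * t ^+ q.
Proof.
case: (posnP (p + q)) => [|pq0].
  move=> /eqP; rewrite addn_eq0 => /andP[/eqP -> /eqP ->].
  exists 1 => // t t0; rewrite /flat t0 !expr0 !mul1r -[leRHS]expR0 ler_expR.
  by rewrite oppr_le0 invr_ge0 ltW.
exists ((p + q)%:R ^+ (p + q)); first by rewrite exprn_ge0.
move=> t t0; rewrite /flat t0.
rewrite mulrC exprVn ler_pdivrMr ?exprn_gt0// -mulrA -exprD [(q + p)%N]addnC.
by rewrite -exprMn -(prednK pq0); exact: expR_inv_le.
Qed.

Lemma flat_bounded p : exists C : R, forall t, `|flat p t| <= C.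
Proof.
have [C C0 H] := flat_le p 0; exists C => t; rewrite ger0_norm ?flat_ge0//.
have [t0|t0] := ltP 0 t; first by have := H _ t0; rewrite expr0 mulr1.
by rewrite /flat ltNge t0.
Qed.

Lemma is_derive_flat p (t : R) :
  is_derive t (1 : R) (flat p) (- p%:R * flat p.+1 t + flat p.+2 t).
Proof.
have [t0|t0|t0] := ltgtP t 0.
- have E : \forall y \near t, 0 = flat p y.
    have : \forall y \near t, y < 0 by exact: cvgr_lt (cvg_id : y @[y --> t] --> t) _ t0.
    by apply: filterS => y y0; rewrite /flat ltNge ltW.
  have d0 : is_derive t (1 : R) (fun _ => 0 : R) 0 by exact: is_derive_cst.
  rewrite /flat ltNge (ltW t0)/= mulr0 addr0.
  apply: DeriveDef; last by rewrite -(derive_near_eq _ E); have [] := d0.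
  by apply/derivable1_diffP; apply: (differentiable_near_eq E); exact: differentiable_cst.
- pose g (y : R) := y^-1 ^+ p * expR (- y^-1).
  have E : \forall y \near t, g y = flat p y.
    have : \forall y \near t, 0 < y by exact: cvgr_gt (cvg_id : y @[y --> t] --> t) _ t0.
    by apply: filterS => y y0; rewrite /flat y0.
  have dg : is_derive t (1 : R) g (- p%:R * flat p.+1 t + flat p.+2 t).
    have tn0 : t != 0 by rewrite gt_eqF.
    have di : is_derive t (1 : R) (fun y : R => y^-1) (- t ^- 2).
      apply: DeriveDef; first exact: (@derivableV _ _ id t 1 tn0).
      by rewrite (@deriveV _ _ id t 1 tn0)// derive_id [LHS]mulr1.
    have de : is_derive t (1 : R) (fun y : R => expR (- y^-1)) (t ^- 2 * expR (- t^-1)).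
      have dn : is_derive t (1 : R) (fun y : R => - y^-1) (t ^- 2).
        by have := is_deriveN di; rewrite opprK.
      have ddn := (derivable1_diffP _ _).1 (@ex_derive _ _ _ _ _ _ _ dn).
      have [dx Dx] := is_derive_expR (- t^-1).
      apply: DeriveDef; last first.
        by rewrite (derive_comp _ ddn dx) Dx mulrC; congr (_ * _); have [] := dn.
      by apply/derivable1_diffP; exact: differentiable_comp1.
    have := is_deriveM (is_deriveX p di) de.
    have -> : (fun y : R => y^-1) ^+ p * (fun y : R => expR (- y^-1)) = g.
      by apply/funext => y; rewrite /g !fctE.
    move=> dg; apply: (is_derive_eq dg); rewrite /flat t0 /= !fctE.
    have alg (e u v : R) : v = u ^+ 2 -> u ^+ p * (v * e) +
        e * ((p%:R * u ^+ p.-1) * - v) = - p%:R * (u ^+ p.+1 * e) + u ^+ p.+2 * e.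
      by move=> ->; case: (p) => [|q]; rewrite /= ?exprS -?natr1; ring.
    exact: (alg _ _ _ (esym (exprVn t 2))).
  apply: DeriveDef; last by rewrite -(derive_near_eq _ E); have [] := dg.
  apply/derivable1_diffP; apply: (differentiable_near_eq E).
  by apply/derivable1_diffP; have [] := dg.
have f0 q : flat q 0 = 0 by rewrite /flat ltxx.
rewrite t0 !f0 mulr0 addr0.
have [C C0 H] := flat_le p 2.
suff L : (fun h : R => h^-1 *: ((flat p \o shift 0) (h *: (1 : R)) - flat p 0)) @ 0^' --> (0 : R).
  by apply: DeriveDef; [apply/cvg_ex; exists 0; exact: L|exact: (cvg_lim _ L)].
rewrite f0.
have b h : `|h^-1 *: ((flat p \o shift 0) (h *: (1 : R)) - 0)| <= C * `|h|.
  rewrite /= subr0 addr0 [h *: _]mulr1 normrZ normfV.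
  have [h0|h0] := ltP 0 h; last first.
    by rewrite [flat p h]/flat ltNge h0/= normr0 mulr0 mulr_ge0.
  rewrite (ger0_norm (flat_ge0 p h)) (gtr0_norm h0) mulrC ler_pdivrMr// -mulrA -expr2.
  exact: H.
have C1 : 0 < C + 1 by rewrite ltr_wpDl.
apply/cvgrPdist_le => e e0; near=> h; rewrite sub0r normrN.
apply: le_trans (b h) _.
apply: (@le_trans _ _ ((C + 1) * `|h|)); first by rewrite ler_wpM2r// lerDl.
rewrite mulrC -ler_pdivlMr//; apply: ltW; near: h; apply: nbhs_dnbhs.
have cn : `|h| @[h --> (0:R)] --> (0 : R) by rewrite -[X in _ --> X](@normr0 R R); apply: cvg_norm; exact: cvg_id.
have ec : 0 < e / (C + 1) by exact: divr_gt0.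
exact: cvgr_lt cn _ ec.
Unshelve. all: by end_near. Qed.

Lemma derive_flat p t : 'D_1 (flat p) t = - p%:R * flat p.+1 t + flat p.+2 t.
Proof. by have [] := is_derive_flat p t. Qed.

Lemma flat_lipschitz p : exists2 C : R, 0 <= C &
  forall x y, `|flat p x - flat p y| <= C * `|x - y|.
Proof.
have [A HA] := flat_bounded p.+1; have [B HB] := flat_bounded p.+2.
have A0 : 0 <= A by exact: le_trans (normr_ge0 _) (HA 0).
have B0 : 0 <= B by exact: le_trans (normr_ge0 _) (HB 0).
exists (p%:R * A + B); first by rewrite addr_ge0// mulr_ge0.
move=> x y; wlog xy : x y / x <= y.
  by move=> H; have [/H//|/ltW/H] := leP x y; rewrite distrC [`|y - x|]distrC.
rewrite distrC [`|x - y|]distrC.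
have cf : {within `[x, y], continuous (flat p)}.
  apply: derivable_within_continuous => z _.
  exact: (@ex_derive _ _ _ _ _ _ _ (is_derive_flat p z)).
have [z _ ->] := MVT_segment xy (fun z _ => is_derive_flat p z) cf.
rewrite normrM ler_wpM2r//; apply: le_trans (ler_normD _ _) _.
by rewrite lerD// normrM normrN normr_nat ler_wpM2l.
Qed.
End flat.

Section affine_support.
Context {R : realType} {V : normedModType R} {I : finType} (bd : I -> V)
  (om : I -> V -> R) {T : Type} (U B : T -> set V).
Hypothesis om0 : forall d p, 0 <= om d p.
Hypothesis oU : forall t, open (U t).
Hypothesis BU : forall t, B t `<=` U t.
Implicit Types (w f g : T -> V -> R).

Lemma wclass_affine l w g (c : I -> T -> R) :
  (forall t p, U t p -> differentiable (g t) p) ->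
  (forall d t p, U t p -> 'D_(bd d) (g t) p = c d t) ->
  (exists C : R, forall t p, B t p -> `|g t p| <= C * w t p) ->
  (forall d, exists C : R, forall t p, B t p -> `|c d t| <= C * (w t p * om d p)) ->
  (forall t p, B t p -> 0 <= w t p) ->
  wclass bd om U B l w g.
Proof.
move=> dg Dg bg bc w0; case: l => [|l]; first by split.
split => //; split => // d.
apply: (wclass_ext oU BU (f := fun t _ => c d t)) => [t p Up|]; first by rewrite Dg.
apply: wclass_cst => //.
by move=> t p Bp; rewrite mulr_ge0 ?w0.
Qed.

(** Bounds on the support of f are bounds everywhere: outside the closed set S,
f and all its derivatives vanish. *)
Lemma wclass_support l w f (S U' B' : T -> set V) :
  (forall t, closed (S t)) -> (forall t p, ~ S t p -> f t p = 0) ->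
  (forall t p, U' t p -> S t p -> U t p) ->
  (forall t p, B' t p -> S t p -> B t p) ->
  (forall t p, B' t p -> 0 <= w t p) ->
  wclass bd om U B l w f -> wclass bd om U' B' l w f.
Proof.
move=> cS; elim: l w f => [|l IH] w f f0 US BS w0 [[C HC] H];
  have b : exists D : R, forall t p, B' t p -> `|f t p| <= D * w t p by
    exists `|C| => t p Bp; have [Sp|Sp] := pselect (S t p);
    [apply: le_trans (HC _ _ (BS _ _ Bp Sp)) _; rewrite ler_wpM2r ?ler_norm// w0
    |rewrite f0// normr0 mulr_ge0// w0].
  by split.
split => //.
have E t p : ~ S t p -> \forall q \near p, 0 = f t q.
  move=> nSp; have oS : open (~` S t) by exact: closed_openC.
  by apply: filterS (open_near oS nSp) => q nSq; rewrite f0.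
have [H1 H2] := H; split => [t p Up|d].
  have [Sp|Sp] := pselect (S t p); first exact: H1 (US _ _ Up Sp).
  by apply: (differentiable_near_eq (E _ _ Sp)); exact: differentiable_cst.
apply: IH (H2 d) => //.
- by move=> t p Sp; rewrite -(derive_near_eq _ (E _ _ Sp)) derive_cst.
- by move=> t p Bp; rewrite mulr_ge0// w0.
Qed.

Lemma wclass_flat p l f : wclass bd om U B l (fun _ _ => 1) f ->
  wclass bd om U B l (fun _ _ => 1) (fun t v => flat p (f t v)).
Proof.
move=> Hf; apply: (wclass_comp om0 oU BU (h := flat)) Hf _ => [q y|q|q].
- exact: (@ex_derive _ _ _ _ _ _ _ (is_derive_flat q y)).
- by exists (- q%:R), q.+1, 1, q.+2 => y; rewrite derive_flat mul1r.
- by have [C HC] := @flat_bounded R q; exists C => t v _; exact: HC.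
Qed.

Lemma wclass_trig l f : wclass bd om U B l (fun _ _ => 1) f ->
  wclass bd om U B l (fun _ _ => 1) (fun t v => cos (f t v)) /\
  wclass bd om U B l (fun _ _ => 1) (fun t v => sin (f t v)).
Proof.
move=> Hf; pose h (b : bool) : R -> R := if b then cos else sin.
suff H b : wclass bd om U B l (fun _ _ => 1) (fun t v => h b (f t v)).
  by split; [exact: (H true)|exact: (H false)].
apply: (wclass_comp om0 oU BU (h := h)) Hf b => [b y|b|b].
- by case: b; [exact: derivable_cos|exact: derivable_sin].
- case: b => /=.
    by exists (-1), false, 0, false => y; rewrite /= mul0r addr0 mulN1r; have [] := is_derive_cos y.
  by exists 1, true, 0, true => y; rewrite /= mul0r addr0 mul1r; have [] := is_derive_sin y.
- exists 1 => t v _; case: b => /=; [exact: cos_max|exact: sin_max].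
Qed.

End affine_support.

Section coordinates.
Context {R : realType} (n s : nat).
Local Notation X := ('rV[R]_n * 'rV[R]_s)%type.

Lemma differentiable_coordx (i : 'I_n) (p : X) : differentiable (fun q : X => q.1 0 i : R) p.
Proof.
have dfst : differentiable (@fst 'rV[R]_n 'rV[R]_s) p.
  by apply: linear_differentiable => q; exact: cvg_fst.
exact: (differentiable_comp dfst (differentiable_coord _ _ _)).
Qed.

Lemma differentiable_coordt (j : 'I_s) (p : X) : differentiable (fun q : X => q.2 0 j : R) p.
Proof.
have dsnd : differentiable (@snd 'rV[R]_n 'rV[R]_s) p.
  by apply: linear_differentiable => q; exact: cvg_snd.
exact: (differentiable_comp dsnd (differentiable_coord _ _ _)).
Qed.

Lemma derive_linear {W : normedModType R} (g : W -> R) (v p : W) (c : R) :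
  (forall h, g (h *: v + p) = h * c + g p) -> 'D_v g p = c.
Proof.
move=> H; have H' : (fun h : R => h^-1 *: ((g \o shift p) (h *: v) - g p)) @ 0^' --> c.
  apply: cvg_near_cst; near=> h; rewrite /= H addrK.
  have sE (a b : R) : a *: (b : R^o) = a * b by [].
  have hn : h != 0 by near: h; exact: nbhs_dnbhs_neq.
  exact: etrans (sE _ _) (mulKf hn c).
exact: (cvg_lim _ H').
Unshelve. all: by end_near. Qed.

Lemma derive_xtcoord (d d' : 'I_n + 'I_s) (p : X) :
  'D_(xtdir d') (@xtcoord R n s d) p = (d == d')%:R.
Proof.
apply: derive_linear => h; case: d d' => [i|i] [j|j]; rewrite /= !mxE //=.
Qed.

Lemma differentiable_xtcoord d p : differentiable (@xtcoord R n s d) p.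
Proof. by case: d => i; [exact: differentiable_coordx|exact: differentiable_coordt]. Qed.
End coordinates.

Section reindexing.
Context {R : realType} {V : normedModType R} {I : finType} (bd : I -> V)
  (om : I -> V -> R).

Lemma wclass_reindex (T T' : Type) (tau : T' -> T) (U B : T -> set V) l w f :
  wclass bd om U B l w f ->
  wclass bd om (fun t => U (tau t)) (fun t => B (tau t)) l
    (fun t => w (tau t)) (fun t => f (tau t)).
Proof.
elim: l w f => [|l IH] w f [[C HC] H]; first by split=> //; exists C => t p; exact: HC.
split; first by exists C => t p; exact: HC.
have [H1 H2] := H; split => [t p|d]; first exact: H1.
by apply: IH (H2 d).
Qed.

Lemma wclass_sub (T : Type) (U B U' B' : T -> set V) l w f :
  (forall t, U' t `<=` U t) -> (forall t, B' t `<=` B t) ->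
  wclass bd om U B l w f -> wclass bd om U' B' l w f.
Proof.
move=> UU BB; elim: l w f => [|l IH] w f [[C HC] H].
  by split=> //; exists C => t p /BB; exact: HC.
split; first by exists C => t p /BB; exact: HC.
have [H1 H2] := H; split => [t p /UU|d]; first exact: H1.
by apply: IH (H2 d).
Qed.

End reindexing.

(** Cutoffs flat (1 - sum_j y_j^2), for affine functions y_j with derivatives
c_j: on the set where they do not vanish the y_j are bounded by 1, which is all
that the class estimates require. *)
Section cutoffs.
Context {R : realType} {V : normedModType R} {I : finType} (bd : I -> V)
  (om : I -> V -> R) {T : Type}.
Hypothesis om0 : forall d p, 0 <= om d p.
Variables (J : finType) (y : J -> T -> V -> R) (c : J -> I -> T -> R).
Hypothesis dy : forall j t p, differentiable (y j t) p.
Hypothesis Dy : forall j d t p, 'D_(bd d) (y j t) p = c j d t.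
Let S t := [set p | \sum_j y j t p ^+ 2 <= 1].
Hypothesis bc : forall j d, exists C : R, forall t p, S t p -> `|c j d t| <= C * om d p.
Let full := fun _ : T => [set: V].
Let oT (t : T) : open (full t) := openT.
Let SU (t : T) : S t `<=` full t. Proof. by []. Qed.

Let sum_sqr_derive d t p (r : seq J) :
  differentiable (fun p => \sum_(j <- r) y j t p ^+ 2) p /\
  'D_(bd d) (fun p => \sum_(j <- r) y j t p ^+ 2) p = \sum_(j <- r) 2 * y j t p * c j d t.
Proof.
have dsq j : differentiable (fun p => y j t p ^+ 2) p.
  by apply: differentiable_mul.
elim: r => [|j r [IH1 IH2]].
    have -> : (fun p : V => \sum_(j <- [::]) y j t p ^+ 2) = (fun=> 0).
      by apply/funext => u; rewrite big_nil.
    by split; [exact: differentiable_cst|rewrite derive_cst big_nil].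
  have -> : (fun p : V => \sum_(j <- j :: r) y j t p ^+ 2) =
     (fun p => y j t p ^+ 2 + \sum_(j <- r) y j t p ^+ 2).
    by apply/funext => u; rewrite big_cons.
  split; first exact: differentiable_add.
  rewrite derive_add// IH2 big_cons; congr (_ + _).
  rewrite (_ : (fun p => y j t p ^+ 2) = (fun p => y j t p * y j t p))//.
  by rewrite derive_mul// Dy; ring.
Qed.

Let closedS t : closed (S t).
Proof.
have -> : S t = (fun p => \sum_j y j t p ^+ 2) @^-1` [set x | x <= 1] by [].
apply: closed_comp => [p _|]; last exact: closed_le.
apply: differentiable_continuous.
by apply: differentiable_bigsum => j; exact: differentiable_mul.
Qed.

Lemma cutoff_coord l j : wclass bd om full S l (fun _ _ => 1) (y j).
Proof.
apply: (@wclass_affine _ _ _ _ _ _ _ _ om0 oT SU _ _ _ (c j)) => //.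
- exists 1 => t p Sp; rewrite mulr1 -(ler_pXn2r (n := 2))// ?nnegrE// expr1n real_normK ?num_real//.
  apply: le_trans Sp; rewrite (bigD1 j)//= lerDl.
  by apply: sumr_ge0 => i _; exact: sqr_ge0.
- move=> d; have [C HC] := bc j d; exists C => t p Sp.
  by rewrite mul1r; exact: HC.
Qed.

Let cutS l q : wclass bd om full S l (fun _ _ => 1)
  (fun t p => flat q (1 - \sum_j y j t p ^+ 2)).
Proof.
apply: (wclass_flat om0 oT SU); apply: (wclass_add oT SU).
  by apply: (@wclass_cst _ _ _ _ _ _ _ _ om0 oT SU _ _ (fun=> 1)) => //; exists 1 => t p _; rewrite normr1 mulr1.
apply: (wclass_opp om0 oT SU); apply: (wclass_sum om0 oT SU) => // j.
have := wclass_mul oT SU (cutoff_coord l j) (cutoff_coord l j).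
by apply: wclass_eqw => // t p _; rewrite mul1r.
Qed.

Let cut0 q t p : ~ S t p -> flat q (1 - \sum_j y j t p ^+ 2) = 0.
Proof.
move=> /negP; rewrite /S /= -ltNge => h.
by rewrite /flat ifF//; apply/negbTE; rewrite -leNgt subr_le0 ltW.
Qed.

Lemma wclass_cutoff l q : wclass bd om full full l (fun _ _ => 1)
  (fun t p => flat q (1 - \sum_j y j t p ^+ 2)).
Proof. exact: (wclass_support om0 closedS (cut0 q)) (cutS l q). Qed.

Lemma wclass_cutoff_coord l q i : wclass bd om full full l (fun _ _ => 1)
  (fun t p => flat q (1 - \sum_j y j t p ^+ 2) * y i t p).
Proof.
apply: (wclass_support om0 closedS (U := full) (B := S)) => //.
  by move=> t p /cut0 ->; rewrite mul0r.
have := wclass_mul oT SU (cutS l q) (cutoff_coord l i).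
by apply: wclass_eqw => // t p _; rewrite mul1r.
Qed.

Lemma derive_cutoff q d t p : 'D_(bd d) (fun p => flat q (1 - \sum_j y j t p ^+ 2)) p =
  (- q%:R * flat q.+1 (1 - \sum_j y j t p ^+ 2) + flat q.+2 (1 - \sum_j y j t p ^+ 2)) *
  - (\sum_j 2 * y j t p * c j d t).
Proof.
have [ds Ds] := sum_sqr_derive d t p (index_enum J).
have d1 : differentiable (fun p => 1 - \sum_j y j t p ^+ 2) p.
  by apply: (differentiable_add (f := fun=> 1)) => //; apply: differentiableN.
rewrite derive_comp//; last exact: (@ex_derive _ _ _ _ _ _ _ (is_derive_flat q _)).
rewrite derive_flat; congr (_ * _).
rewrite (derive_add (f := fun=> 1))//; last exact: differentiableN.
rewrite derive_cst add0r -Ds deriveN//; exact: diff_derivable.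
Qed.

End cutoffs.

Section xt_cutoffs.
Context {R : realType} (n s : nat).
Local Notation X := ('rV[R]_n * 'rV[R]_s)%type.

(** The cutoff kappa(theta / (k + 1)), equal to 1 at 0 and supported in the ball
of radius k + 1.  On this ball <theta> <= 2 (k + 1), so that a factor
1 / (k + 1) from a derivative counts as <theta>^-1 and the cutoffs are bounded
in symbols of order 0, uniformly in k. *)
Definition theta_cut (k : nat) (p : X) : R :=
  flat 0 (1 - \sum_j (p.2 0 j / k.+1%:R) ^+ 2) / flat 0 1.

Let y (j : 'I_s) (k : nat) (p : X) : R := p.2 0 j / k.+1%:R.
Let c (j : 'I_s) (d : 'I_n + 'I_s) (k : nat) : R := (inr j == d)%:R / k.+1%:R.

Let dy j k p : differentiable (y j k) p.
Proof.
apply: (differentiable_mul (g := fun=> k.+1%:R^-1)) => //; exact: differentiable_coordt.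
Qed.

Let Dy j d k p : 'D_(xtdir d) (y j k) p = c j d k.
Proof.
have -> : y j k = (fun p => k.+1%:R^-1 * @xtcoord R n s (inr j) p).
  by apply/funext => q; rewrite /y mulrC.
rewrite derive_scalel; last exact: differentiable_xtcoord.
by rewrite derive_xtcoord mulrC.
Qed.

Let bc j d : exists C : R, forall k p, \sum_j y j k p ^+ 2 <= 1 ->
  `|c j d k| <= C * xtweight d p.
Proof.
exists 2 => k p Sp; rewrite /c; case: d => [i|j']; first by rewrite mul0r normr0 mulr1.
have k0 : 0 < k.+1%:R :> R by [].
apply: (@le_trans _ _ k.+1%:R^-1).
  rewrite normrM normfV (gtr0_norm k0) ler_piMl ?invr_ge0 ?(ltW k0)//.
  by case: (_ == _); rewrite ?normr1 ?normr0 ?ler01.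
rewrite /=.
have : enorm p.2 <= k.+1%:R.
  rewrite -(ler_pXn2r (n := 2))// ?nnegrE ?enorm_ge0// enorm_sqr.
  rewrite -[leRHS]mul1r -ler_pdivrMr ?exprn_gt0// mulr_suml.
  by apply: le_trans Sp; apply: ler_sum => i _; rewrite /y exprMn exprVn.
move=> h; rewrite ler_pdivlMr ?jap_gt0// mulrC ler_pdivrMr// /jap.
rewrite mulr_natl mulr2n lerD//.
by rewrite -[1]/(1%:R) ler_nat.
Qed.

Let full := fun _ : nat => [set: X].
Let oT (t : nat) : open (full t) := openT.
Let xw0 := @xtweight_ge0 R n s.
Let FF (t : nat) : full t `<=` full t. Proof. by []. Qed.

Lemma theta_cut_class l : wclass (@xtdir R n s) (@xtweight R n s) full full l (fun _ _ => 1) theta_cut.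
Proof.
have := wclass_scale xw0 oT FF (flat 0 1)^-1
  (wclass_cutoff xw0 dy Dy bc l 0).
by apply: (wclass_ext oT FF) => k p _; rewrite mulrC.
Qed.

Lemma flat1_gt0 : 0 < flat 0 (1 : R).
Proof. by rewrite /flat ltr01 expr0 mul1r expR_gt0. Qed.

Lemma sum_scaled (k : nat) (p : X) :
  \sum_j (p.2 0 j / k.+1%:R) ^+ 2 = enorm p.2 ^+ 2 / k.+1%:R ^+ 2.
Proof. by rewrite enorm_sqr mulr_suml; apply: eq_bigr => j _; rewrite exprMn exprVn. Qed.

Lemma theta_cut_support k p : k.+1%:R <= enorm p.2 -> theta_cut k p = 0.
Proof.
move=> kp; rewrite /theta_cut /flat ifF ?mul0r//; apply/negbTE.
rewrite -leNgt subr_le0 sum_scaled ler_pdivlMr ?exprn_gt0// mul1r.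
by rewrite ler_pXn2r ?nnegrE ?enorm_ge0.
Qed.

Lemma theta_cut_sub1_bound : exists C : R, forall k p,
  `|theta_cut k p - 1| <= C * (jap p / k.+1%:R).
Proof.
have [C C0 HC] := @flat_lipschitz R 0.
have [D HD] := @flat_bounded R 0.
have D0 : 0 <= D by exact: le_trans (normr_ge0 _) (HD 0).
have f1 := flat1_gt0.
exists ((C + 2 * D) / flat 0 1) => k p.
have k0 : 0 < k.+1%:R :> R by [].
have -> : theta_cut k p - 1 = (flat 0 (1 - \sum_j (p.2 0 j / k.+1%:R) ^+ 2) - flat 0 1) / flat 0 1.
  by rewrite mulrBl divff ?gt_eqF.
rewrite normrM normfV (gtr0_norm f1) mulrAC ler_wpM2r ?invr_ge0 ?(ltW f1)//.
rewrite mulrDl; set q := _ / _.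
have q0 : 0 <= q by rewrite divr_ge0 ?ltW ?jap_gt0.
have [kp|pk] := leP k.+1%:R (enorm p.2).
  have q1 : 1 <= q by rewrite ler_pdivlMr// mul1r (le_trans kp)// lerDr.
  apply: (@le_trans _ _ (2 * D)).
    by rewrite mulr_natl mulr2n (le_trans (ler_normB _ _))// lerD.
  by apply: (@le_trans _ _ (2 * D * q)); [rewrite ler_peMr ?mulr_ge0|rewrite lerDr mulr_ge0].
apply: (@le_trans _ _ (C * q)); last by rewrite lerDl mulr_ge0// mulr_ge0.
apply: le_trans (HC _ _) _; rewrite ler_wpM2l// addrAC subrr sub0r normrN.
rewrite sum_scaled -expr_div_n ger0_norm ?exprn_ge0 ?divr_ge0 ?enorm_ge0// expr2.
rewrite -[leRHS]mul1r ler_pM ?divr_ge0 ?enorm_ge0//.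
  by rewrite ler_pdivrMr// mul1r ltW.
by rewrite ler_wpM2r ?invr_ge0// lerDr.
Qed.

(** The cutoffs tend to 1 in symbols of order 1, at the rate 1 / (k + 1): one
power of <theta> is exchanged for smallness.  For the derivatives this is the
factor 1 / (k + 1) that comes out of each of them. *)
Lemma theta_cut_sub1_class l : wclass (@xtdir R n s) (@xtweight R n s) full full l
  (fun k p => jap p / k.+1%:R) (fun k p => theta_cut k p - 1).
Proof.
case: l => [|l]; first by split => //; have [C HC] := theta_cut_sub1_bound; exists C => t p _; exact: HC.
have dcut k p : differentiable (theta_cut k) p.
  exact: (wclass_differentiable (theta_cut_class 1)).
split; first by have [C HC] := theta_cut_sub1_bound; exists C => t p _; exact: HC.
split => [k p _|d].
  by apply: (differentiable_add (g := fun=> - 1)) => //; exact: differentiable_cst.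
pose h d k p := (flat 2 (1 - \sum_j y j k p ^+ 2) / flat 0 1) * - (\sum_j 2 * y j k p * c j d k).
apply: (wclass_ext oT FF (f := h d)) => [k p _|].
  rewrite (derive_add (g := fun=> - 1))//.
  rewrite derive_cst addr0.
  rewrite (_ : theta_cut k = (fun p => (flat 0 1)^-1 * flat 0 (1 - \sum_j y j k p ^+ 2))); last first.
    by apply/funext => q; rewrite mulrC.
  rewrite derive_scalel; last first.
    exact: (wclass_differentiable (wclass_cutoff xw0 dy Dy bc 1 0)).
  by rewrite (derive_cutoff dy Dy) /h mulr0n oppr0 mul0r add0r mulrA [_^-1 * _]mulrC.
have hE : h d = (fun k p => \sum_j (- (2 / flat 0 1)) * (c j d k * (flat 2 (1 - \sum_j y j k p ^+ 2) * y j k p))).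
  apply/funext => k; apply/funext => p; rewrite /h mulrN mulr_sumr -sumrN.
  by apply: eq_bigr => j _; ring.
rewrite hE.
have w0 k (p : X) : 0 <= jap p / k.+1%:R * xtweight d p.
  by apply: mulr_ge0; [rewrite divr_ge0// ltW// jap_gt0|exact: xw0].
apply: (wclass_sum xw0 oT FF) => // j.
apply: (wclass_scale xw0 oT FF).
have cc : wclass (@xtdir R n s) (@xtweight R n s) full full l (fun k p => jap p / k.+1%:R * xtweight d p)
   (fun k (p : X) => c j d k).
  apply: (@wclass_cst _ _ _ _ _ _ _ _ xw0 oT FF _ _ (c j d)) => //.
  exists 1 => k p _; rewrite mul1r /c; case: d {h hE} w0 => [i|j'] w0.
    by rewrite mul0r normr0 w0.
  rewrite normrM normfV [`|_.+1%:R|]ger0_norm// /= mulrAC divff ?gt_eqF ?jap_gt0// ler_wpM2r ?invr_ge0//.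
  by case: (_ == _); rewrite ?normr1 ?normr0 ?ler01.
have := wclass_mul oT FF cc (wclass_cutoff_coord xw0 dy Dy bc l 2 j).
by apply: (wclass_eqw xw0) => k p _; rewrite mulr1.
Qed.

End xt_cutoffs.

Section x_cutoff.
Context {R : realType} (n : nat) (x0 : 'rV[R]_n) (r : R).
Hypothesis r0 : 0 < r.

Definition space_cut (x : 'rV[R]_n) : R :=
  flat 0 (1 - \sum_i ((x 0 i - x0 0 i) / r) ^+ 2).

Lemma space_cut_center : 0 < space_cut x0.
Proof.
rewrite /space_cut big1 => [|i _]; first by rewrite subr0 flat1_gt0.
by rewrite subrr mul0r expr0n.
Qed.

Lemma space_cut_support x : r <= enorm (x - x0) -> space_cut x = 0.
Proof.
move=> rx; rewrite /space_cut /flat ifF//; apply/negbTE.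
rewrite -leNgt subr_le0.
have -> : \sum_i ((x 0 i - x0 0 i) / r) ^+ 2 = enorm (x - x0) ^+ 2 / r ^+ 2.
  by rewrite enorm_sqr mulr_suml; apply: eq_bigr => i _; rewrite !mxE exprMn exprVn.
rewrite ler_pdivlMr ?exprn_gt0// mul1r.
by rewrite ler_pXn2r ?nnegrE ?enorm_ge0 ?(ltW r0).
Qed.

Lemma space_cut_class (T : Type) l :
  wclass (@unitv R n) (fun _ _ => 1) (fun _ : T => setT) (fun _ => setT) l (fun _ _ => 1)
    (fun _ => space_cut).
Proof.
pose y (i : 'I_n) (_ : T) (x : 'rV[R]_n) : R := (x 0 i - x0 0 i) / r.
pose c (i d : 'I_n) (_ : T) : R := (i == d)%:R / r.
have dy j t p : differentiable (y j t) p.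
  apply: (differentiable_mul (g := fun=> r^-1)) => //.
  apply: (differentiable_add (g := fun=> - x0 0 j)) => //; exact: differentiable_coord.
have Dy j d t p : 'D_(unitv d) (y j t) p = c j d t.
  apply: derive_linear => h.
  by rewrite /y /c !mxE eqxx/=; field; rewrite gt_eqF.
have bc j d : exists C : R, forall t p, \sum_j y j t p ^+ 2 <= 1 -> `|c j d t| <= C * 1.
  exists r^-1 => t p _; rewrite mulr1 /c normrM normfV (gtr0_norm r0).
  by rewrite ler_piMl ?invr_ge0 ?(ltW r0)//; case: (_ == _); rewrite ?normr1 ?normr0 ?ler01.
exact: (@wclass_cutoff R _ _ (@unitv R n) (fun _ _ => 1) T (fun _ _ => ler01) _ y c dy Dy bc l 0).
Qed.

Lemma space_cut_xt_class s (T : Type) l :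
  wclass (@xtdir R n s) (@xtweight R n s) (fun _ : T => setT) (fun _ => setT) l (fun _ _ => 1)
    (fun _ p => space_cut p.1).
Proof.
pose y (i : 'I_n) (_ : T) (p : 'rV[R]_n * 'rV[R]_s) : R := (p.1 0 i - x0 0 i) / r.
pose c (i : 'I_n) (d : 'I_n + 'I_s) (_ : T) : R := (inl i == d)%:R / r.
have dy j t p : differentiable (y j t) p.
  apply: (differentiable_mul (g := fun=> r^-1)) => //.
  apply: (differentiable_add (g := fun=> - x0 0 j)) => //; exact: differentiable_coordx.
have Dy j d t p : 'D_(xtdir d) (y j t) p = c j d t.
  apply: derive_linear => h; rewrite /y /c.
  case: d => [i|i] /=; rewrite !mxE ?eqxx/=; last by rewrite mulr0 add0r mul0r mulr0 add0r.
  by rewrite (inj_eq inl_inj); field; rewrite gt_eqF.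
have bc j d : exists C : R, forall t p, \sum_j y j t p ^+ 2 <= 1 ->
    `|c j d t| <= C * xtweight d p.
  case: d => [i|i]; last by exists 0 => t p _; rewrite /c mul0r normr0 mul0r.
  exists r^-1 => t p _; rewrite mulr1 /c normrM normfV (gtr0_norm r0).
  by rewrite ler_piMl ?invr_ge0 ?(ltW r0)//; case: (_ == _); rewrite ?normr1 ?normr0 ?ler01.
exact: (@wclass_cutoff R _ _ (@xtdir R n s) (@xtweight R n s) T (@xtweight_ge0 R n s) _ y c dy Dy bc l 0).
Qed.

End x_cutoff.

(** * Non-stationary phase *)
Section compact_support_integrals.
Context {R : realType} {n s : nat}.
Local Notation X := ('rV[R]_n * 'rV[R]_s)%type.
Implicit Types (F G : X -> R).

Definition box_supported F :=
  exists b : R, forall p : X, b < `|p.1| \/ b < `|p.2| -> F p = 0.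

Lemma iintD_box F G : continuous F -> continuous G ->
  box_supported F -> box_supported G ->
  iint (fun p => F p + G p) = iint F + iint G.
Proof.
move=> cF cG [b Fb] [b' Gb].
have [C HC] := compact_support_gauge2 cF Fb.
have [D HD] := compact_support_gauge2 cG Gb.
exact: iintD cF cG HC HD.
Qed.

Lemma iint0 : iint (fun _ : X => 0) = 0.
Proof.
have c0 : continuous (fun _ : X => 0 : R) by move=> p; exact: cvg_cst.
have b0 : box_supported (fun _ : X => 0) by exists 0.
have := iintD_box c0 c0 b0 b0.
rewrite (_ : (fun _ : X => 0 + 0) = (fun=> 0)); last by apply/funext => p; rewrite addr0.
by move/eqP; rewrite -subr_eq subrr eq_sym => /eqP.
Qed.

Lemma iint_sum_box (J : Type) (r : seq J) (F : J -> X -> R) :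
  (forall j, continuous (F j)) -> (forall j, box_supported (F j)) ->
  iint (fun p => \sum_(j <- r) F j p) = \sum_(j <- r) iint (F j).
Proof.
move=> cF bF.
suff [] : [/\ continuous (fun p => \sum_(j <- r) F j p),
  box_supported (fun p => \sum_(j <- r) F j p) &
  iint (fun p => \sum_(j <- r) F j p) = \sum_(j <- r) iint (F j)] by [].
elim: r => [|j r [IH1 IH2 IH3]].
  rewrite (_ : (fun _ => _) = (fun=> 0)); last by apply/funext => p; rewrite big_nil.
  by rewrite big_nil iint0; split => //; [move=> p; exact: cvg_cst|exists 0].
rewrite (_ : (fun _ => _) = (fun p => F j p + \sum_(j <- r) F j p)); last first.
  by apply/funext => p; rewrite big_cons.
split.
- by move=> p; apply: cvgD; [exact: cF|exact: IH1].
- have [b Hb] := bF j; have [b' Hb'] := IH2; exists (Num.max b b') => p.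
  by rewrite !gt_max => -[/andP[h1 h2]|/andP[h1 h2]];
    rewrite (Hb p) ?(Hb' p) ?addr0//; [left|left|right|right].
- by rewrite iintD_box// IH3 big_cons.
Qed.

End compact_support_integrals.

(** Abstract form of the argument: a family of phases psi whose derivatives have
the class Wt xtweight, and whose rescaled gradient is at least of size Wt. *)
Section nonstationary_phase.
Context {R : realType} {n s : nat} {T : Type}.
Local Notation X := ('rV[R]_n * 'rV[R]_s)%type.
Local Notation I := ('I_n + 'I_s)%type.
Variables (W : set 'rV[R]_n) (x0 : 'rV[R]_n) (r : R) (b : T -> R).
Hypothesis oW : open W.
Hypothesis ball_W : forall x, `|x - x0| <= r -> W x.
Variables (psi : T -> X -> R) (Wt : T -> X -> R).
Hypothesis Wt0 : forall t p, 0 < Wt t p.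
Let U := fun _ : T => W `*` [set: 'rV[R]_s].
Local Notation D d := (@xtdir R n s d).
Local Notation wcl := (wclass (@xtdir R n s) (@xtweight R n s) U U).
Hypothesis dpsi : forall t p, U t p -> differentiable (psi t) p.
Hypothesis Dpsi : forall d l, wcl l (fun t p => Wt t p * xtweight d p)
  (fun t => 'D_(D d) (psi t)).

(** The smooth substitute for the inverse square of [xtweight], which makes all
the terms of [grad_sqr] of the same size Wt^2. *)
Definition xtscale (d : I) (p : X) : R :=
  if d is inr _ then 1 + enorm p.2 ^+ 2 else 1.

Definition grad_sqr t p : R := \sum_d xtscale d p * 'D_(D d) (psi t) p ^+ 2.

Hypothesis Qlow : exists2 c : R, 0 < c & forall t p, U t p -> c * Wt t p ^+ 2 <= grad_sqr t p.

Let oU t : open (U t). Proof. exact: open_cylinder. Qed.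
Let UU t : U t `<=` U t. Proof. by []. Qed.
Let xw0 := @xtweight_ge0 R n s.

Let S t := [set p : X | `|p.1 - x0| <= r /\ `|p.2| <= b t].

(** Amplitudes are supported in the sets S, where everything is differentiable;
extended by 0 they are differentiable everywhere. *)
Lemma closed_tube t : closed (S t).
Proof.
have -> : S t = (fun p : X => `|p.1 - x0|) @^-1` [set x | x <= r] `&`
   (fun p : X => `|p.2|) @^-1` [set x | x <= b t] by [].
apply: closedI; apply: closed_comp; try exact: closed_le; move=> p _.
  by apply: cvg_norm; apply: cvgB; [exact: cvg_fst|exact: cvg_cst].
by apply: cvg_norm; exact: cvg_snd.
Qed.

Let SU t p : S t p -> U t p. Proof. by move=> [h _]; split => //; exact: ball_W. Qed.

Lemma tube_box_supported (F : X -> R) t : (forall p, ~ S t p -> F p = 0) -> box_supported F.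
Proof.
move=> F0; exists (Num.max (`|x0| + r) (b t)) => p.
rewrite !gt_max => H; apply: F0 => -[h1 h2].
case: H => /andP[h3 h4]; last by move: h4; rewrite ltNge h2.
move: h3; rewrite ltNge => /negP; apply.
rewrite -[p.1](subrK x0) addrC; apply: le_trans (ler_normD _ _) _.
by rewrite lerD2l.
Qed.

Lemma tube_differentiable (F : X -> R) t : (forall p, ~ S t p -> F p = 0) ->
  (forall p, U t p -> differentiable F p) -> forall p, differentiable F p.
Proof.
move=> F0 dF p; have [Sp|nSp] := pselect (S t p); first exact/dF/SU.
apply: (@differentiable_near_eq _ _ (fun=> 0)); last exact: differentiable_cst.
have oS : open (~` S t) by exact: (closed_openC (@closed_tube t)).
by apply: filterS (open_near oS nSp) => q nSq; rewrite F0.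
Qed.

Lemma tube_continuous (F : X -> R) t : (forall p, ~ S t p -> F p = 0) ->
  (forall p, U t p -> differentiable F p) -> continuous F.
Proof. by move=> F0 dF p; exact: (differentiable_continuous (tube_differentiable F0 dF p)). Qed.

Let derive_S (F : X -> R) t v : (forall p, ~ S t p -> F p = 0) ->
  forall p, ~ S t p -> 'D_v F p = 0.
Proof.
move=> F0 p nSp; rewrite (@derive_near_eq _ _ F (fun=> 0)) ?derive_cst//.
have oS : open (~` S t) by exact: (closed_openC (@closed_tube t)).
by apply: filterS (open_near oS nSp) => q nSq; rewrite F0.
Qed.

Lemma xtscale_class d l : wcl l (fun t p => (xtweight d p)^-1 ^+ 2) (fun _ => xtscale d).
Proof.
case: d => [i|j].
  apply: (@wclass_cst _ _ _ _ _ _ _ _ xw0 oU UU _ _ (fun=> 1)).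
    by exists 1 => t p _; rewrite normr1 /= invr1 expr1n mulr1.
  by move=> t p _; rewrite sqr_ge0.
have one : wcl l (fun t p => jap p ^+ 2) (fun _ _ => 1).
  apply: (@wclass_cst _ _ _ _ _ _ _ _ xw0 oU UU _ _ (fun=> 1)).
    by exists 1 => t p _; rewrite normr1 mul1r; exact: exprn_ege1 (jap_ge1 p).
  by move=> t p _; rewrite sqr_ge0.
have co k : wcl l (fun t p => jap p) (fun _ p => p.2 0 k).
  apply: (@wclass_affine _ _ _ _ _ _ _ _ xw0 oU UU _ _ _ (fun d _ => ((inr k : I) == d)%:R)).
  - by move=> t p _; exact: differentiable_coordt.
  - by move=> d t p _; exact: (derive_xtcoord (inr k)).
  - exists 1 => t p _; rewrite mul1r /jap (le_trans (enorm_coord _ _))//.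
    by rewrite lerDr.
  - case=> [i|k']; first by exists 0 => t p _; rewrite normr0 mul0r.
    exists 1 => t p _; rewrite /= divff ?gt_eqF ?jap_gt0// mulr1.
    by case: (_ == _); rewrite ?normr1 ?normr0.
  - by move=> t p _; rewrite ltW ?jap_gt0.
rewrite /=; have -> : (fun (t : T) (p : X) => (jap p)^-1^-1 ^+ 2) = (fun _ p => jap p ^+ 2).
  by apply/funext => t; apply/funext => p; rewrite invrK.
have -> : xtscale (inr j) = (fun p => 1 + \sum_k p.2 0 k * p.2 0 k).
  by apply/funext => p; rewrite /= enorm_sqr; congr (_ + _); apply: eq_bigr => k _; rewrite expr2.
apply: (wclass_add oU UU) => //; apply: (wclass_sum xw0 oU UU) => [t p _|k]; first exact: sqr_ge0.
have := wclass_mul oU UU (co k) (co k).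
by apply: (wclass_eqw xw0) => t p _; rewrite ?expr2// mulr_ge0// ltW// jap_gt0.
Qed.

Lemma xtweight_gt0 d (p : X) : 0 < xtweight d p.
Proof. by case: d => [i|j] //=; rewrite invr_gt0 jap_gt0. Qed.

Lemma grad_sqr_class l : wcl l (fun t p => Wt t p ^+ 2) grad_sqr.
Proof.
apply: (wclass_sum xw0 oU UU) => [t p _|d]; first exact: sqr_ge0.
have := wclass_mul oU UU (xtscale_class d l) (wclass_mul oU UU (Dpsi d l) (Dpsi d l)).
apply: (wclass_eqw xw0) => t p _; have := xtweight_gt0 d p; have := Wt0 t p.
  by move: (Wt t p) (xtweight d p) => a c a0 c0; field; rewrite gt_eqF.
by move=> w1 w2; rewrite !mulr_ge0 ?exprn_ge0 ?invr_ge0// ltW.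
Qed.

Lemma grad_sqr_gt0 t p : U t p -> 0 < grad_sqr t p.
Proof.
move=> Up; have [c c0 Hc] := Qlow; apply: lt_le_trans (Hc _ _ Up).
by rewrite mulr_gt0// exprn_gt0.
Qed.

Definition ibp_coef d t p : R := xtscale d p * 'D_(D d) (psi t) p / grad_sqr t p.

Lemma ibp_coef_class d l : wcl l (fun t p => (Wt t p * xtweight d p)^-1) (ibp_coef d).
Proof.
have Qi : wcl l (fun t p => (Wt t p ^+ 2)^-1) (fun t p => (grad_sqr t p)^-1).
  apply: (wclass_inv xw0 oU UU) (grad_sqr_class l) _ _ _.
  - by move=> t p Up; rewrite gt_eqF// grad_sqr_gt0.
  - by move=> t p _; rewrite exprn_gt0.
  - have [c c0 Hc] := Qlow; exists c => // t p Up.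
    by rewrite (le_trans (Hc _ _ Up))// ler_norm.
have := wclass_mul oU UU (wclass_mul oU UU (xtscale_class d l) (Dpsi d l)) Qi.
apply: (wclass_eqw xw0) => t p _; have := xtweight_gt0 d p; have := Wt0 t p.
  by move: (Wt t p) (xtweight d p) => a c a0 c0; field; rewrite !gt_eqF.
by move=> w1 w2; rewrite !mulr_ge0 ?exprn_ge0 ?invr_ge0 ?mulr_ge0 ?exprn_ge0// ltW.
Qed.

Lemma ibp_coef_sum t p : U t p -> \sum_d ibp_coef d t p * 'D_(D d) (psi t) p = 1.
Proof.
move=> Up; have Q0 := grad_sqr_gt0 Up.
transitivity (\sum_d xtscale d p * 'D_(D d) (psi t) p ^+ 2 / grad_sqr t p).
  by apply: eq_bigr => d _; rewrite /ibp_coef; ring.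
by rewrite -mulr_suml -/(grad_sqr t p) divff// gt_eqF.
Qed.

Definition amplitude w (f : T -> X -> R) :=
  (forall l, wcl l w f) /\ (forall t p, ~ S t p -> f t p = 0).

(** The formal transpose of the field sum_d c_d D_d, up to sign. *)
Definition transport (f : T -> X -> R) t p : R :=
  \sum_d 'D_(D d) (fun q => f t q * ibp_coef d t q) p.

(** Differentiation in the direction d multiplies the weight by xtweight d, and
the coefficient c_d by (Wt xtweight d)^-1; the gain is 1 / Wt for every d. *)
Lemma transport_amplitude w f : (forall t p, U t p -> 0 <= w t p) -> amplitude w f ->
  amplitude (fun t p => w t p / Wt t p) (transport f).
Proof.
move=> w0 [Hf f0]; split => [l|t p nSp]; last first.
  rewrite /transport big1// => d _; apply: derive_S nSp => q nSq.
  by rewrite f0// mul0r.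
apply: (wclass_sum xw0 oU UU) => [t p Up|d]; first by rewrite divr_ge0 ?w0// ltW.
have := wclass_derive d (wclass_mul oU UU (Hf l.+1) (ibp_coef_class d l.+1)).
apply: (wclass_eqw xw0) => t p Up; have := xtweight_gt0 d p; have := Wt0 t p.
  by move: (Wt t p) (xtweight d p) (w t p) => a c e a0 c0; field; rewrite !gt_eqF.
by move=> w1 w2; rewrite !mulr_ge0 ?invr_ge0 ?mulr_ge0 ?w0// ltW.
Qed.

(** For h' the derivative of h, the divergence of (f c_d h(psi))_d is
transport f * h(psi) + f * h'(psi), because sum_d c_d D_d psi = 1; its integral
is 0. *)
Let trig_ibp w f (h h' : R -> R) t : amplitude w f ->
  (forall y, is_derive y (1 : R) h (h' y)) -> (forall y, derivable h' y 1) ->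
  continuous (fun p => transport f t p * h (psi t p)) /\
  continuous (fun p => f t p * h' (psi t p)) /\
  iint (fun p => transport f t p * h (psi t p)) + iint (fun p => f t p * h' (psi t p)) = 0.
Proof.
move=> [Hf f0] dh dh'.
have dh1 y : derivable h y 1 by have [] := dh y.
have Dh y : 'D_1 h y = h' y by have [] := dh y.
pose g d p := f t p * ibp_coef d t p.
have g0 d p : ~ S t p -> g d p = 0 by move=> nSp; rewrite /g f0// mul0r.
have gcl d l := wclass_mul oU UU (Hf l) (ibp_coef_class d l).
have dg d p : U t p -> differentiable (g d) p.
  exact: (wclass_differentiable (gcl d 1%N)).
have dDg d e p : U t p -> differentiable ('D_(D e) (g d)) p.
  exact: (wclass_differentiable (wclass_derive e (gcl d 2%N))).
have dDpsi d p : U t p -> differentiable ('D_(D d) (psi t)) p.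
  exact: (wclass_differentiable (Dpsi d 1%N)).
have dhp p : U t p -> differentiable (fun q => h (psi t q)) p.
  by move=> Up; apply: differentiable_comp1 => //; exact: dpsi.
have dh'p p : U t p -> differentiable (fun q => h' (psi t q)) p.
  by move=> Up; apply: differentiable_comp1 => //; exact: dpsi.
pose F d p := g d p * h (psi t p).
have F0 d p : ~ S t p -> F d p = 0 by move=> nSp; rewrite /F g0// mul0r.
have dF d p : differentiable (F d) p.
  by apply: (tube_differentiable (F0 d)) => q Uq; apply: differentiable_mul; [exact: dg|exact: dhp].
have DF d p : U t p -> 'D_(D d) (F d) p =
    'D_(D d) (g d) p * h (psi t p) + g d p * (h' (psi t p) * 'D_(D d) (psi t) p).
  move=> Up; rewrite derive_mul; [|exact: dg|exact: dhp].
  by rewrite derive_comp//; [rewrite Dh addrC [h _ * _]mulrC|exact: dpsi].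
have DF0 d p : ~ S t p -> 'D_(D d) (F d) p = 0 by exact: derive_S (F0 d) p.
have cDF d : continuous ('D_(D d) (F d)).
  apply: (tube_continuous (DF0 d)) => q Uq.
  apply: (@differentiable_near_eq _ _ (fun p => 'D_(D d) (g d) p * h (psi t p) +
     g d p * (h' (psi t p) * 'D_(D d) (psi t) p))).
    have oUn : nbhs q (U t) by apply: open_nbhs_nbhs; split; [exact: oU|].
    by apply: filterS oUn => z Uz; rewrite DF.
  apply: differentiable_add; apply: differentiable_mul.
  - exact: dDg.
  - exact: dhp.
  - exact: dg.
  - by apply: differentiable_mul; [exact: dh'p|exact: dDpsi].
have sumE p : \sum_d 'D_(D d) (F d) p = transport f t p * h (psi t p) + f t p * h' (psi t p).
  have [Up|nUp] := pselect (U t p); last first.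
    have nSp : ~ S t p by move=> /SU.
    rewrite f0// mul0r addr0 /transport !big1 ?mul0r// => d _.
      by apply: derive_S nSp => q nSq; rewrite f0// mul0r.
    exact: DF0.
  rewrite (eq_bigr _ (fun d _ => DF d p Up)) big_split/= -mulr_suml; congr (_ + _).
  transitivity (f t p * h' (psi t p) * \sum_d ibp_coef d t p * 'D_(D d) (psi t) p).
    by rewrite mulr_sumr; apply: eq_bigr => d _; rewrite /g; ring.
  by rewrite ibp_coef_sum// mulr1.
have tr0 p : ~ S t p -> transport f t p = 0.
  move=> nSp; rewrite /transport big1// => d _.
  by apply: derive_S nSp => q nSq; rewrite f0// mul0r.
have ct : continuous (fun p => transport f t p * h (psi t p)).
  apply: (@tube_continuous _ t) => [q /tr0 ->|q Uq].
    by rewrite mul0r.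
  apply: differentiable_mul; last exact: dhp.
  by apply: differentiable_bigsum => d; exact: dDg.
have cf : continuous (fun p => f t p * h' (psi t p)).
  apply: (@tube_continuous _ t) => [q /f0 ->|q Uq].
    by rewrite mul0r.
  apply: differentiable_mul; last exact: dh'p.
  exact: (wclass_differentiable (Hf 1%N)).
split => //; split => //.
rewrite -iintD_box//; first last.
- by apply: (@tube_box_supported _ t) => p nSp; rewrite f0// mul0r.
- by apply: (@tube_box_supported _ t) => p nSp; rewrite tr0// mul0r.
rewrite -(_ : (fun p => \sum_d 'D_(D d) (F d) p) = (fun p => _ + _)); last by apply/funext.
rewrite iint_sum_box//; last by move=> d; exact: tube_box_supported (DF0 d).
apply: big1 => d _; have [b' Hb'] := tube_box_supported (F0 d).
exact: iint_derive_eq0 (dF d) (cDF d) Hb'.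
Qed.

Definition osc f g t := iint (fun p => f t p * cos (psi t p) + g t p * sin (psi t p)).

Lemma amplitude_opp w f : amplitude w f -> amplitude w (fun t p => - f t p).
Proof.
by move=> [Hf f0]; split => [l|t p nSp]; [exact: wclass_opp|rewrite f0// oppr0].
Qed.

Let iintN F : continuous F -> box_supported F -> iint (fun p : X => - F p) = - iint F.
Proof.
move=> cF [b' Fb]; have cN : continuous (fun p => - F p) by move=> p; apply: cvgN; exact: cF.
have bN : box_supported (fun p => - F p) by exists b' => p /Fb ->; rewrite oppr0.
apply/eqP; rewrite -subr_eq0 opprK addrC -iintD_box//; last by exists b'.
rewrite (_ : (fun p => F p + - F p) = (fun=> 0)) ?iint0//.
by apply/funext => p; rewrite subrr.
Qed.

Let amp_box w f h t : amplitude w f -> box_supported (fun p => f t p * h (psi t p)).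
Proof. by move=> [_ f0]; apply: (@tube_box_supported _ t) => p nSp; rewrite f0// mul0r. Qed.

Lemma osc_transport w f g t : (forall t p, U t p -> 0 <= w t p) ->
  amplitude w f -> amplitude w g ->
  osc f g t = osc (transport g) (fun t p => - transport f t p) t.
Proof.
move=> w0 Hf Hg.
have ds y : is_derive y (1 : R) sin (cos y) by exact: is_derive_sin.
have dc y : is_derive y (1 : R) cos (- sin y) by exact: is_derive_cos.
have dns y : derivable (fun y => - sin y) y (1 : R).
  by apply: derivableN; exact: derivable_sin.
have dcs y : derivable cos y (1 : R) by exact: derivable_cos.
have [c1 [c2 E1]] := @trig_ibp w f sin cos t Hf ds dcs.
have [c3 [c4 E2]] := @trig_ibp w g cos (fun y => - sin y) t Hg dc dns.
have Tf := transport_amplitude w0 Hf; have Tg := transport_amplitude w0 Hg.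
have c5 : continuous (fun p => g t p * sin (psi t p)).
  rewrite (_ : (fun _ => _) = (fun p => - (g t p * - sin (psi t p)))).
    by move=> p; apply: cvgN; exact: c4.
  by apply/funext => p; rewrite mulrN opprK.
rewrite /osc (iintD_box c2 c5 (amp_box cos t Hf) (amp_box sin t Hg)).
have E3 : iint (fun p => g t p * - sin (psi t p)) = - iint (fun p => g t p * sin (psi t p)).
  rewrite -(iintN c5 (amp_box sin t Hg)).
  by congr iint; apply/funext => p; rewrite mulrN.
have -> : (fun p => transport g t p * cos (psi t p) + - transport f t p * sin (psi t p)) =
    (fun p => transport g t p * cos (psi t p) + - (transport f t p * sin (psi t p))).
  by apply/funext => p; rewrite mulNr.
have c6 : continuous (fun p => - (transport f t p * sin (psi t p))).
  by move=> p; apply: cvgN; exact: c1.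
have b6 : box_supported (fun p => - (transport f t p * sin (psi t p))).
  by have [b' Hb'] := amp_box sin t Tf; exists b' => p bp; rewrite (Hb' p bp) oppr0.
rewrite (iintD_box c3 c6 (amp_box cos t Tg) b6) (iintN c1 (amp_box sin t Tf)).
move: E1 E2; rewrite E3.
move: (iint _) (iint _) (iint _) (iint _) => i1 i2 i3 i4 E1 E2; lra.
Qed.

(** The transported pair is again a pair of amplitudes, so the step iterates. *)
Lemma osc_iterate k w f g : (forall t p, U t p -> 0 <= w t p) ->
  amplitude w f -> amplitude w g ->
  exists f' g', [/\ amplitude (fun t p => w t p / Wt t p ^+ k) f',
    amplitude (fun t p => w t p / Wt t p ^+ k) g' & forall t, osc f g t = osc f' g' t].
Proof.
move=> + Hf Hg; elim: k w f g Hf Hg => [|k IH] w f g Hf Hg w0.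
  exists f, g; have -> : (fun t p => w t p / Wt t p ^+ 0) = w.
    by apply/funext => t; apply/funext => p; rewrite expr0 divr1.
  by split.
have w1 t p : U t p -> 0 <= w t p / Wt t p by move=> Up; rewrite divr_ge0 ?w0// ltW.
have [f' [g' [H1 H2 H3]]] := IH _ _ _ (transport_amplitude w0 Hg)
  (amplitude_opp (transport_amplitude w0 Hf)) w1.
have E : (fun t p => w t p / Wt t p ^+ k.+1) = (fun t p => w t p / Wt t p / Wt t p ^+ k).
  by apply/funext => t; apply/funext => p; rewrite exprS invfM mulrA.
exists f', g'; rewrite E; split; [exact: H1|exact: H2|move=> t].
by rewrite (osc_transport _ w0 Hf Hg) H3.
Qed.

Variables (mu m : R) (kap : T -> R).
Hypothesis mu0 : 0 < mu.
Hypothesis kap1 : forall t, 1 <= kap t.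
Hypothesis WtE : forall t p, Wt t p = jap p `^ mu + kap t.

Lemma jap_gauge (p : X) : (jap p) ^- (2 * s) <= gauge p.2.
Proof.
rewrite exprM -exprVn /gauge -[X in _ ^+ X <= _]card_ord -prodr_const.
apply: ler_prod => j _; have o1 : 1 <= oneDsqr (p.2 0 j) by exact: oneDsqr_ge1.
rewrite invr_ge0 sqr_ge0/= lef_pV2 ?posrE ?exprn_gt0 ?jap_gt0 ?(lt_le_trans ltr01 o1)//.
have h := enorm_coord p.2 j; have e0 := enorm_ge0 p.2.
have h2 : p.2 0 j ^+ 2 <= enorm p.2 ^+ 2.
  by rewrite -(real_normK (num_real (p.2 0 j))) ler_pXn2r ?nnegrE.
by rewrite /oneDsqr /jap; move: h2; move: (enorm p.2) e0 => e e0 h2; nra.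
Qed.

(** After k + N steps the amplitude is O(<theta>^m (<theta>^mu + kap)^-(k + N)):
k factors bring <theta>^m below the integrable <theta>^(-2 s), the N others are
at most kap^-N. *)
Lemma nonstationary_decay f g N :
  amplitude (fun _ p => jap p `^ m) f -> amplitude (fun _ p => jap p `^ m) g ->
  exists C : R, forall t, `|osc f g t| <= C * (kap t) ^- N.
Proof.
move=> Hf Hg.
have [k hk] : exists k : nat, m + (2 * s)%:R <= mu * k%:R.
  exists (Num.truncn ((`|m| + (2 * s)%:R) / mu)).+1.
  rewrite mulrC -ler_pdivrMr//; apply: le_trans (ltW (truncnS_gt _)).
  by rewrite ler_wpM2r ?invr_ge0 ?(ltW mu0)// lerD2r ler_norm.
have w0 t p : U t p -> 0 <= (fun (_ : T) p => jap p `^ m) t p by move=> _; exact: powR_ge0.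
have [f' [g' [[Hf' f'0] [Hg' g'0] E]]] := osc_iterate (k + N) w0 Hf Hg.
have [C HC] := wclass_bound (Hf' 0%N); have [D HD] := wclass_bound (Hg' 0%N).
have [K K0 HK] := @iint_le R n s.
pose bx := (oneDsqr (`|x0| + r))^-1 ^+ n.
have bx0 : 0 < bx by rewrite exprn_gt0// invr_gt0 (lt_le_trans ltr01)// oneDsqr_ge1.
exists ((`|C| + `|D|) / bx * K) => t; rewrite E.
have k0 : 0 < kap t by exact: lt_le_trans (kap1 t).
have W0 p : jap p `^ m / Wt t p ^+ (k + N) <= (kap t) ^- N * gauge p.2.
  have j0 := jap_gt0 p; have j1 := jap_ge1 p.
  have jn0 : jap p != 0 by rewrite gt_eqF.
  have a1 : (jap p `^ mu) ^+ k <= Wt t p ^+ k.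
    by rewrite lerXn2r ?nnegrE ?powR_ge0// ?(ltW (Wt0 t p))// WtE lerDl (ltW k0).
  have a2 : kap t ^+ N <= Wt t p ^+ N.
    by rewrite lerXn2r ?nnegrE ?(ltW k0)// ?(ltW (Wt0 t p))// WtE lerDr powR_ge0.
  have b1 : 0 < (jap p `^ mu) ^+ k by rewrite exprn_gt0// powR_gt0.
  have b2 : 0 < kap t ^+ N by rewrite exprn_gt0.
  apply: (@le_trans _ _ (jap p `^ m / ((jap p `^ mu) ^+ k * kap t ^+ N))).
    have ab : (jap p `^ mu) ^+ k * kap t ^+ N <= Wt t p ^+ (k + N).
      by rewrite exprD; apply: ler_pM (ltW b1) (ltW b2) a1 a2.
    rewrite ler_wpM2l ?powR_ge0//.
    have ab0 := mulr_gt0 b1 b2.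
    by rewrite lef_pV2 ?posrE// (lt_le_trans ab0 ab).
  rewrite invfM mulrA [leRHS]mulrC ler_wpM2r ?invr_ge0 ?(ltW b2)//.
  apply: le_trans (jap_gauge p).
  rewrite -powR_mulrn ?powR_ge0// -powRrM -powRN -powRD ?jn0 ?implybT//.
  rewrite -powR_mulrn ?(ltW j0)// -powRN; apply: ler_powR => //.
  by rewrite lerBlDl -lerBlDr opprK; exact: hk.
pose F p := f' t p * cos (psi t p) + g' t p * sin (psi t p).
have F0 p : ~ S t p -> F p = 0 by move=> nSp; rewrite /F f'0// g'0// !mul0r addr0.
have cF : continuous F.
  apply: (tube_continuous F0) => q Uq.
  apply: differentiable_add; apply: differentiable_mul.
  - exact: (wclass_differentiable (Hf' 1%N)).
  - by apply: differentiable_comp1; [exact: dpsi|exact: derivable_cos].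
  - exact: (wclass_differentiable (Hg' 1%N)).
  - by apply: differentiable_comp1; [exact: dpsi|exact: derivable_sin].
have HF p : `|F p| <= (`|C| + `|D|) / bx * (kap t) ^- N * gauge2 p.
  have c0 : 0 <= (`|C| + `|D|) / bx * (kap t) ^- N.
    by rewrite mulr_ge0 ?divr_ge0 ?addr_ge0 ?invr_ge0 ?exprn_ge0 ?(ltW bx0) ?(ltW k0).
  have [Sp|nSp] := pselect (S t p); last by rewrite F0// normr0 mulr_ge0// ltW// gauge2_gt0.
  have Up := SU Sp; set w := jap p `^ m / Wt t p ^+ (k + N).
  have w1 : 0 <= w by rewrite divr_ge0 ?powR_ge0// exprn_ge0// ltW.
  apply: (@le_trans _ _ ((`|C| + `|D|) * w)).
    rewrite /F mulrDl; apply: le_trans (ler_normD _ _) _; apply: lerD.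
      rewrite normrM -[leRHS]mulr1; apply: ler_pM; rewrite ?normr_ge0// ?cos_max//.
      by apply: le_trans (HC _ _ Up) _; rewrite ler_wpM2r ?ler_norm.
    rewrite normrM -[leRHS]mulr1; apply: ler_pM; rewrite ?normr_ge0// ?sin_max//.
    by apply: le_trans (HD _ _ Up) _; rewrite ler_wpM2r ?ler_norm.
  have gx : bx <= gauge p.1.
    apply: gauge_ge; have [h _] := Sp.
    by rewrite -[p.1](subrK x0) addrC (le_trans (ler_normD _ _))// lerD2l.
  rewrite -!mulrA ler_wpM2l ?addr_ge0//; apply: le_trans (W0 p) _.
  rewrite /gauge2 mulrCA ler_wpM2l ?invr_ge0 ?exprn_ge0 ?(ltW k0)//.
  rewrite mulrA ler_peMl ?(ltW (gauge_gt0 _))// mulrC ler_pdivlMr// mul1r.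
  exact: gx.
by have := HK F _ cF HF; rewrite mulrAC.
Qed.

End nonstationary_phase.

(** * The gradient of the phase away from the stationary set *)
Section gradient_balance.
Context {R : realType}.
Implicit Types a v q L S B c ep t k eta : R.

(** Here a, v, q and L stand for |grad_x phi - k|^2, |grad_x phi|^2,
|theta|^2 |grad_theta phi|^2 and lam^(2 mu), and S for |k|^2.  When q controls
L, and L controls v, half of q pays for the loss v in |k|^2 <= 2 (a + v). *)
Lemma theta_gradient_dominates a v q L S B c ep : 0 <= a -> 0 <= L -> S / 2 - v <= a -> v <= B * L ->
  c * L <= q -> 0 <= ep -> ep <= 1 -> ep * B <= c / 2 ->
  ep * S / 2 + (c / 2) * L <= a + q.
Proof.
move=> a0 L0 h1 h2 h3 e0 e1 h4.
have i1 : ep * a <= a by rewrite ler_piMl.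
have i2 := ler_wpM2l e0 h1; have i3 := ler_wpM2l e0 h2; have i4 := ler_wpM2r L0 h4.
lra.
Qed.

(** Same quantities, with t k in the place of S.  When a controls v + t k, the lower
bound of v + q given by the phase axiom passes to a + q. *)
Lemma angle_dominates a v q L t c k eta : 0 <= v -> 0 <= a -> 0 <= q -> 0 <= L -> 0 <= t ->
  0 < Num.min 1 eta -> 0 < c -> 0 < k ->
  eta * (v + t * k) <= a -> c * L <= v + q ->
  Num.min (Num.min 1 eta * k) (Num.min 1 eta * c) * (L + t) <= a + q.
Proof.
move=> v0 a0 q0 L0 t0; set e := Num.min 1 eta => e0 c0 k0 h1 h2.
have e1 : e <= 1 by rewrite ge_min lexx.
have e2 : e <= eta by rewrite ge_min lexx orbT.
have i1 : e * (v + t * k) <= a.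
  by apply: le_trans h1; rewrite ler_wpM2r// addr_ge0// mulr_ge0// ltW.
have i2 : e * q <= q by rewrite ler_piMl.
have i3 := ler_wpM2l (ltW e0) h2.
set m := Num.min _ _.
have m1 : m * t <= e * k * t by rewrite ler_wpM2r// ge_min lexx.
have m2 : m * L <= e * c * L by rewrite ler_wpM2r// ge_min lexx orbT.
lra.
Qed.

End gradient_balance.

Section phase_geometry.
Context {R : realType} (n s : nat) (Omega : set 'rV[R]_n).
Local Notation X := ('rV[R]_n * 'rV[R]_s)%type.
Local Notation I := ('I_n + 'I_s)%type.
Local Notation D d := (@xtdir R n s d).
Hypothesis Omega_open : open Omega.
Variables (mu : R) (phi : X -> R).
Hypothesis phi_phase : phase_function Omega mu phi.

Local Notation gx := (grad_x phi).
Local Notation gt := (grad_theta phi).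

Lemma grad_xE p i : gx p 0 i = 'D_(D (inl i)) phi p.
Proof. by rewrite mxE. Qed.

Lemma phase_class K : compact K -> K `<=` Omega -> forall l,
  wclass (@xtdir R n s) (@xtweight R n s) (fun _ : unit => Omega `*` setT)
    (fun _ => K `*` setT) l (fun _ => symbol_weight mu) (fun _ => phi).
Proof.
move=> cK KO l; have [_ sphi _] := phi_phase.
have [+ _] := symbol_class Omega_open sphi cK KO l.
by [].
Qed.

Variables (x0 k0 : 'rV[R]_n).
Hypothesis Ox0 : Omega x0.

Lemma closed_ball_in_open : exists2 r : R, 0 < r &
  compact [set x : 'rV[R]_n | `|x - x0| <= r] /\ [set x | `|x - x0| <= r] `<=` Omega.
Proof.
have [e e0 He] := (nbhs_ballP _ _).1 (open_nbhs_nbhs (conj Omega_open Ox0)).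
exists (e / 2); first by rewrite divr_gt0.
have e2 : e / 2 < e by rewrite ltr_pdivrMr// ltr_pMr// ltr1n.
split; first exact: compact_norm_ball.
move=> x /= xe; apply: He; rewrite -ball_normE /ball_/= distrC.
exact: le_lt_trans xe e2.
Qed.

(** The symbol estimates for the first two derivatives of phi, on a fixed ball
around x0. *)
Lemma phase_bounds : exists2 r : R, 0 < r & [/\ [set x | `|x - x0| <= r] `<=` Omega,
  compact [set x : 'rV[R]_n | `|x - x0| <= r],
  (forall p, `|p.1 - x0| <= r -> forall d, differentiable ('D_(D d) phi) p) &
  exists2 C : R, 0 <= C & forall p, `|p.1 - x0| <= r ->
    (forall d, `|'D_(D d) phi p| <= C * (jap p `^ mu * xtweight d p)) /\
    (forall d e, `|'D_(D e) ('D_(D d) phi) p| <= C * (jap p `^ mu * xtweight d p * xtweight e p))].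
Proof.
have [r r0 [cK KO]] := closed_ball_in_open; exists r => //.
have Hphi := phase_class cK KO 2.
split => //.
  move=> p pr d; apply: (wclass_differentiable (wclass_derive d Hphi) (t := tt)).
  by split => //; exact: KO.
have b1 d := wclass_bound (wclass_derive d (wclassS Hphi)).
have b2 d e := wclass_bound (wclass_derive e (wclass_derive d Hphi)).
pose C1 d := sval (cid (b1 d)); pose C2 d e := sval (cid (b2 d e)).
exists (\sum_d `|C1 d| + \sum_d \sum_e `|C2 d e|).
  by rewrite addr_ge0 ?sumr_ge0// => d _; rewrite sumr_ge0.
move=> p pr; have Bp : ([set x | `|x - x0| <= r] `*` setT) p by split.
have w0 := ltW (symbol_weight_gt0 mu p).
split => [d|d e].
  apply: le_trans (svalP (cid (b1 d)) tt p Bp) _.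
  rewrite ler_wpM2r ?mulr_ge0 ?xtweight_ge0//.
  apply: le_trans (ler_norm _) _; rewrite (bigD1 d)//= -addrA lerDl.
  by rewrite addr_ge0 ?sumr_ge0// => d' _; rewrite sumr_ge0.
apply: le_trans (svalP (cid (b2 d e)) tt p Bp) _.
rewrite ler_wpM2r ?mulr_ge0 ?xtweight_ge0//.
apply: le_trans (ler_norm _) _; apply: ler_wpDl; first exact: sumr_ge0.
rewrite (bigD1 d)//= (bigD1 e)//= -addrA lerDl.
by rewrite addr_ge0 ?sumr_ge0// => d' _; rewrite sumr_ge0.
Qed.

Hypothesis k00 : k0 != 0.
Hypothesis notSP : ~ SP_set Omega mu phi (x0, k0).

(** The squared size of the gradient of phi - tau k . x at (x, lam th), where the
theta-gradient is scaled by lam. *)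
Definition msize (x : 'rV[R]_n) (th : 'rV[R]_s) (k : 'rV[R]_n) (lam tau : R) : R :=
  enorm (gx (x, lam *: th) - tau *: k) ^+ 2 + lam ^+ 2 * enorm (gt (x, lam *: th)) ^+ 2.

Lemma jap_ray (x : 'rV[R]_n) (th : 'rV[R]_s) (lam : R) : 1 <= lam -> 1 / 2 <= `|th| -> `|th| <= 1 ->
  lam / 2 <= jap (x, lam *: th) <= (1 + s%:R) * lam.
Proof.
move=> l1 t1 t2; have l0 : 0 < lam by exact: lt_le_trans l1.
rewrite /jap /= enormZ (gtr0_norm l0); apply/andP; split.
  have h := norm_le_enorm th; move: (enorm th) h => e h; nra.
have h := enorm_le_norm th; have s0 : 0 <= s%:R :> R by [].
have h2 : enorm th <= s%:R by apply: le_trans h _; rewrite ler_piMr.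
by rewrite mulrDl mul1r; apply: lerD => //; rewrite mulrC ler_wpM2r ?(ltW l0).
Qed.

Lemma powR_ray (lam j c : R) : 0 < mu -> 0 < lam -> 0 <= j -> 0 < c ->
  j <= c * lam -> j `^ mu <= c `^ mu * lam `^ mu.
Proof.
move=> m0 l0 j0 c0 jc; rewrite -powRM ?(ltW l0) ?(ltW c0)//.
by apply: ge0_ler_powR; rewrite ?nnegrE ?(ltW m0)// mulr_ge0 ?ltW.
Qed.

(** The two cases of the definitions of M(phi) and SP(phi), on a single ray over
x0.  The sphere is that of the sup norm. *)
Lemma msize_pointwise th : `|th| = 1 -> exists c Dl : R, [/\ 0 < c, 1 <= Dl &
  forall lam tau, Dl <= lam -> 0 <= tau ->
    c * ((lam `^ mu) ^+ 2 + tau ^+ 2) <= msize x0 th k0 lam tau].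
Proof.
move=> th1; have [mu0 _ Hph] := phi_phase.
have th0 : th != 0 by rewrite -normr_eq0 th1 oner_eq0.
have k2 : 0 < enorm k0 ^+ 2.
  rewrite lt_def sqr_ge0 andbT; apply/eqP => /enorm_eq0 k0E.
  by move: k00; rewrite k0E eqxx.
have [r r0 [KO cK _ [C C0 HC]]] := phase_bounds.
have xr : `|x0 - x0| <= r by rewrite subrr normr0 ltW.
have [[Cm [Dm [Cm0 Dm0 HM]]]|notM] := pselect (exists C D : R, [/\ 0 < C, 0 < D &
    forall lam, D < lam -> C * lam `^ (mu - 1) <= enorm (gt (x0, lam *: th))]).
  pose B := n%:R * (C * (1 + s%:R) `^ mu) ^+ 2 + 1.
  have B0 : 0 < B by rewrite ltr_wpDl// mulr_ge0// sqr_ge0.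
  pose ep := Num.min 1 (Cm ^+ 2 / (2 * B)).
  have ep0 : 0 < ep by rewrite lt_min ltr01 divr_gt0// ?exprn_gt0// mulr_gt0.
  pose c := Num.min (ep * enorm k0 ^+ 2 / 2) (Cm ^+ 2 / 2).
  exists c, (Num.max 1 (Dm + 1)); split.
  - by rewrite lt_min (divr_gt0 (mulr_gt0 ep0 k2))//= divr_gt0// exprn_gt0.
  - by rewrite le_max lexx.
  move=> lam tau; rewrite ge_max => /andP[l1 lD] tau0.
  have l0 : 0 < lam by exact: lt_le_trans l1.
  have lD' : Dm < lam by apply: lt_le_trans lD; rewrite ltrDl.
  have hM := HM _ lD'.
  have q : Cm ^+ 2 * (lam `^ mu) ^+ 2 <= lam ^+ 2 * enorm (gt (x0, lam *: th)) ^+ 2.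
    have E : Cm * lam `^ mu = lam * (Cm * lam `^ (mu - 1)).
      rewrite mulrCA; congr (_ * _); rewrite -{2}(powRr1 (ltW l0)) -powRD.
        by congr (_ `^ _); ring.
      by rewrite (gt_eqF l0) implybT.
    rewrite -!exprMn lerXn2r ?nnegrE ?mulr_ge0 ?powR_ge0 ?enorm_ge0 ?(ltW l0) ?(ltW Cm0)//.
    by rewrite E ler_wpM2l// ltW.
  have v : enorm (gx (x0, lam *: th)) ^+ 2 <= B * (lam `^ mu) ^+ 2.
    apply: (@le_trans _ _ (n%:R * (C * ((1 + s%:R) `^ mu * lam `^ mu)) ^+ 2)).
      apply: enorm_sqr_le => i; rewrite grad_xE.
      have [H _] := HC (x0, lam *: th) xr.
      apply: le_trans (H (inl i)) _; rewrite /= mulr1 ler_wpM2l//.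
      have := jap_ray x0 l1; move=> /(_ th); rewrite th1 lexx ler_pdivrMr// mul1r ler1n.
      move=> /(_ isT isT)/andP[j1 j2].
      by apply: (powR_ray mu0 l0 (ltW (jap_gt0 _)) (ltr_pwDl ltr01 (ler0n R s))).
    rewrite mulrA exprMn mulrA ler_wpM2r ?sqr_ge0// lerDl//.
  have a := enormD_sqr_ge (- (tau *: k0)) (gx (x0, lam *: th)).
  rewrite enormN enormZ exprMn real_normK ?num_real// [- _ + _]addrC in a.
  have a0 := enorm_sqr_ge0 (gx (x0, lam *: th) - tau *: k0).
  have ep1 : ep <= 1 by rewrite ge_min lexx.
  have epB : ep * B <= Cm ^+ 2 / 2.
    have : ep <= Cm ^+ 2 / (2 * B) by rewrite ge_min lexx orbT.
    by rewrite ler_pdivlMr ?mulr_gt0//; move: (ep) (B) (Cm ^+ 2) => e b m h; lra.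
  rewrite /msize; apply: le_trans (theta_gradient_dominates a0 (sqr_ge0 _) a v q (ltW ep0) ep1 epB).
  have c1 : c * tau ^+ 2 <= ep * enorm k0 ^+ 2 / 2 * tau ^+ 2.
    by rewrite ler_wpM2r ?sqr_ge0// ge_min lexx.
  have c2 : c * (lam `^ mu) ^+ 2 <= Cm ^+ 2 / 2 * (lam `^ mu) ^+ 2.
    by rewrite ler_wpM2r ?sqr_ge0// ge_min lexx orbT.
  move: c1 c2; move: (c) (ep) (enorm k0 ^+ 2) (tau ^+ 2) ((lam `^ mu) ^+ 2) (Cm ^+ 2).
  by move=> c' e' k' t' l' m'; lra.
have HSP : exists alpha D : R, [/\ 0 < alpha, 0 < D & forall lam, D < lam ->
    alpha <= angle (gx (x0, lam *: th)) k0].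
  apply: contrapT => H; apply: notSP; split => //; exists th; split => //.
have [al [Da [al0 Da0 Hal]]] := HSP.
have [eta eta0 Heta] := @angle_coercive R n al al0.
have [Cp [Dp [Cp0 Dp0 HP]]] := Hph _ cK KO.
pose et := Num.min 1 eta.
have et0 : 0 < et by rewrite lt_min ltr01.
have S0 : 0 < 1 + s%:R :> R by rewrite ltr_pwDl.
pose cp := Cp / (1 + s%:R) ^+ 2.
have cp0 : 0 < cp by rewrite divr_gt0// exprn_gt0.
exists (Num.min (et * enorm k0 ^+ 2) (et * cp)), (Num.max 1 (Num.max (Da + 1) Dp)); split.
- by rewrite lt_min (mulr_gt0 et0 k2) (mulr_gt0 et0 cp0).
- by rewrite le_max lexx.
move=> lam tau; rewrite !ge_max => /and3P[l1 lD lP] tau0.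
have l0 : 0 < lam by exact: lt_le_trans l1.
have lD' : Da < lam by apply: lt_le_trans lD; rewrite ltrDl.
have a := Heta _ k0 tau tau0 (Hal _ lD').
have e1 : 1 <= enorm th by rewrite -th1 norm_le_enorm.
have e2 : enorm th <= 1 + s%:R.
  by apply: le_trans (enorm_le_norm th) _; rewrite th1 mulr1 lerDr.
have eE : enorm (lam *: th) = lam * enorm th by rewrite enormZ (gtr0_norm l0).
have el : lam <= enorm (lam *: th) by rewrite eE ler_peMr// ltW.
have := HP x0 (lam *: th) xr (le_trans lP el).
have pw : (lam `^ mu) ^+ 2 <= enorm (lam *: th) `^ (2 * mu).
  rewrite mulrC powRrM powR_mulrn ?powR_ge0// lerXn2r ?nnegrE ?powR_ge0//.
  by apply: ge0_ler_powR; rewrite ?nnegrE ?(ltW mu0) ?enorm_ge0 ?(ltW l0).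
rewrite /msize eE exprMn; move: a pw.
have e3 : enorm th ^+ 2 <= (1 + s%:R) ^+ 2 by rewrite lerXn2r ?nnegrE ?enorm_ge0 ?(ltW S0).
have := enorm_sqr_ge0 (gt (x0, lam *: th)).
have := enorm_sqr_ge0 (gx (x0, lam *: th) - tau *: k0).
have := enorm_sqr_ge0 (gx (x0, lam *: th)).
have := sqr_ge0 (lam `^ mu).
rewrite -[lam * enorm th]eE.
move: (enorm (gt _) ^+ 2) (enorm (gx _ - _) ^+ 2) (enorm (gx _) ^+ 2) (lam `^ mu ^+ 2).
move=> g a v L L0 v0 a0 g0 ea pw ph.
have h1 : Cp * L <= v + lam ^+ 2 * enorm th ^+ 2 * g by apply: le_trans ph; rewrite ler_wpM2l// ltW.
have h2 : cp * L <= v + lam ^+ 2 * g.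
  rewrite /cp mulrAC ler_pdivrMr ?exprn_gt0//; apply: le_trans h1 _.
  have hv : v <= v * (1 + s%:R) ^+ 2 by rewrite ler_peMr// exprn_ege1// lerDl.
  have hg : lam ^+ 2 * enorm th ^+ 2 * g <= lam ^+ 2 * g * (1 + s%:R) ^+ 2.
    by rewrite mulrAC ler_wpM2l// mulr_ge0 ?sqr_ge0.
  by rewrite mulrDl lerD.
exact: angle_dominates v0 a0 (mulr_ge0 (sqr_ge0 lam) g0) L0 (sqr_ge0 tau) et0 cp0 k2 ea h2.
Qed.

Definition rayweight (d : I) (lam : R) : R :=
  match d with inl _ => 1 | inr _ => lam^-1 end.

Lemma rayweight_xtweight d (x : 'rV[R]_n) (th : 'rV[R]_s) (lam : R) :
  1 <= lam -> 1 / 2 <= `|th| -> `|th| <= 1 ->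
  xtweight d (x, lam *: th) <= 2 * rayweight d lam.
Proof.
move=> l1 t1 t2; have /andP[j1 _] := jap_ray x l1 t1 t2.
have l0 : 0 < lam by exact: lt_le_trans l1.
case: d => [i|j] /=; first by rewrite mulr1 ler1n.
have h : (jap (x, lam *: th))^-1 <= (lam / 2)^-1.
  by rewrite lef_pV2 ?posrE ?jap_gt0 ?divr_gt0.
by apply: le_trans h _; rewrite invfM invrK mulrC.
Qed.

(** Mean value theorem on the segment from (x0, lam th0) to (x, lam th).  Along
it <theta> is comparable to lam, and a derivative in theta costs lam^-1 while
the displacement in theta is lam (th - th0). *)
Lemma grad_lipschitz : exists r C : R, [/\ 0 < r, 0 <= C &
  forall (x : 'rV[R]_n) (th th0 : 'rV[R]_s) (lam delta : R), `|th| = 1 -> `|th0| = 1 ->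
    delta <= 1 / 2 -> delta <= r -> `|th - th0| <= delta -> `|x - x0| <= delta -> 1 <= lam ->
    forall d, `|'D_(D d) phi (x, lam *: th) - 'D_(D d) phi (x0, lam *: th0)| <=
      C * delta * lam `^ mu * rayweight d lam].
Proof.
have [mu0 _ _] := phi_phase.
have [r r0 [KO cK dphi [C C0 HC]]] := phase_bounds.
exists r, (\sum_(e : I) 4 * C * (1 + s%:R) `^ mu); split => //.
  by apply: sumr_ge0 => e _; rewrite !mulr_ge0// powR_ge0.
move=> x th th0 lam de th1 th01 de2 der thd xd l1 d.
have l0 : 0 < lam by exact: lt_le_trans l1.
have de0 : 0 <= de by exact: le_trans xd.
pose v : X := (x - x0, lam *: (th - th0)).
have lineE t : (x0, lam *: th0) + t *: v = (x0 + t *: (x - x0), lam *: (th0 + t *: (th - th0))) :> X.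
  apply: (f_equal2 pair) => //=.
    by rewrite [in RHS]scalerDr !scalerA [lam * t]mulrC.
have line t : 0 <= t <= 1 -> let p : X := (x0, lam *: th0) + t *: v in
   `|p.1 - x0| <= r /\ forall e, jap p `^ mu <= (1 + s%:R) `^ mu * lam `^ mu /\ xtweight e p <= 2 * rayweight e lam.
  move=> /andP[t0 t1] p; rewrite {}/p lineE /=; split.
    rewrite addrC addKr normrZ (ger0_norm t0); apply: le_trans der.
    by apply: le_trans xd; rewrite ler_piMl.
  have a1 : 1 / 2 <= `|th0 + t *: (th - th0)|.
    have := lerB_normD th0 (t *: (th - th0)); rewrite th01 normrZ (ger0_norm t0).
    have := ler_piMl (normr_ge0 (th - th0)) t1; lra.
  have a2 : `|th0 + t *: (th - th0)| <= 1.
    have -> : th0 + t *: (th - th0) = (1 - t) *: th0 + t *: th.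
      by rewrite scalerBr scalerBl scale1r addrA addrAC.
    apply: le_trans (ler_normD _ _) _; rewrite !normrZ th1 th01 !mulr1.
    by rewrite (ger0_norm t0) ger0_norm ?subr_ge0// subrK.
  move=> e; split; last exact: rayweight_xtweight.
  have /andP[j1 j2] := jap_ray (x0 + t *: (x - x0)) l1 a1 a2.
  by apply: (powR_ray mu0 l0 (ltW (jap_gt0 _)) (ltr_pwDl ltr01 (ler0n R s))).
have [t /andP[t0 t1]] := @mvt_line _ _ ('D_(D d) phi) (x0, lam *: th0) v 1 ltr01
  (fun t ht => dphi _ (line t ht).1 d).
have tt : 0 <= t <= 1 by rewrite !ltW.
have [pr pw] := line t tt.
have -> : (x0, lam *: th0) + 1 *: v = (x, lam *: th).
  by rewrite lineE !scale1r [x0 + _]addrC subrK [th0 + _]addrC subrK.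
rewrite mul1r => ->.
move: ((x0, lam *: th0) + t *: v) pr pw => p pr pw.
have vb e : `|xtcoord e v| * rayweight e lam <= de.
  case: e => [i|j] /=.
    by rewrite mulr1; apply: le_trans (rV_coord_le _ _) xd.
  apply: (@le_trans _ _ (`|lam *: (th - th0)| / lam)).
    by rewrite ler_wpM2r ?invr_ge0 ?(ltW l0)// rV_coord_le.
  by rewrite normrZ (gtr0_norm l0) mulrAC divff ?mul1r// gt_eqF.
rewrite {1}(xtcoord_sum v) derive_dir_sum; last exact: dphi.
apply: le_trans (ler_norm_sum _ _ _) _; rewrite !mulr_suml.
apply: ler_sum => e _; rewrite derive_dirZ; last exact: dphi.
rewrite normrM.
have [_ /(_ d e) H] := HC p pr.
have [pj _] := pw e; have [_ pd] := pw d; have [_ pe] := pw e.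
have h1 : jap p `^ mu * xtweight d p * xtweight e p <=
   (1 + s%:R) `^ mu * lam `^ mu * (2 * rayweight d lam) * (2 * rayweight e lam).
  by rewrite !ler_pM ?mulr_ge0 ?powR_ge0 ?xtweight_ge0.
have h2 := le_trans H (ler_wpM2l C0 h1).
apply: le_trans (ler_wpM2l (normr_ge0 _) h2) _.
have w0 : 0 <= rayweight d lam by case: (d) => [i|j] //=; rewrite invr_ge0 ltW.
have := vb e.
have := powR_ge0 (1 + s%:R) mu; have := powR_ge0 lam mu.
move: (lam `^ mu) ((1 + s%:R) `^ mu) (rayweight d lam) w0 (`|xtcoord e v|) (rayweight e lam) => L S w w0 q u L0 S0 h.
have A0 : 0 <= 4 * C * S * L * w by rewrite !mulr_ge0.
have := ler_wpM2l A0 h; lra.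
Qed.

(** Moving x, th and k by delta changes the gradient by O(delta (lam^mu + tau)),
which is absorbed when delta is small. *)
Lemma msize_local th0 : `|th0| = 1 -> exists2 delta : R, 0 < delta &
  forall x th k (lam tau : R), `|th| = 1 -> `|th - th0| <= delta -> `|x - x0| <= delta ->
    `|k - k0| <= delta -> delta^-1 <= lam -> 0 <= tau ->
    delta * ((lam `^ mu) ^+ 2 + tau ^+ 2) <= msize x th k lam tau.
Proof.
move=> th01; have [c [Dl [c0 Dl1 Hc]]] := msize_pointwise th01.
have [r [C [r0 C0 HL]]] := grad_lipschitz.
(* E delta^2 (lam^(2 mu) + tau^2) bounds the squared error *)
pose E := 2 * n%:R * (C ^+ 2 + 1) + s%:R * C ^+ 2.
have E0 : 0 <= E by rewrite addr_ge0 ?mulr_ge0 ?addr_ge0 ?sqr_ge0.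
have E1 : 0 < 4 * (E + 1) by rewrite mulr_gt0// ltr_wpDl.
have D0 : 0 < Dl by exact: lt_le_trans Dl1.
pose de := Num.min (1 / 2) (Num.min r (Num.min (c / 4) (Num.min (c / (4 * (E + 1))) Dl^-1))).
have de0 : 0 < de by rewrite !lt_min r0 !divr_gt0// invr_gt0 D0.
exists de => // x th k lam tau th1 thd xd kd lamd tau0.
have [d1 d2 d3 d4 d5] : [/\ de <= 1 / 2, de <= r, de <= c / 4, de <= c / (4 * (E + 1)) & de <= Dl^-1].
  by split; rewrite !ge_min lexx ?orbT.
have lamD : Dl <= lam.
  by apply: le_trans lamd; rewrite -[Dl]invrK lef_pV2 ?posrE ?invr_gt0.
have l1 : 1 <= lam by exact: le_trans lamD.
have l0 : 0 < lam by exact: lt_le_trans l1.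
have HL' := HL x th th0 lam de th1 th01 d1 d2 thd xd l1.
have H0 := Hc lam tau lamD tau0.
pose g := gx (x0, lam *: th0) - tau *: k0; pose g' := gx (x, lam *: th) - gx (x0, lam *: th0).
pose hk := - (tau *: (k - k0)).
have gE : gx (x, lam *: th) - tau *: k = g + (g' + hk).
  by rewrite /g /g' /hk; apply/rowP => i; rewrite !mxE; ring.
pose q := gt (x0, lam *: th0); pose q' := gt (x, lam *: th) - q.
have qE : gt (x, lam *: th) = q + q' by rewrite /q' addrC subrK.
have i1 := enormD_sqr_ge g (g' + hk); have i2 := enormD_sqr_le g' hk.
have i3 := enormD_sqr_ge q q'.
have i4 : enorm g' ^+ 2 <= n%:R * (C * de * lam `^ mu) ^+ 2.
  by apply: enorm_sqr_le => i; have := HL' (inl i); rewrite mulr1 /g' !mxE.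
have i5 : enorm q' ^+ 2 <= s%:R * (C * de * lam `^ mu / lam) ^+ 2.
  by apply: enorm_sqr_le => j; have := HL' (inr j); rewrite /q' !mxE.
have i6 : enorm hk ^+ 2 <= n%:R * (tau * de) ^+ 2.
  apply: enorm_sqr_le => i; apply: le_trans (rV_coord_le _ _) _.
  by rewrite normrN normrZ (ger0_norm tau0) ler_wpM2l.
have i7 : lam ^+ 2 * enorm q' ^+ 2 <= s%:R * (C * de * lam `^ mu) ^+ 2.
  have -> : s%:R * (C * de * lam `^ mu) ^+ 2 = lam ^+ 2 * (s%:R * (C * de * lam `^ mu / lam) ^+ 2).
    by move: (lam `^ mu) => L; field; rewrite gt_eqF.
  by rewrite ler_wpM2l ?sqr_ge0.
have i8 := ler_wpM2l (sqr_ge0 lam) i3.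
rewrite /msize gE qE; move: H0; rewrite /msize -/g -/q.
have dE : de ^+ 2 * E <= c / 4.
  move: d4; rewrite ler_pdivlMr// => d4.
  have : de ^+ 2 * E <= de * (1 / 2) * E by rewrite ler_wpM2r// expr2 ler_wpM2l// ltW.
  move: (de ^+ 2) (de) (c) (E) de0 c0 d4 => z y c' e y0 c0' h h'; lra.
have L0 : 0 <= (lam `^ mu) ^+ 2 + tau ^+ 2 by rewrite addr_ge0 ?sqr_ge0.
have j1 := ler_wpM2r L0 dE; have j2 := ler_wpM2r L0 d3.
have j3 : 2 * (n%:R * (C * de * lam `^ mu) ^+ 2) + 2 * (n%:R * (tau * de) ^+ 2) +
    s%:R * (C * de * lam `^ mu) ^+ 2 <= de ^+ 2 * E * ((lam `^ mu) ^+ 2 + tau ^+ 2).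
  rewrite -subr_ge0 /E.
  have -> : de ^+ 2 * (2 * n%:R * (C ^+ 2 + 1) + s%:R * C ^+ 2) * (lam `^ mu ^+ 2 + tau ^+ 2) -
     (2 * (n%:R * (C * de * lam `^ mu) ^+ 2) + 2 * (n%:R * (tau * de) ^+ 2) +
       s%:R * (C * de * lam `^ mu) ^+ 2) =
     2 * n%:R * (de * lam `^ mu) ^+ 2 + 2 * n%:R * (C * de * tau) ^+ 2 + s%:R * (C * de * tau) ^+ 2.
    by ring.
  have sq (m : nat) (y : R) : 0 <= m%:R * y ^+ 2 by rewrite mulr_ge0 ?sqr_ge0.
  by rewrite -!natrM !addr_ge0.
move: i1 i2 i4 i6 i7 i8 j1 j2 j3.
move: (n%:R * (C * de * lam `^ mu) ^+ 2) (n%:R * (tau * de) ^+ 2) (s%:R * (C * de * lam `^ mu) ^+ 2)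
  ((lam `^ mu) ^+ 2 + tau ^+ 2) (enorm (g + (g' + hk)) ^+ 2) (enorm g ^+ 2) (enorm (g' + hk) ^+ 2)
  (enorm g' ^+ 2) (enorm hk ^+ 2) (lam ^+ 2) (enorm q ^+ 2) (enorm q' ^+ 2) (enorm (q + q') ^+ 2) (de ^+ 2 * E)
  => A B A' L G1 G2 G3 G4 G5 L2 Q1 Q2 Q3 dd.
by move=> *; lra.
Qed.

(** The local constants are made of the form 1 / (i + 1), for which the estimate
holds eventually in i; compactness then yields a common i. *)
Lemma msize_sphere : exists2 delta : R, 0 < delta &
  forall x th k (lam tau : R), `|th| = 1 -> `|x - x0| <= delta ->
    `|k - k0| <= delta -> delta^-1 <= lam -> 0 <= tau ->
    delta * ((lam `^ mu) ^+ 2 + tau ^+ 2) <= msize x th k lam tau.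
Proof.
pose P (i : nat) (th : 'rV[R]_s) := `|th| = 1 -> forall x k (lam tau : R), `|x - x0| <= i.+1%:R^-1 ->
    `|k - k0| <= i.+1%:R^-1 -> (i.+1%:R^-1)^-1 <= lam -> 0 <= tau ->
    i.+1%:R^-1 * ((lam `^ mu) ^+ 2 + tau ^+ 2) <= msize x th k lam tau.
pose K := [set th : 'rV[R]_s | `|th| = 1].
have cK : compact K.
  apply: (subclosed_compact _ (@compact_norm_ball _ _ (0 : 'rV[R]_s) 1)) => [|th /=]; last by rewrite subr0 => ->.
  have -> : K = (fun v : 'rV[R]_s => `|v|) @^-1` [set x | x = 1] by [].
  by apply: closed_comp => [v _|]; [exact: norm_continuous|exact: closed_eq].
have [|N _ HN] := (compact_near_coveringP K).1 cK nat \oo P _ _.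
  move=> th0 th01; have [de de0 H] := msize_local th01.
  exists ([set th | `|th - th0| < de], [set i | i.+1%:R^-1 < de]); first split => /=.
  - apply/nbhs_ballP; exists de => // th; rewrite -ball_normE /ball_/=.
    by rewrite distrC.
  - exact: near_infty_natSinv_lt (PosNum de0).
  move=> [th i] /= [thd id] th1 x k lam tau xd kd lamd tau0.
  have iv : de^-1 <= (i.+1%:R^-1 : R)^-1 by rewrite lef_pV2 ?posrE// ltW.
  have := H x th k lam tau th1 (ltW thd) (le_trans xd (ltW id)) (le_trans kd (ltW id)) (le_trans iv lamd) tau0.
  apply: le_trans; rewrite ler_wpM2r ?(ltW id)// addr_ge0 ?sqr_ge0//.
exists N.+1%:R^-1 => // x th k lam tau th1; exact: (HN N (leqnn N) th th1 th1).
Qed.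

Definition cone (delta : R) : set 'rV[R]_n :=
  [set k | exists tau k', [/\ 0 < tau, `|k' - k0| < delta & k = tau *: k']].

Lemma cone_open delta : open (cone delta).
Proof.
rewrite openE => k [tau [k' [tau0 kd kE]]]; apply/nbhs_ballP.
exists (tau * (delta - `|k' - k0|)) => [|y]; first by rewrite /= mulr_gt0// subr_gt0.
rewrite -ball_normE /ball_/= => yd; exists tau, (tau^-1 *: y); split => //.
  have -> : tau^-1 *: y - k0 = (k' - k0) - tau^-1 *: (k - y).
    rewrite kE scalerBr scalerA mulVf ?gt_eqF// scale1r.
    by apply/rowP => i; rewrite !mxE; ring.
  apply: le_lt_trans (ler_normB _ _) _; rewrite normrZ gtr0_norm ?invr_gt0//.
  by rewrite addrC -ltrBrDr mulrC ltr_pdivrMr// mulrC.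
by rewrite scalerA divff ?scale1r// gt_eqF.
Qed.

Lemma cone_center delta : 0 < delta -> cone delta k0.
Proof. by move=> d0; exists 1, k0; rewrite ltr01 subrr normr0 scale1r. Qed.

Lemma cone_scale delta (lam : R) k : 0 < lam -> cone delta k -> cone delta (lam *: k).
Proof.
move=> l0 [tau [k' [tau0 kd ->]]]; exists (lam * tau), k'.
by rewrite mulr_gt0// scalerA.
Qed.

(** For theta outside a ball this is [msize_sphere] with lam = |theta|.  Inside
it, grad_x phi is bounded, and |k| alone is large enough. *)
Lemma gradient_lower : exists delta c k1 : R, [/\ 0 < delta, 0 < c, 1 <= k1,
  compact [set x : 'rV[R]_n | `|x - x0| <= delta] /\ [set x | `|x - x0| <= delta] `<=` Omega &
  forall k x th, cone delta k -> k1 <= enorm k -> `|x - x0| <= delta ->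
    c * (jap (x, th) `^ mu + enorm k) ^+ 2 <=
      enorm (gx (x, th) - k) ^+ 2 + (1 + enorm th ^+ 2) * enorm (gt (x, th)) ^+ 2].
Proof.
have [mu0 _ _] := phi_phase.
have [d1 d10 Hs] := msize_sphere.
have [r r0 [KO cK _ [C C0 HC]]] := phase_bounds.
pose de := Num.min d1 r.
have de0 : 0 < de by rewrite lt_min d10.
have ded : de <= d1 by rewrite ge_min lexx.
have der : de <= r by rewrite ge_min lexx orbT.
pose A := (1 + s%:R : R) `^ mu; pose K := n%:R * (`|k0| + de).
have K0 : 0 <= K by rewrite mulr_ge0// addr_ge0// ltW.
pose c1 := d1 / (2 * A ^+ 2 + 2 * K ^+ 2 + 1).
have B1 : 0 < 2 * A ^+ 2 + 2 * K ^+ 2 + 1 by rewrite ltr_wpDl// addr_ge0// mulr_ge0// sqr_ge0.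
have c10 : 0 < c1 by rewrite divr_gt0.
pose M : R := Num.max 1 d1^-1.
have M0 : 0 < M by rewrite lt_max ltr01.
pose J : R := (1 + s%:R * M) `^ mu.
have J0 : 0 <= J by exact: powR_ge0.
pose B := n%:R * (C * J) ^+ 2.
have B0 : 0 <= B by rewrite mulr_ge0// sqr_ge0.
have S0 : 0 < 1 + s%:R :> R by rewrite ltr_pwDl.
exists de, (Num.min c1 (1 / 16)), (1 + 4 * B + J); split => //.
- by rewrite lt_min c10 divr_gt0.
- by rewrite -addrA lerDl addr_ge0// mulr_ge0.
- split; first exact: compact_norm_ball.
  by move=> x /= xd; apply: KO; exact: le_trans der.
move=> k x th [tau [k' [tau0 k'd kE]]] kk xd.
have xr : `|x - x0| <= r by exact: le_trans der.
have j0 := powR_ge0 (jap (x, th)) mu.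
have g0 := enorm_sqr_ge0 (gt (x, th)).
have [th1|th1] := leP M `|th|.
  set lam := `|th| in th1; have l0 : 0 < lam by exact: lt_le_trans M0 th1.
  have /andP[l1 ld] : (1 <= lam) && (d1^-1 <= lam) by move: th1; rewrite ge_max.
  pose w := lam^-1 *: th.
  have thE : th = lam *: w by rewrite /w scalerA divff ?scale1r// gt_eqF.
  have w1 : `|w| = 1 by rewrite normrZ gtr0_norm ?invr_gt0// mulVf// gt_eqF.
  have := Hs x w k' lam tau w1 (le_trans xd ded) (le_trans (ltW k'd) ded) ld (ltW tau0).
  rewrite /msize -thE -kE => H.
  have lt : lam ^+ 2 <= 1 + enorm th ^+ 2.
    rewrite ler_wpDl// lerXn2r ?nnegrE ?enorm_ge0 ?(ltW l0)//; exact: norm_le_enorm.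
  have Hg := ler_wpM2r g0 lt.
  have jl : jap (x, th) `^ mu <= A * lam `^ mu.
    apply: (powR_ray mu0 l0 (ltW (jap_gt0 _)) S0).
    rewrite /jap /= mulrDl mul1r; apply: lerD => //; exact: enorm_le_norm.
  have kl : enorm k <= K * tau.
    rewrite kE enormZ (gtr0_norm tau0) mulrC ler_wpM2r ?(ltW tau0)//.
    apply: le_trans (enorm_le_norm _) _; rewrite ler_wpM2l//.
    rewrite -[k'](subrK k0) addrC; apply: le_trans (ler_normD _ _) _.
    by rewrite lerD2l ltW.
  apply: (@le_trans _ _ (c1 * (jap (x, th) `^ mu + enorm k) ^+ 2)).
    by rewrite ler_wpM2r ?sqr_ge0// ge_min lexx.
  apply: le_trans (le_trans H _); last by rewrite lerD2l.
  rewrite /c1 mulrAC ler_pdivrMr//.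
  rewrite -mulrA ler_wpM2l ?(ltW d10)//.
  have e0 := enorm_ge0 k.
  move: (jap _ `^ mu) (enorm k) (lam `^ mu) j0 e0 jl kl => j e L j0' e0 jl kl.
  have h1 : j ^+ 2 <= A ^+ 2 * L ^+ 2 by rewrite -exprMn lerXn2r ?nnegrE// (le_trans j0').
  have h2 : e ^+ 2 <= K ^+ 2 * tau ^+ 2 by rewrite -exprMn lerXn2r ?nnegrE// (le_trans e0).
  have h3 := sqr_ge0 (j - e).
  have p1 := mulr_ge0 (sqr_ge0 A) (sqr_ge0 tau); have p2 := mulr_ge0 (sqr_ge0 K) (sqr_ge0 L).
  have p3 := sqr_ge0 L; have p4 := sqr_ge0 tau.
  lra.
have jJ : jap (x, th) `^ mu <= J.
  apply: ge0_ler_powR; rewrite ?nnegrE ?(ltW mu0) ?(ltW (jap_gt0 _)) ?addr_ge0 ?mulr_ge0 ?(ltW M0)//.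
  rewrite /jap lerD2l; apply: le_trans (enorm_le_norm _) _.
  by rewrite ler_wpM2l// ltW.
have gB : enorm (gx (x, th)) ^+ 2 <= B.
  apply: enorm_sqr_le => i; rewrite grad_xE; have [H _] := HC (x, th) xr.
  by apply: le_trans (H (inl i)) _; rewrite mulr1 ler_wpM2l.
apply: (@le_trans _ _ (1 / 16 * (jap (x, th) `^ mu + enorm k) ^+ 2)).
  by rewrite ler_wpM2r ?sqr_ge0// ge_min lexx orbT.
apply: (@le_trans _ _ (enorm (gx (x, th) - k) ^+ 2)); last first.
  by rewrite lerDl mulr_ge0// addr_ge0 ?sqr_ge0.
have := enormD_sqr_ge (- k) (gx (x, th)); rewrite [- k + _]addrC enormN.
move: (enorm (gx _ - _) ^+ 2) (enorm (gx _) ^+ 2) gB (jap _ `^ mu) j0 jJ (enorm k) kk => q g gB j j0' jJ e kk hq.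
have e1 : 1 <= e by apply: le_trans kk; rewrite -addrA lerDl addr_ge0// mulr_ge0.
have h1 : e <= e ^+ 2 by rewrite expr2 ler_peMl// (le_trans ler01).
have je : j <= e by apply: le_trans jJ _; apply: le_trans kk; rewrite lerDr addr_ge0// mulr_ge0.
have h2 : j ^+ 2 <= e ^+ 2 by rewrite lerXn2r ?nnegrE// (le_trans j0' je).
have h3 := sqr_ge0 (j - e).
lra.
Qed.

End phase_geometry.

(** * Modulated test functions *)
Section modulated_cutoffs.
Context {R : realType} {n : nat} (Omega : set 'rV[R]_n) (x0 : 'rV[R]_n) (r : R).
Hypothesis r0 : 0 < r.
Hypothesis ball_Omega : [set x : 'rV[R]_n | `|x - x0| <= r] `<=` Omega.

Let S := [set x : 'rV[R]_n | `|x - x0| <= r].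

(** The test function chi(x) e^(- i k . x) of the localized Fourier transform. *)
Definition modulated (k x : 'rV[R]_n) : R[i] := (space_cut x0 r x)%:C * expi (- dotp k x).

Lemma re_modulated k : re_fun (modulated k) = (fun x => space_cut x0 r x * cos (dotp k x)).
Proof. by apply/funext => x; rewrite /re_fun/= cosN mul0r subr0. Qed.

Lemma im_modulated k : im_fun (modulated k) = (fun x => - (space_cut x0 r x * sin (dotp k x))).
Proof. by apply/funext => x; rewrite /im_fun/= sinN mul0r addr0 mulrN. Qed.

Lemma space_cut_ball x : ~ S x -> space_cut x0 r x = 0.
Proof.
move=> /negP; rewrite -ltNge => rx; apply: space_cut_support => //.
exact: le_trans (ltW rx) (norm_le_enorm _).
Qed.

Lemma differentiable_dotp (k x : 'rV[R]_n) : differentiable (dotp k) x.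
Proof.
apply: (@differentiable_bigsum _ _ _ _ (fun i (y : 'rV[R]_n) => k 0 i * y 0 i)) => i.
apply: (differentiable_mul (f := fun=> k 0 i)) => //; exact: differentiable_coord.
Qed.

Lemma derive_dotp (k x : 'rV[R]_n) i : 'D_(unitv i) (dotp k) x = k 0 i.
Proof. by apply: derive_linear => h; exact: dotp_shift. Qed.

(** On the support of the cutoff, k . x has bounded derivatives as long as k is
bounded, so the family is bounded with all its derivatives. *)
Lemma modulated_class (T : Type) (ka : T -> 'rV[R]_n) (M : R) l : (forall t, `|ka t| <= M) ->
  wclass (@unitv R n) (fun _ _ => 1) (fun _ : T => setT) (fun _ => setT) l (fun _ _ => 1)
    (fun t => re_fun (modulated (ka t))) /\
  wclass (@unitv R n) (fun _ _ => 1) (fun _ : T => setT) (fun _ => setT) l (fun _ _ => 1)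
    (fun t => im_fun (modulated (ka t))).
Proof.
move=> kM.
have om0 (d : 'I_n) (p : 'rV[R]_n) : 0 <= (1 : R) by [].
have oU (t : T) : open [set: 'rV[R]_n] by exact: openT.
have BU (t : T) : S `<=` [set: 'rV[R]_n] by [].
have Hd : wclass (@unitv R n) (fun _ _ => 1) (fun _ : T => setT) (fun _ => S) l (fun _ _ => 1)
   (fun t => dotp (ka t)).
  apply: (@wclass_affine _ _ _ _ _ _ _ _ om0 oU BU _ _ _ (fun i t => ka t 0 i)) => //.
  - by move=> t p _; exact: differentiable_dotp.
  - by move=> i t p _; exact: derive_dotp.
  - exists (n%:R * M * (n%:R * (`|x0| + r))) => t p Sp; rewrite mulr1.
    apply: le_trans (dotp_cauchy _ _) _; apply: ler_pM; rewrite ?enorm_ge0//.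
      by apply: le_trans (enorm_le_norm _) _; rewrite ler_wpM2l.
    apply: le_trans (enorm_le_norm _) _; rewrite ler_wpM2l//.
    by rewrite -[p](subrK x0) addrC (le_trans (ler_normD _ _))// lerD2l.
  - by move=> i; exists M => t p _; rewrite !mulr1 (le_trans (rV_coord_le _ _)).
have [Hc Hs] := wclass_trig om0 oU BU Hd.
have Hx := wclass_sub (U' := fun=> setT) (B' := fun=> S) (fun _ => @subset_refl _ _) (fun _ _ _ => I)
  (space_cut_class x0 r0 T l).
have Sc (t : T) : closed S by exact: closed_norm_ball.
have w1 (t : T) (p : 'rV[R]_n) : S p -> 0 <= (1 : R) * 1 by [].
have fin f : (forall t p, ~ S p -> f t p = 0) ->
    wclass (@unitv R n) (fun _ _ => 1) (fun _ : T => setT) (fun _ => S) l (fun _ _ => 1 * 1) f ->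
    wclass (@unitv R n) (fun _ _ => 1) (fun _ : T => setT) (fun _ => setT) l (fun _ _ => 1) f.
  move=> f0 /(wclass_eqw (w' := fun _ _ => 1) om0 (fun _ _ _ => mulr1 _) w1).
  by apply: (@wclass_support _ _ _ _ _ _ _ _ om0 _ _ _ (fun=> S)).
split.
  apply: fin => [t p nS|]; first by rewrite re_modulated space_cut_ball// mul0r.
  by have := wclass_mul oU BU Hx Hc; apply: (wclass_ext oU BU) => t p _; rewrite re_modulated.
apply: fin => [t p nS|]; first by rewrite im_modulated space_cut_ball// mul0r oppr0.
have := wclass_opp om0 oU BU (wclass_mul oU BU Hx Hs).
by apply: (wclass_ext oU BU) => t p _; rewrite im_modulated.
Qed.

Lemma unitv_span (v : 'rV[R]_n) : exists c : 'I_n -> R, v = \sum_i c i *: unitv i.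
Proof. by exists (v 0); exact: row_sum_delta. Qed.

Lemma modulated_supp k : supp (modulated k) `<=` S.
Proof.
rewrite [X in _ `<=` X](_ : _ = closure S); last first.
  by apply/closure_id; exact: closed_norm_ball.
apply: closure_subset => y /= /eqP my; apply: contrapT => nS; apply: my.
by rewrite /modulated space_cut_ball// mul0r.
Qed.

Lemma modulated_test k : test_function Omega (modulated k).
Proof.
have om0 (d : 'I_n) (p : 'rV[R]_n) : 0 <= (1 : R) by [].
have oU (t : unit) : open [set: 'rV[R]_n] by exact: openT.
have H l := @modulated_class unit (fun=> k) `|k| l (fun=> lexx _).
split.
- apply/smooth_onP; split.
    exact: (wclass_smooth (t := tt) (U := fun=> setT) (f := fun=> re_fun (modulated k))
      om0 oU unitv_span (fun l => (H l).1)).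
  exact: (wclass_smooth (t := tt) (U := fun=> setT) (f := fun=> im_fun (modulated k))
      om0 oU unitv_span (fun l => (H l).2)).
- apply: (subclosed_compact _ (_ : compact S) (@modulated_supp k)); first exact: closed_closure.
  exact: compact_norm_ball.
- by apply: subset_trans ball_Omega; exact: modulated_supp.
Qed.

Lemma modulated_partials (M : R) (N : nat) : exists C : R, forall k al x, `|k| <= M ->
  (mi_deg al <= N)%N -> cabs (partials al (modulated k) x) <= C.
Proof.
have [Hr Hi] := @modulated_class {k : 'rV[R]_n | `|k| <= M} sval M N svalP.
have [C C0 HC] := wclass_words (fun _ _ _ => ler01) Hr.
have [D D0 HD] := wclass_words (fun _ _ _ => ler01) Hi.
exists (C + D) => k al x kM alN.
have sz : (size (mi_seq al) <= N)%N by rewrite size_mi_seq.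
apply: le_trans (cabs_le _) _.
have h1 := HC (mi_seq al) (exist _ k kM) x sz I.
have h2 := HD (mi_seq al) (exist _ k kM) x sz I.
rewrite !mulr1 !dwordsE/= in h1 h2.
apply: lerD.
  by move: h1; rewrite -re_cderives.
by move: h2; rewrite -im_cderives.
Qed.

End modulated_cutoffs.

(** * Symbols with compact support in theta *)
Lemma finite_eventually (T : Type) (F : set T) (P : T -> nat -> Prop) : finite_set F ->
  (forall x, F x -> exists N, forall j, (N <= j)%N -> P x j) ->
  exists N, forall x, F x -> forall j, (N <= j)%N -> P x j.
Proof.
case/finite_setP=> n; elim: n F => [F|n IH F].
  by rewrite II0 card_eq0 => /eqP -> _; exists 0.
move=> /eq_cardSP[x Fx] /IH{}IH H; have [N HN] := H x Fx.
have [y [Fy _]|M HM] := IH _; first exact: H.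
exists (maxn N M) => y Fy j; rewrite geq_max => /andP[Nj Mj].
have [->|xy] := pselect (y = x); first exact: HN.
by apply: HM => //; split.
Qed.

Section regularization.
Context {R : realType} {n s : nat} (Omega : set 'rV[R]_n).
Local Notation X := ('rV[R]_n * 'rV[R]_s)%type.
Hypothesis Omega_open : open Omega.
Variables (m : R) (a : X -> R[i]).
Hypothesis a_symbol : symbol Omega m a.

Local Notation wcl T K := (wclass (@xtdir R n s) (@xtweight R n s)
  (fun _ : T => Omega `*` setT) (fun _ => K `*` setT)).
Let xw0 := @xtweight_ge0 R n s.
Let oU (T : Type) (t : T) : open (Omega `*` [set: 'rV[R]_s]).
Proof. exact: open_cylinder. Qed.

Definition regularized (j : nat) (p : X) : R[i] := a p * (theta_cut j p)%:C.

Lemma re_regularized j : re_fun (regularized j) = (fun p => re_fun a p * theta_cut j p).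
Proof. by apply/funext => p; rewrite /regularized /re_fun; case: (a p) => u v /=; rewrite mulr0 subr0. Qed.

Lemma im_regularized j : im_fun (regularized j) = (fun p => im_fun a p * theta_cut j p).
Proof. by apply/funext => p; rewrite /regularized /im_fun; case: (a p) => u v /=; rewrite mulr0 add0r. Qed.

(** On the support of the cutoff <theta> is bounded, so that all the weights
<theta>^m are equivalent. *)
Lemma regularized_symbol j m' : symbol Omega m' (regularized j).
Proof.
pose S := [set p : X | enorm p.2 <= j.+1%:R].
have cS : closed S.
  have -> : S = (fun p : X => enorm p.2 ^+ 2) @^-1` [set x | x <= j.+1%:R ^+ 2].
    apply/seteqP; split => p /=; first by move=> h; rewrite lerXn2r ?nnegrE ?enorm_ge0.
    by rewrite ler_pXn2r ?nnegrE ?enorm_ge0.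
  apply: closed_comp => [p _|]; last exact: closed_le.
  apply: differentiable_continuous.
  have -> : (fun p : X => enorm p.2 ^+ 2) = (fun p => \sum_i p.2 0 i ^+ 2).
    by apply/funext => q; rewrite enorm_sqr.
  apply: (@differentiable_bigsum _ _ _ _ (fun i (q : X) => q.2 0 i ^+ 2)) => i.
  by apply: differentiable_mul; exact: differentiable_coordt.
pose w (m : R) := fun (_ : unit) => symbol_weight m : X -> R.
have w0 m1 (t : unit) p : 0 <= w m1 t p by exact: ltW (symbol_weight_gt0 _ _).
have key K g : compact K -> K `<=` Omega ->
    (forall l, wcl unit K l (w m) (fun _ => g)) ->
    forall l, wcl unit K l (w m') (fun _ p => g p * theta_cut j p).
  move=> cK KO Hg l.
  have BU (t : unit) : K `*` [set: 'rV[R]_s] `<=` Omega `*` setT by move=> p [Kp _]; split => //; exact: KO.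
  have Ht := wclass_sub (U' := fun=> Omega `*` setT) (B' := fun=> K `*` setT)
    (fun _ _ _ => I) (fun _ _ _ => I) (wclass_reindex (fun _ : unit => j) (@theta_cut_class R n s l)).
  have H := wclass_mul (@oU unit) BU (Hg l) Ht.
  pose B (t : unit) := (K `*` [set: 'rV[R]_s]) `&` S.
  have HB := wclass_sub (U' := fun=> Omega `*` setT) (B' := B) (fun _ _ h => h) (fun _ p h => h.1) H.
  apply: (@wclass_support _ _ _ (@xtdir R n s) _ unit (fun=> Omega `*` setT) B xw0 l (w m') _ (fun=> S)) => //.
    move=> t p /= nS; rewrite theta_cut_support ?mulr0//.
    by move: nS => /negP; rewrite -ltNge => /ltW.
  apply: wclass_le HB => //; exists ((j.+2%:R) `^ `|m - m'|); first exact: powR_ge0.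
  move=> t p [_ Sp]; rewrite mulr1 ger0_norm ?w0// /w /symbol_weight.
  have -> : jap p `^ m = jap p `^ (m - m') * jap p `^ m'.
    by rewrite -powRD ?subrK// (gt_eqF (jap_gt0 p)) implybT.
  rewrite ler_wpM2r ?powR_ge0//.
  apply: (@le_trans _ _ (jap p `^ `|m - m'|)).
    by apply: ler_powR; [exact: jap_ge1|exact: ler_norm].
  apply: ge0_ler_powR; rewrite ?nnegrE ?normr_ge0 ?(ltW (jap_gt0 _))//.
  by rewrite /jap -[j.+2]add1n natrD lerD2l.
apply: (class_symbol Omega_open) => K cK KO l.
  by rewrite re_regularized; apply: key => // l'; have [] := symbol_class Omega_open a_symbol cK KO l'.
by rewrite im_regularized; apply: key => // l'; have [] := symbol_class Omega_open a_symbol cK KO l'.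
Qed.

Lemma regularized_close al be K : compact K -> K `<=` Omega -> exists C : R, forall j,
  (symbol_seminorm (m + 1) al be K (fun p => (regularized j p - a p)%R) <= (C / j.+1%:R)%:E)%E.
Proof.
move=> cK KO.
have BU (t : nat) : K `*` [set: 'rV[R]_s] `<=` Omega `*` setT by move=> p [Kp _]; split => //; exact: KO.
pose w (j : nat) (p : X) := symbol_weight m p * (jap p / j.+1%:R).
have key g : (forall l, wcl unit K l (fun _ => symbol_weight m) (fun _ => g)) ->
    forall l, wcl nat K l w (fun j p => g p * theta_cut j p - g p).
  move=> Hg l.
  have Ht := wclass_sub (U' := fun=> Omega `*` setT) (B' := fun=> K `*` setT)
    (fun _ _ _ => I) (fun _ _ _ => I) (@theta_cut_sub1_class R n s l).
  have := wclass_mul (@oU nat) BU (wclass_reindex (fun _ : nat => tt) (Hg l)) Ht.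
  by apply: (wclass_ext (@oU nat) BU) => j p _; ring.
have [C HC] : exists C : R, forall j p, K p.1 ->
    cabs (xt_partials al be (fun p => regularized j p - a p) p) <= C * (w j p * (jap p) ^- mi_deg be).
  apply: (@class_xt_partials R n s Omega nat (fun j p => regularized j p - a p)) => l.
    have := key _ (fun l => (symbol_class Omega_open a_symbol cK KO l).1) l.
    apply: (wclass_ext (@oU nat) BU) => j p _.
    by rewrite /re_fun /regularized; case: (a p) => u v /=; rewrite mulr0 subr0.
  have := key _ (fun l => (symbol_class Omega_open a_symbol cK KO l).2) l.
  apply: (wclass_ext (@oU nat) BU) => j p _.
  by rewrite /im_fun /regularized; case: (a p) => u v /=; rewrite mulr0 add0r.
exists C => j; apply: symbol_seminorm_bound => p Kp; apply: le_trans (HC j p Kp) _.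
rewrite /w /symbol_weight powRD ?(gt_eqF (jap_gt0 p)) ?implybT// powRr1 ?(ltW (jap_gt0 p))//.
by rewrite le_eqVlt; apply/orP; left; apply/eqP; ring.
Qed.

End regularization.

Section symbol_limit.
Context {R : realType} {n s : nat} (Omega : set 'rV[R]_n).
Local Notation X := ('rV[R]_n * 'rV[R]_s)%type.
Hypothesis Omega_open : open Omega.
Variables (m : R) (a : X -> R[i]).
Hypothesis a_symbol : symbol Omega m a.

Lemma symbol_weaken : symbol Omega (m + 1) a.
Proof.
have xw0 := @xtweight_ge0 R n s.
have H K g (cK : compact K) (KO : K `<=` Omega) l :
  wclass (@xtdir R n s) (@xtweight R n s) (fun _ : unit => Omega `*` setT) (fun _ => K `*` setT) l
    (fun _ => symbol_weight m) (fun _ => g) ->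
  wclass (@xtdir R n s) (@xtweight R n s) (fun _ : unit => Omega `*` setT) (fun _ => K `*` setT) l
    (fun _ => symbol_weight (m + 1)) (fun _ => g).
  apply: wclass_le => //; exists 1 => // t p _; rewrite mul1r ger0_norm; last exact: ltW (symbol_weight_gt0 _ _).
  by apply: ler_powR; [exact: jap_ge1|rewrite lerDl].
apply: (class_symbol Omega_open) => K cK KO l.
  by apply: H => //; have [] := symbol_class Omega_open a_symbol cK KO l.
by apply: H => //; have [] := symbol_class Omega_open a_symbol cK KO l.
Qed.

Variables (phi : X -> R) (Dphi : (X -> R[i]) -> ('rV[R]_n -> R[i]) -> R[i]).
Hypothesis Dphi_osc : oscillatory_integral Omega phi Dphi.

Lemma regularized_limit f (eps : R) : test_function Omega f -> 0 < eps ->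
  exists j, cabs (Dphi (regularized a j) f - Dphi a f) < eps.
Proof.
move=> tf e0; have [_ _ H] := Dphi_osc.
have [F [de [fF FK de0 HF]]] := H _ _ _ _ symbol_weaken tf e0.
pose P (q : ('I_n -> nat) * ('I_s -> nat) * set 'rV[R]_n) (j : nat) :=
  (symbol_seminorm (m + 1) q.1.1 q.1.2 q.2 (fun p => (regularized a j p - a p)%R) < de%:E)%E.
have [q Fq|N HN] := finite_eventually (P := P) fF _.
  have [cK KO] := FK q.1.1 q.1.2 q.2 ltac:(by move: q Fq => [[? ?] ?]).
  have [C HC] := regularized_close Omega_open a_symbol q.1.1 q.1.2 cK KO.
  exists (Num.truncn (`|C| / de)) => j Nj; apply: le_lt_trans (HC j) _.
  rewrite lte_fin ltr_pdivrMr// mulrC -ltr_pdivrMr//.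
  apply: (@le_lt_trans _ _ (`|C| / de)); first by rewrite ler_wpM2r ?ler_norm// invr_ge0 ltW.
  by apply: lt_le_trans (truncnS_gt _) _; rewrite ler_nat ltnS.
exists N; apply: HF; first exact: (regularized_symbol Omega_open a_symbol).
by move=> al be K Fq; exact: (HN _ Fq N (leqnn N)).
Qed.

(** Bounds on the approximating integrals, being uniform in j, pass to the limit
through the continuity of D_phi on symbols of order m + 1. *)
Lemma regularized_bound f (B D : R) : test_function Omega f ->
  (forall j, `|complex.Re (Dphi (regularized a j) f)| <= B) ->
  (forall j, `|complex.Im (Dphi (regularized a j) f)| <= D) -> cabs (Dphi a f) <= B + D.
Proof.
move=> tf HB HD; apply/ler_addgt0Pr => e e0.
have e20 : 0 < e / 2 by rewrite divr_gt0.
have [j Hj] := regularized_limit tf e20.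
apply: le_trans (cabs_le _) _.
have h1 := le_trans (Re_le_cabs _) (ltW Hj); have h2 := le_trans (Im_le_cabs _) (ltW Hj).
move: (HB j) (HD j) h1 h2; case: (Dphi (regularized a j) f) => u v; case: (Dphi a f) => u' v' /=.
move=> k1 k2 k3 k4.
have i1 := ler_normB u (u - u'); have i2 := ler_normB v (v - v').
rewrite !opprB ![_ + (_ - _)]addrC !subrK in i1 i2; lra.
Qed.

End symbol_limit.

(** * The oscillatory integral as a real iterated integral *)
(** The inner integral of g need only exist where chi does not vanish, and there
it is obtained from that of chi g. *)
Section pairing.
Context {R : realType} {n s : nat} (Omega : set 'rV[R]_n).
Local Notation X := ('rV[R]_n * 'rV[R]_s)%type.
Local Notation mu k := (@lebesgue_tuple R k).
Variables (chi : 'rV[R]_n -> R) (g : X -> R[i]).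
Hypothesis chi0 : forall x, ~ Omega x -> chi x = 0.
Hypothesis cRe : continuous (fun p : X => chi p.1 * re_fun g p).
Hypothesis cIm : continuous (fun p : X => chi p.1 * im_fun g p).
Hypothesis bRe : box_supported (fun p : X => chi p.1 * re_fun g p).
Hypothesis bIm : box_supported (fun p : X => chi p.1 * im_fun g p).

Let section_integrable (h : X -> R) (x : 'rV[R]_n) : chi x != 0 ->
  continuous (fun p : X => chi p.1 * h p) -> box_supported (fun p : X => chi p.1 * h p) ->
  (mu s).-integrable setT (EFin \o (fun u => h (x, row_of u))).
Proof.
move=> x0 ch [b bh]; have [C HC] := compact_support_gauge2 ch bh.
have := integrable_row2_section x ch HC.
move=> /(integrableZl measurableT (chi x)^-1).
apply: eq_integrable => // u _ /=.
by rewrite -EFinM mulrA mulVf// mul1r.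
Qed.

Let inner (x : 'rV[R]_n) (al be : R) :
  chi x * (Rintegral (mu s) setT (fun u => re_fun g (x, row_of u)) * al +
           Rintegral (mu s) setT (fun u => im_fun g (x, row_of u)) * be) =
  Rintegral (mu s) setT (fun u => chi x * (re_fun g (x, row_of u) * al + im_fun g (x, row_of u) * be)).
Proof.
have [x0|x0] := eqVneq (chi x) 0.
  rewrite x0 mul0r /Rintegral (_ : (fun u => _) = cst 0%E); last first.
    by apply/funext => u; rewrite mul0r.
  by rewrite integral0.
have iR := section_integrable x0 cRe bRe; have iI := section_integrable x0 cIm bIm.
have iRa : (mu s).-integrable setT (EFin \o (fun u => re_fun g (x, row_of u) * al)).
  exact: (integrableZr measurableT al iR).
have iIa : (mu s).-integrable setT (EFin \o (fun u => im_fun g (x, row_of u) * be)).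
  exact: (integrableZr measurableT be iI).
rewrite RintegralZl//; last exact: (integrableD measurableT iRa iIa).
by rewrite RintegralD// !RintegralZr.
Qed.

Lemma cintegral_pairing (k : 'rV[R]_n) :
  cintegral Omega (fun x => cintegral [set: 'rV[R]_s] (fun theta => g (x, theta)) *
    ((chi x)%:C * expi (- dotp k x))) =
  iint (fun p => chi p.1 * (re_fun g p * cos (dotp k p.1) + im_fun g p * sin (dotp k p.1))) +i*
  iint (fun p => chi p.1 * (re_fun g p * (- sin (dotp k p.1)) + im_fun g p * cos (dotp k p.1))).
Proof.
have E (f : 'rV[R]_n -> R) (f' : n.-tuple (measurableTypeR R) -> R) :
   (forall x, ~ Omega x -> f x = 0) -> (forall t, f (row_of t) = f' t) ->
   Rintegral (mu n) (@row_of R n @^-1` Omega) (fun t => f (row_of t)) = Rintegral (mu n) setT f'.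
  move=> f0 ff'; rewrite Rintegral_mkcond; apply: eq_Rintegral => t _.
  rewrite /patch; case: ifPn => [_|]; first exact: ff'.
  by rewrite notin_setE /= -ff' => /f0.
rewrite /cintegral; congr (_ +i* _).
  apply: (E (fun x => complex.Re (cintegral [set: 'rV[R]_s] (fun theta => g (x, theta)) *
    ((chi x)%:C * expi (- dotp k x))))) => [x nx|t].
    by rewrite chi0// mul0r mulr0.
  rewrite /= -inner /cintegral /= preimage_setT cosN sinN.
  rewrite /re_fun /im_fun.
  ring.
apply: (E (fun x => complex.Im (cintegral [set: 'rV[R]_s] (fun theta => g (x, theta)) *
    ((chi x)%:C * expi (- dotp k x))))) => [x nx|t].
  by rewrite chi0// mul0r mulr0.
rewrite /= -inner /cintegral /= preimage_setT cosN sinN.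
rewrite /re_fun /im_fun.
ring.
Qed.

End pairing.

(** * Decay of the localized Fourier transform *)
Section conclusion.
Context {R : realType} {n s : nat} (Omega : set 'rV[R]_n).
Local Notation X := ('rV[R]_n * 'rV[R]_s)%type.
Local Notation D d := (@xtdir R n s d).
Hypothesis Omega_open : open Omega.
Variables (mu : R) (phi : X -> R).
Hypothesis phi_phase : phase_function Omega mu phi.
Variable Dphi : (X -> R[i]) -> ('rV[R]_n -> R[i]) -> R[i].
Hypothesis Dphi_osc : oscillatory_integral Omega phi Dphi.
Variables (m : R) (a : X -> R[i]).
Hypothesis a_symbol : symbol Omega m a.
Variables (x0 k0 : 'rV[R]_n) (delta c k1 : R).
Hypothesis delta0 : 0 < delta.
Hypothesis c0 : 0 < c.
Hypothesis k11 : 1 <= k1.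
Let K := [set x : 'rV[R]_n | `|x - x0| <= delta].
Hypothesis cK : compact K.
Hypothesis KO : K `<=` Omega.
Hypothesis lower : forall k x th, cone k0 delta k -> k1 <= enorm k -> `|x - x0| <= delta ->
  c * (jap ((x, th) : X) `^ mu + enorm k) ^+ 2 <=
  enorm (grad_x phi (x, th) - k) ^+ 2 + (1 + enorm th ^+ 2) * enorm (grad_theta phi (x, th)) ^+ 2.

Let r := delta / 2.
Let r0 : 0 < r. Proof. by rewrite divr_gt0. Qed.
Let rdelta : r < delta. Proof. by rewrite ltr_pdivrMr// ltr_pMr// ltr1n. Qed.
Let W := [set x : 'rV[R]_n | `|x - x0| < delta].
Let oW : open W.
Proof.
have -> : W = ball x0 delta.
  by apply/seteqP; split => x; rewrite -ball_normE /ball_/= distrC.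
exact: ball_open.
Qed.
Let ball_W (x : 'rV[R]_n) : `|x - x0| <= r -> W x.
Proof. by move=> xr; exact: le_lt_trans rdelta. Qed.
Let WK : W `<=` K. Proof. by move=> x; exact: ltW. Qed.
Let ball_Omega : [set x : 'rV[R]_n | `|x - x0| <= r] `<=` Omega.
Proof. by move=> x /ball_W/WK; exact: KO. Qed.

(** The parameters of the family of phases: the index of the regularization, on
which only the amplitudes depend, and the frequency. *)
Let T := (nat * {k : 'rV[R]_n | cone k0 delta k /\ k1 <= enorm k})%type.
Let ka (t : T) : 'rV[R]_n := sval t.2.
Let b (t : T) : R := t.1.+1%:R.
Let psi (t : T) (p : X) : R := phi p - dotp (ka t) p.1.
Let Wt (t : T) (p : X) : R := jap p `^ mu + enorm (ka t).
Let U := fun _ : T => W `*` [set: 'rV[R]_s].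
Let oU (t : T) : open (U t). Proof. exact: open_cylinder. Qed.
Let UU (t : T) : U t `<=` U t. Proof. by []. Qed.
Let xw0 := @xtweight_ge0 R n s.
Local Notation wcl := (wclass (@xtdir R n s) (@xtweight R n s) U U).

Let ka1 t : 1 <= enorm (ka t).
Proof. by apply: le_trans k11 _; rewrite /ka; have [] := svalP t.2. Qed.

Let Wt0 t p : 0 < Wt t p.
Proof. by rewrite ltr_wpDl ?powR_ge0// (lt_le_trans ltr01). Qed.

Let dotp_xtdir (k : 'rV[R]_n) (d : 'I_n + 'I_s) (p : X) :
  'D_(D d) (fun p : X => dotp k p.1) p = if d is inl i then k 0 i else 0.
Proof.
apply: derive_linear => h; case: d => [i|j] /=; first exact: dotp_shift.
by rewrite mulr0 add0r scaler0 add0r.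
Qed.

Let dotp_xtdiff (k : 'rV[R]_n) (p : X) : differentiable (fun p : X => dotp k p.1) p.
Proof.
apply: (@differentiable_bigsum _ _ _ _ (fun i (y : X) => k 0 i * y.1 0 i)) => i.
by apply: (differentiable_mul (f := fun=> k 0 i)) => //; exact: differentiable_coordx.
Qed.

Let dphi p : (W `*` [set: 'rV[R]_s]) p -> differentiable phi p.
Proof.
move=> [Wp _]; apply: (wclass_differentiable (phase_class Omega_open phi_phase cK KO 1) (t := tt)).
by split => //; exact/KO/WK.
Qed.

Let dpsi t p : U t p -> differentiable (psi t) p.
Proof.
move=> Up; apply: (differentiable_add (g := fun p : X => - dotp (ka t) p.1)).
  exact: dphi Up.
by apply: differentiableN; exact: dotp_xtdiff.
Qed.

Let derive_psi d t p : U t p ->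
  'D_(D d) (psi t) p = 'D_(D d) phi p - (if d is inl i then ka t 0 i else 0).
Proof.
move=> Up.
apply: etrans (deriveB (diff_derivable (dphi Up)) (diff_derivable (dotp_xtdiff (ka t) p))) _.
by rewrite dotp_xtdir.
Qed.

Let Dpsi d l : wcl l (fun t p => Wt t p * xtweight d p) (fun t => 'D_(D d) (psi t)).
Proof.
have w0 t p : 0 <= Wt t p * xtweight d p by rewrite mulr_ge0 ?xw0// ltW.
have H1 : wcl l (fun t p => Wt t p * xtweight d p) (fun _ => 'D_(D d) phi).
  have := wclass_derive d (phase_class Omega_open phi_phase cK KO l.+1).
  move=> /(wclass_reindex (fun _ : T => tt)).
  move=> /(wclass_sub (U' := U) (B' := U) _ _) H.
  apply: wclass_le (H _ _) => //; last 2 first.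
  - by move=> t p [/WK/KO Wp _]; split.
  - by move=> t p [/WK Wp _]; split.
  exists 1 => // t p _; have sw0 := ltW (symbol_weight_gt0 mu p).
  rewrite mul1r ger0_norm ?mulr_ge0//.
  by rewrite ler_wpM2r// lerDl (le_trans ler01).
have H2 : wcl l (fun t p => Wt t p * xtweight d p)
    (fun t _ => - (if d is inl i then ka t 0 i else 0)).
  apply: (@wclass_cst _ _ _ _ _ _ _ _ xw0 oU UU _ _ (fun t => - (if d is inl i then ka t 0 i else 0))) => //.
  exists 1 => t p _; rewrite normrN mul1r; case: d w0 {H1} => [i|j] w0; last by rewrite normr0.
  by rewrite /= mulr1 (le_trans (enorm_coord _ _))// lerDr powR_ge0.
apply: (wclass_ext oU UU) (wclass_add oU UU H1 H2) => t p Up.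
by rewrite derive_psi.
Qed.

Let Qlow : exists2 c : R, 0 < c & forall t p, U t p -> c * Wt t p ^+ 2 <= grad_sqr psi t p.
Proof.
exists c => // t [x th] Up; have [[ck kk] [Wx _]] := (svalP t.2, Up).
apply: le_trans (lower th ck kk (WK Wx)) _.
rewrite /grad_sqr big_sumType/= !enorm_sqr mulr_sumr le_eqVlt; apply/orP; left; apply/eqP.
congr (_ + _); apply: eq_bigr => i _; first by rewrite mul1r !mxE (derive_psi (inl i)).
by rewrite !mxE (derive_psi (inr i))// subr0.
Qed.

Let amp := amplitude W x0 r b (fun (_ : T) (p : X) => jap p `^ m).

Let cut_amplitude h :
  (forall l, wclass (@xtdir R n s) (@xtweight R n s) (fun _ : unit => Omega `*` setT)
     (fun _ => K `*` setT) l (fun _ => symbol_weight m) (fun _ => h)) ->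
  amp (fun t p => space_cut x0 r p.1 * (h p * theta_cut t.1 p)).
Proof.
move=> Hh; split => [l|t p nS]; last first.
  have [p1|p1] := leP `|p.1 - x0| r; last first.
    by rewrite space_cut_ball ?mul0r//; apply/negP; rewrite -ltNge.
  rewrite theta_cut_support ?mulr0 ?mulr0//.
  have [p2|p2] := leP `|p.2| (b t); first by case: nS.
  exact: le_trans (ltW p2) (norm_le_enorm _).
have H1 : wcl l (fun _ => symbol_weight m) (fun _ => h).
  apply: wclass_sub (wclass_reindex (fun _ : T => tt) (Hh l)) => t p [Wp _]; split => //.
    exact/KO/WK.
  exact: WK.
have H2 : wcl l (fun _ _ => 1) (fun t => theta_cut t.1).
  exact: wclass_sub (wclass_reindex (fun t : T => t.1) (@theta_cut_class R n s l)).
have H3 : wcl l (fun _ _ => 1) (fun _ p => space_cut x0 r p.1).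
  exact: wclass_sub (space_cut_xt_class x0 r0 s T l).
apply: (wclass_eqw xw0) (wclass_mul oU UU H3 (wclass_mul oU UU H1 H2)) => t p _.
  by rewrite mul1r mulr1.
by rewrite mul1r mulr1 powR_ge0.
Qed.

Let f (t : T) (p : X) : R := space_cut x0 r p.1 * (re_fun a p * theta_cut t.1 p).
Let g (t : T) (p : X) : R := space_cut x0 r p.1 * (im_fun a p * theta_cut t.1 p).

Let amp_f : amp f.
Proof. by apply: cut_amplitude => l; have [] := symbol_class Omega_open a_symbol cK KO l. Qed.

Let amp_g : amp g.
Proof. by apply: cut_amplitude => l; have [] := symbol_class Omega_open a_symbol cK KO l. Qed.

Let phased j (p : X) : R[i] := regularized a j p * expi (phi p).

Let re_phased j p : re_fun (phased j) p =
  re_fun (regularized a j) p * cos (phi p) - im_fun (regularized a j) p * sin (phi p).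
Proof. by rewrite /phased /re_fun /im_fun; case: (regularized a j p). Qed.

Let im_phased j p : im_fun (phased j) p =
  re_fun (regularized a j) p * sin (phi p) + im_fun (regularized a j) p * cos (phi p).
Proof. by rewrite /phased /re_fun /im_fun; case: (regularized a j p). Qed.

Let cut_phased (t : T) (h h' : R -> R) : (forall y, derivable h y 1) -> (forall y, derivable h' y 1) ->
  let F (p : X) := f t p * h (phi p) + g t p * h' (phi p) in
  continuous F /\ box_supported F.
Proof.
move=> dh dh' F.
have F0 p : ~ [set p : X | `|p.1 - x0| <= r /\ `|p.2| <= b t] p -> F p = 0.
  by move=> nS; rewrite /F amp_f.2// amp_g.2// !mul0r addr0.
split; last exact: (@tube_box_supported _ _ _ _ _ _ b _ t F0).
apply: (@tube_continuous _ _ _ _ W x0 r b ball_W F t F0) => q Uq.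
apply: differentiable_add; apply: differentiable_mul.
- exact: (wclass_differentiable (amp_f.1 1%N) (t := t)).
- by apply: differentiable_comp1; [exact: dphi|exact: dh].
- exact: (wclass_differentiable (amp_g.1 1%N) (t := t)).
- by apply: differentiable_comp1; [exact: dphi|exact: dh'].
Qed.

Let trig_shift (x u v y z : R) :
  x * ((u * cos y - v * sin y) * cos z + (u * sin y + v * cos y) * sin z) =
    x * u * cos (y - z) + - (x * v) * sin (y - z) /\
  x * ((u * cos y - v * sin y) * - sin z + (u * sin y + v * cos y) * cos z) =
    x * v * cos (y - z) + x * u * sin (y - z).
Proof. by rewrite cosB sinB; split; ring. Qed.

Lemma regularized_pairing (t : T) :
  Dphi (regularized a t.1) (modulated x0 r (ka t)) =
    osc psi f (fun t p => - g t p) t +i* osc psi g f t.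
Proof.
have [_ H _] := Dphi_osc.
have tf := modulated_test r0 ball_Omega (ka t).
rewrite (H (- s%:R - 1) _ _ _ (regularized_symbol Omega_open a_symbol _ _) tf); last by rewrite gtrBl.
have [cr br] := @cut_phased t cos (fun y => - sin y) (@derivable_cos R) (fun y => derivableN (@derivable_sin R y)).
have [ci bi] := @cut_phased t sin cos (@derivable_sin R) (@derivable_cos R).
have Er : (fun p : X => space_cut x0 r p.1 * re_fun (phased t.1) p) =
    (fun p => f t p * cos (phi p) + g t p * - sin (phi p)).
  by apply/funext => p; rewrite re_phased re_regularized im_regularized /f /g; ring.
have Ei : (fun p : X => space_cut x0 r p.1 * im_fun (phased t.1) p) =
    (fun p => f t p * sin (phi p) + g t p * cos (phi p)).
  by apply/funext => p; rewrite im_phased re_regularized im_regularized /f /g; ring.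
have := @cintegral_pairing R n s Omega (space_cut x0 r) (phased t.1).
rewrite Er Ei => /(_ _ cr ci br bi (ka t)) ->; last first.
  by move=> x nO; apply: space_cut_ball => // /ball_Omega.
apply: f_equal2.
  apply: f_equal; apply/funext => p.
  by rewrite re_phased im_phased re_regularized im_regularized (trig_shift _ _ _ _ _).1.
apply: f_equal; apply/funext => p.
by rewrite re_phased im_phased re_regularized im_regularized (trig_shift _ _ _ _ _).2.
Qed.

(** The real and imaginary parts of D_phi(a_j) at chi e^(- i k . x) are the
integrals of [regularized_pairing], to which [nonstationary_decay] applies with
constants independent of j. *)
Lemma large_frequency_decay (N : nat) : exists C : R, forall k, cone k0 delta k -> k1 <= enorm k ->
  cabs (Dphi a (modulated x0 r k)) <= C * enorm k ^- N.
Proof.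
have [mu0 _ _] := phi_phase.
have decay := nonstationary_decay oW ball_W Wt0 dpsi Dpsi Qlow mu0 ka1 (fun t p => erefl).
have [C HC] := decay _ _ _ _ N amp_f (amplitude_opp oW amp_g).
have [C' HC'] := decay _ _ _ _ N amp_g amp_f.
exists (C + C') => k ck kk; rewrite mulrDl.
have tf := modulated_test r0 ball_Omega k.
pose t j : T := (j, exist _ k (conj ck kk)).
apply: (regularized_bound Omega_open a_symbol Dphi_osc tf) => j.
  by have := HC (t j); rewrite (regularized_pairing (t j)).
by have := HC' (t j); rewrite (regularized_pairing (t j)).
Qed.

(** Outside a ball of frequencies, rapid decay comes from the integrals; inside,
the distribution is bounded on the test functions chi e^(- i k . x). *)
Lemma not_in_wave_front : ~ wave_front_set Omega (Dphi a) (x0, k0).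
Proof.
move=> [Ox0 k00]; apply; exists (modulated x0 r 0), (cone k0 delta).
have [dist _ _] := Dphi_osc.
have [_ HD] := dist a (ex_intro _ m a_symbol).
have cB := @compact_norm_ball _ _ x0 r.
have [C [M HM]] := HD _ cB ball_Omega.
have E k : (fun x => modulated x0 r 0 x * expi (- dotp k x)) = modulated x0 r k.
  apply/funext => x; rewrite /modulated; congr (_ * _).
  by rewrite /dotp big1 ?oppr0 /expi ?cos0 ?sin0 ?mulr1// => i _; rewrite mxE mul0r.
split.
- exact: modulated_test.
- rewrite /modulated /= mulf_neq0//.
    by rewrite eq_complex /= eqxx andbT gt_eqF// space_cut_center.
  rewrite /dotp big1 => [|i _]; last by rewrite mxE mul0r.
  by rewrite oppr0 /expi cos0 sin0 eq_complex /= oner_eq0.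
- by split; [exact: cone_open|exact: cone_center].
- by move=> lam k l0; exact: cone_scale.
move=> N; rewrite /cutoff_fourier.
have [C1 HC1] := large_frequency_decay N.
have [B HB] := @modulated_partials R n x0 r r0 k1 M.
exists (2 ^+ N * `|C1| + (1 + k1) ^+ N * `|C * B|) => k ck; rewrite E.
have k_ge0 := enorm_ge0 k.
have [kk|kk] := leP k1 (enorm k).
  have e0 : 0 < enorm k by apply: lt_le_trans kk; apply: lt_le_trans k11.
  apply: ler_wpDr; first by rewrite mulr_ge0// exprn_ge0// addr_ge0// (le_trans ler01).
  apply: (@le_trans _ _ ((2 * enorm k) ^+ N * (`|C1| * enorm k ^- N))).
    apply: ler_pM; rewrite ?cabs_ge0 ?exprn_ge0 ?addr_ge0//.
      rewrite lerXn2r ?nnegrE ?addr_ge0 ?mulr_ge0//.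
      by have := le_trans k11 kk; lra.
    apply: le_trans (HC1 k ck kk) _; rewrite ler_wpM2r ?ler_norm// invr_ge0 exprn_ge0//.
  by rewrite exprMn mulrACA divff ?mulr1// gt_eqF// exprn_gt0.
apply: ler_wpDl; first by rewrite mulr_ge0// exprn_ge0.
apply: ler_pM; rewrite ?cabs_ge0 ?exprn_ge0 ?addr_ge0//.
  by rewrite lerXn2r ?nnegrE ?addr_ge0 ?(le_trans ler01 k11)// lerD2l ltW.
apply: le_trans (ler_norm (C * B)).
apply: HM.
- exact: modulated_test.
- exact: modulated_supp.
- move=> al x alM; apply: HB => //; apply: le_trans (norm_le_enorm _) (ltW kk).
Qed.

End conclusion.

Theorem theorem3p5 (R : realType) (n s : nat) (Omega : set 'rV[R]_n)
    (Omega_open : open Omega) (mu : R) (phi : 'rV[R]_n * 'rV[R]_s -> R)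
    (phi_phase : phase_function Omega mu phi)
    (Dphi : ('rV[R]_n * 'rV[R]_s -> R[i]) -> ('rV[R]_n -> R[i]) -> R[i])
    (Dphi_osc : oscillatory_integral Omega phi Dphi)
    (a : 'rV[R]_n * 'rV[R]_s -> R[i]) (a_symbol : symbol_any Omega a) :
  wave_front_set Omega (Dphi a) `<=` SP_set Omega mu phi.
Proof.
move=> [x0 k0] wf; apply: contrapT => notSP.
have [Ox0 k00 _] := wf; have [m am] := a_symbol.
have [delta [c [k1 [d0 c0 k11 [cK KO] low]]]] :=
  gradient_lower Omega_open phi_phase Ox0 k00 notSP.
exact: (not_in_wave_front Omega_open phi_phase Dphi_osc am d0 c0 k11 cK KO low wf).
Qed.
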